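(* Let $p$ be an odd prime, let $F$ be a field and let $A$ be a central division $F$-algebra of degree $p^2$ containing a Galois extension $K/F$ of degree $p$. Suppose there are two discrete valuations $v_1,v_2$ of $F$ such that: (1) $v_1$ and $v_2$ extend to valuations of $A$; (2) $K/F$ is totally ramified for $v_1$, $\mathrm{char}\,\overline{F}_{v_1}\neq p$, and $\mu_{p^2}\not\subset\overline{F}_{v_1}$ (i.e. $\overline{F}_{v_1}$ contains no primitive $(p^2)$-th root of unity); (3) $K/F$ is inertial for $v_2$, $\overline{F}_{v_2}$ is finite, and $|\overline{F}_{v_2}|\not\equiv 0,1 \bmod p$. Then $A$ has no maximal subfield $M$ containing $K$ such that $M/F$ is a Galois extension. Consequently, for every totally ordered abelian (additive) group $\Gamma$ and every surjective homomorphism $\varepsilon:\Gamma\to\mathrm{Gal}[K/F]$, the Mal'cev-Neumann ring $\mathcal{D}=C_A(K)((\Gamma))$ is a noncrossed product division algebra.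
   Context: $\overline{F}_v$ denotes the residue field of $F$ for a valuation $v$. The degree of a central division $F$-algebra $A$ is $\sqrt{[A:F]}$. A valuation on a division algebra $A$ is a map $w$ from $A$ to a totally ordered abelian group with $\infty$ adjoined such that $w(x)=\infty\iff x=0$, $w(x+y)\ge\min\{w(x),w(y)\}$, $w(xy)=w(x)+w(y)$. A finite extension $K/F$ is totally ramified for $v$ if $v$ has an extension to $K$ with ramification index $[K:F]$; it is inertial for $v$ if $v$ has an extension to $K$ whose residue field is a separable extension of $\overline{F}_v$ of degree $[K:F]$. $C_A(K)$ is the centralizer of $K$ in $A$ and $G=\mathrm{Gal}[K/F]$. Construction of the Mal'cev-Neumann ring $C_A(K)((\Gamma))$: by the Skolem-Noether theorem, for each $\sigma\in G$ choose $u_\sigma\in A^\times$ with $x^\sigma=u_\sigma^{-1}xu_\sigma$ for all $x\in K$, with $u_{\mathrm{Id}}=1$. The elements of $C_A(K)((\Gamma))$ are formal series $\sum_{\gamma\in\Gamma}a_\gamma r_\gamma$ in indeterminates $a_\gamma$, with $r_\gamma\in C_A(K)$, whose support $\{\gamma\in\Gamma\mid r_\gamma\ne 0\}$ is well-ordered. Addition is componentwise; multiplication is determined by the rules $r a_\gamma=a_\gamma\,(u_{\varepsilon(\gamma)}^{-1}ru_{\varepsilon(\gamma)})$ for $r\in C_A(K)$, $\gamma\in\Gamma$, and $a_\gamma a_\delta=a_{\gamma+\delta}\,u_{\varepsilon(\gamma)\varepsilon(\delta)}^{-1}u_{\varepsilon(\gamma)}u_{\varepsilon(\delta)}$ for $\gamma,\delta\in\Gamma$.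 This is a well-defined associative ring. A finite-dimensional central simple algebra over a field $E$ is a crossed product if it contains a maximal commutative subalgebra that is a Galois field extension of $E$. A noncrossed product division algebra is a division algebra, finite-dimensional over its center, that is not a crossed product over its center. *)

(* Defs.v *)
From HB Require Import structures.
From mathcomp Require Import all_boot all_order all_algebra all_fingroup.
From mathcomp Require Import all_field ring_quotient generic_quotient.
From mathcomp Require Import boolp classical_sets cardinality fsbigop.

Set Implicit Arguments.
Unset Strict Implicit.
Unset Printing Implicit Defensive.

Import Order.TTheory GRing.Theory Num.Theory.

Local Open Scope classical_set_scope.
Local Open Scope ring_scope.

HB.mixin Record POrderedZmodule_isOrdAbGroup G of Num.POrderedZmodule G := {
  lex_total : total (<=%R : rel G);
  lexD2r : forall z x y : G, x <= y -> x + z <= y + z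
}.

#[short(type="ordAbGroupType")]
HB.structure Definition OrdAbGroup :=
  {G of Num.POrderedZmodule G & POrderedZmodule_isOrdAbGroup G}.

Fact int_lexD2r (z x y : int) : x <= y -> x + z <= y + z.
Proof. by rewrite lerD2r. Qed.

HB.instance Definition _ :=
  POrderedZmodule_isOrdAbGroup.Build int le_total int_lexD2r.

Section OrdAbGroupTheory.
Variable G : ordAbGroupType.
Implicit Types x y z : G.

Lemma ltxNge x y : (x < y) = ~~ (y <= x).
Proof. exact/comparable_ltNge/lex_total. Qed.

Lemma lexNgt x y : (x <= y) = ~~ (y < x).
Proof. exact/comparable_leNgt/lex_total. Qed.

Lemma lexD2rE z x y : (x + z <= y + z) = (x <= y).
Proof.
apply/idP/idP => [/(lexD2r (- z))|]; last exact: lexD2r.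
by rewrite !addrK.
Qed.

Lemma lexD2lE z x y : (z + x <= z + y) = (x <= y).
Proof. by rewrite ![z + _]addrC lexD2rE. Qed.

Lemma lexD x y z t : x <= y -> z <= t -> x + z <= y + t.
Proof.
move=> xy zt; apply: (@le_trans _ _ (y + z)); first by rewrite lexD2rE.
by rewrite lexD2lE.
Qed.

Lemma lexD2rtE z x y : (x + z < y + z) = (x < y).
Proof. by rewrite !ltxNge lexD2rE. Qed.

Lemma lexD2ltE z x y : (z + x < z + y) = (x < y).
Proof. by rewrite !ltxNge lexD2lE. Qed.

Lemma addxx_eq0 x : x + x = 0 -> x = 0.
Proof.
move=> xx0; apply/eqP; rewrite eq_le; apply/andP; split.
  by rewrite lexNgt; apply/negP => x0; move: x0 (x0); rewrite -{1}(lexD2rtE x) add0r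
    xx0 => /lt_trans h /h; rewrite ltxx.
by rewrite lexNgt; apply/negP => x0; move: x0 (x0); rewrite -{1}(lexD2rtE x) add0r
  xx0 => h /lt_trans /(_ h); rewrite ltxx.
Qed.

End OrdAbGroupTheory.

(* [option G] is the group with [None] adjoined as infinity. *)
Section Infinity.
Variable G : ordAbGroupType.
Implicit Types a b : option G.

Definition infty_add a b : option G :=
  if a is Some x then if b is Some y then Some (x + y) else None else None.

Definition infty_le a b : bool :=
  if b is Some y then if a is Some x then x <= y else false else true.

Definition infty_min a b : option G := if infty_le a b then a else b.

End Infinity.

Record valuation (R : nzRingType) (G : ordAbGroupType) := Valuation {
  val_fun :> R -> option G;
  val_infty : forall x, val_fun x = None <-> x = 0;
  val_add : forall x y,
    infty_le (infty_min (val_fun x) (val_fun y)) (val_fun (x + y));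
  val_mul : forall x y, val_fun (x * y) = infty_add (val_fun x) (val_fun y)
}.

Definition value_group (R : nzRingType) (G : ordAbGroupType)
  (w : valuation R G) : set G := [set g | exists x, w x = Some g].

(* Every valuation with infinite cyclic value group is equivalent to a
   normalized one. *)
Definition discrete (F : fieldType) (v : valuation F int) : Prop :=
  value_group v = setT.

(* The value group of [v] is identified with a subgroup of that of [w] through
   an order embedding [phi]. *)
Definition extends (R S : nzRingType) (G H : ordAbGroupType) (f : R -> S)
    (v : valuation R G) (w : valuation S H) : Prop :=
  exists phi : G -> H, [/\ {morph phi : x y / x + y},
    {mono phi : x y / x <= y} & forall x, w (f x) = omap phi (v x)].

Section ResidueField.
Variables (L : fieldType) (G : ordAbGroupType) (v : valuation L G).

Lemma val0 : v 0 = None. Proof. exact/val_infty. Qed.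

Lemma val_neq0 x : x != 0 -> exists g, v x = Some g.
Proof.
case E : (v x) => [g|]; first by exists g.
by move/val_infty: E => ->; rewrite eqxx.
Qed.

Lemma val1 : v 1 = Some 0.
Proof.
have [g vg] := val_neq0 (oner_neq0 L).
have := val_mul v 1 1; rewrite mulr1 vg /= => -[] /esym.
by rewrite -[RHS]addr0 => /addrI ->.
Qed.

Lemma valN1 : v (-1) = Some 0.
Proof.
have [|g vg] := @val_neq0 (-1); first by rewrite oppr_eq0 oner_eq0.
have := val_mul v (-1) (-1); rewrite mulrNN mulr1 vg val1 /= => -[] /esym.
by move/addxx_eq0 ->.
Qed.

Lemma valN x : v (- x) = v x.
Proof.
by rewrite -mulN1r val_mul valN1; case: (v x) => //= g; rewrite add0r.
Qed.

Lemma infty_le_min (a b c : option G) :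
  infty_le c (infty_min a b) = infty_le c a && infty_le c b.
Proof.
rewrite /infty_min; case: a b c => [a|] [b|] [c|] //=; rewrite ?andbT //.
  case: ifP => [ab|/negbT]; last rewrite -ltxNge => /ltW ab.
    by apply/esym/andb_idr => /le_trans; apply.
  by apply/esym/andb_idl => /le_trans; apply.
by case: ifP.
Qed.

Lemma infty_le_trans (b a c : option G) :
  infty_le a b -> infty_le b c -> infty_le a c.
Proof. by case: a b c => [a|] [b|] [c|] //=; apply: le_trans. Qed.

Lemma val_geD c x y :
  infty_le c (v x) -> infty_le c (v y) -> infty_le c (v (x + y)).
Proof.
move=> cx cy; apply: infty_le_trans (val_add v x y).
by rewrite infty_le_min cx.
Qed.

Definition valring : {pred L} := [pred x | infty_le (Some 0) (v x)].

Fact valring_subring_closed : subring_closed valring.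
Proof.
split=> [|x y|x y]; rewrite !inE /=.
- by rewrite val1 /=.
- by move=> vx vy; apply: val_geD => //; rewrite valN.
- rewrite val_mul; case: (v x) (v y) => [a|] [b|] //= a0 b0.
  by rewrite -[0]addr0 lexD.
Qed.

HB.instance Definition _ :=
  GRing.isSubringClosed.Build L valring valring_subring_closed.

Record valring_sub := ValringSub {
  valring_val :> L; _ : valring_val \in valring }.

HB.instance Definition _ := [isSub for valring_val].
HB.instance Definition _ := [Choice of valring_sub by <:].
HB.instance Definition _ := [SubChoice_isSubComNzRing of valring_sub by <:].

Definition valmax : {pred valring_sub} :=
  [pred x | ~~ infty_le (v (val x)) (Some 0)].

Lemma valmaxE x : (x \in valmax) = ~~ infty_le (v (val x)) (Some 0).
Proof. by []. Qed.

Fact valmax_idealr : idealr_closed valmax.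
Proof.
split; first by rewrite inE /= val0.
  by rewrite inE /= val1 /= lexx.
move=> a x y; rewrite !valmaxE /= => vx vy.
have {}vx : ~~ infty_le (v (val a * val x)) (Some 0).
  rewrite val_mul; case: a => a /=; rewrite inE /=.
  move: vx; case: (v a) (v (val x)) => [b|] [c|] //=.
  rewrite -!ltxNge => c0 b0; apply: (lt_le_trans c0).
  by rewrite -{1}[c]add0r lexD2rE.
have := val_add v (val a * val x) (val y); move: vx vy.
rewrite /infty_min; case: (v (_ * _)) (v (val y)) => [b|] [c|] //=.
- move=> b0 c0; case: (v _) => [d|] //=; case: ifP => _ /= h.
  + by apply: contra b0; apply: le_trans.
  + by apply: contra c0; apply: le_trans.
- move=> b0 _; case: (v _) => [d|] //= h.
  by apply: contra b0; apply: le_trans.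
- move=> _ c0; case: (v _) => [d|] //= h.
  by apply: contra c0; apply: le_trans.
- by case: (v _).
Qed.

HB.instance Definition _ := isIdealr.Build valring_sub valmax valmax_idealr.

Definition residue_field : Type := {ideal_quot valmax}.

HB.instance Definition _ := GRing.ComNzRing.on residue_field.

(* Total: elements outside the valuation ring are sent to 0. *)
Definition residue (x : L) : residue_field :=
  \pi_({ideal_quot valmax})%qT (insubd (0 : valring_sub) x).

Definition residue_inv (q : residue_field) : residue_field :=
  if q == 0 then 0 else residue (val (repr (q : {ideal_quot valmax})))^-1.

Fact residue_mulVf q : q != 0 -> residue_inv q * q = 1.
Proof.
move=> q0; rewrite /residue_inv (negPf q0).
move: (q0); rewrite -{1 3}[q](@reprK _ {ideal_quot valmax}).
set x := repr _ => x0.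
have vx0 : v (val x) = Some 0.
  have : x \notin valmax.
    apply: contra x0 => xm; apply/eqP; rewrite -[0](@rmorph0 _ _ (\pi_({ideal_quot valmax})%qT)).
    by apply/eqP; rewrite -Quotient.idealrBE subr0.
  rewrite valmaxE negbK; have /= := valP x; rewrite inE /=.
  by case: (v (val x)) => [g|] //= g0 g1; congr Some; apply/eqP; rewrite eq_le g1.
have nx0 : val x != 0 by apply/eqP => /(val_infty v _).2; rewrite vx0.
have vV : v (val x)^-1 = Some 0.
  have := val_mul v (val x)^-1 (val x); rewrite mulVf // val1 vx0.
  by case: (v _) => [g|] //= [] /esym; rewrite addr0 => ->.
have iV : (val x)^-1 \in valring by rewrite inE /= vV /=.
rewrite /residue.
rewrite -[LHS](@rmorphM _ _ (\pi_({ideal_quot valmax})%qT)).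
rewrite -[RHS](@rmorph1 _ _ (\pi_({ideal_quot valmax})%qT)); congr (\pi_({ideal_quot valmax})%qT _).
by apply: val_inj; rewrite /= insubdK // mulVf.
Qed.

Fact residue_invr0 : residue_inv 0 = 0.
Proof. by rewrite /residue_inv eqxx. Qed.

HB.instance Definition _ :=
  GRing.ComNzRing_isField.Build residue_field residue_mulVf residue_invr0.

End ResidueField.

Definition has_index (G : zmodType) (H1 H2 : set G) (n : nat) : Prop :=
  exists r : 'I_n -> G, (forall i, H1 (r i)) /\
    forall g, H1 g -> exists! i, H2 (g - r i).

Definition totally_ramified (F : fieldType) (G : ordAbGroupType)
    (v : valuation F G) (K : fieldExtType F) : Prop :=
  exists (H : ordAbGroupType) (w : valuation K H),
    extends (fun x : F => x%:A) v w /\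
    has_index (value_group w) [set h | exists x : F, w x%:A = Some h]
      (\dim {:K}).

(* [h] identifies the residue field of [w] with an extension [L] of that of
   [v], compatibly with the canonical map between the two residue fields. *)
Definition inertial (F : fieldType) (G : ordAbGroupType)
    (v : valuation F G) (K : fieldExtType F) : Prop :=
  exists (H : ordAbGroupType) (w : valuation K H)
      (L : fieldExtType (residue_field v)) (h : {rmorphism L -> residue_field w}),
    [/\ extends (fun x : F => x%:A) v w,
        bijective h,
        forall x : F, x \in valring v -> h (residue v x)%:A = residue w x%:A,
        separable 1 {:L}
      & \dim {:L} = \dim {:K}].

Section Rings.
Variable D : nzRingType.
Implicit Types S T : set D.

Definition division_ring : Prop :=
  forall x : D, x != 0 -> exists y, y * x = 1 /\ x * y = 1.

Definition ring_center : set D := [set z | forall x, z * x = x * z].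

Definition finite_dim_over_center : Prop :=
  exists (n : nat) (b : 'I_n -> D), forall x, exists c : 'I_n -> D,
    (forall i, ring_center (c i)) /\ x = \sum_i c i * b i.

Definition comm_subring S : Prop :=
  [/\ S 1, forall x y, S x -> S y -> S (x - y),
      forall x y, S x -> S y -> S (x * y)
    & forall x y, S x -> S y -> x * y = y * x].

Definition subfield S : Prop :=
  comm_subring S /\
  forall x, S x -> x != 0 -> exists2 y, S y & x * y = 1.

Definition maximal_subfield S : Prop :=
  subfield S /\ forall T, subfield T -> S `<=` T -> T `<=` S.

Definition comm_subalg S : Prop := comm_subring S /\ ring_center `<=` S.

Definition maximal_comm_subalg S : Prop :=
  comm_subalg S /\ forall T, comm_subalg T -> S `<=` T -> T `<=` S.

(* [j] embeds the Galois extension [M/E] in [D], with [E] mapped onto the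
   center of [D]. *)
Definition crossed_product : Prop :=
  exists (E : fieldType) (M : splittingFieldType E) (j : {rmorphism M -> D}),
    [/\ range (fun a : E => j a%:A) = ring_center,
        galois 1 {:M}
      & maximal_comm_subalg (range j)].

Definition noncrossed_product_division_algebra : Prop :=
  [/\ division_ring, finite_dim_over_center & ~ crossed_product].

End Rings.

Definition well_ordered (G : porderZmodType) (A : set G) : Prop :=
  forall S : set G, S `<=` A -> S !=set0 ->
    exists2 m, S m & forall x, S x -> m <= x.

Section WellOrdered.
Variable G : ordAbGroupType.
Implicit Types A B S : set G.

Lemma well_orderedS A B : A `<=` B -> well_ordered B -> well_ordered A.
Proof. by move=> AB wB S SA; apply: wB; apply: subset_trans AB. Qed.

Lemma well_ordered1 (x : G) : well_ordered [set x].
Proof.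
move=> S S1 [y Sy]; exists y => // z Sz.
by rewrite (S1 _ Sy) (S1 _ Sz) lexx.
Qed.

Lemma well_orderedU A B :
  well_ordered A -> well_ordered B -> well_ordered (A `|` B).
Proof.
move=> wA wB S SAB [x Sx].
have [[a Aa]|nA] := pselect ((S `&` A) !=set0); last first.
  apply: wB; last by exists x.
  by move=> y Sy; case: (SAB y Sy) => // Ay; case: nA; exists y.
have [[b Bb]|nB] := pselect ((S `&` B) !=set0); last first.
  apply: wA; last by exists x.
  by move=> y Sy; case: (SAB y Sy) => // By; case: nB; exists y.
have [m [Sm Am] mP] := wA (S `&` A) (@subIsetr _ _ _) (ex_intro _ a Aa).
have [n [Sn Bn] nP] := wB (S `&` B) (@subIsetr _ _ _) (ex_intro _ b Bb).
have /orP[mn|nm] := lex_total m n.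
  exists m => // y Sy; case: (SAB y Sy) => ?; first exact: mP.
  by apply: (le_trans mn); apply: nP.
exists n => // y Sy; case: (SAB y Sy) => ?; last exact: nP.
by apply: (le_trans nm); apply: mP.
Qed.

Lemma well_orderedD A B : well_ordered A -> well_ordered B ->
  well_ordered [set x | exists2 a, A a & B (x - a)].
Proof.
move=> wA wB U UAB [u0 Uu0].
apply: contrapT => nmin.
have ltU u : U u -> exists2 u', U u' & u' < u.
  move=> Uu; apply: contrapT => nu; apply: nmin; exists u => // x Ux.
  by rewrite lexNgt; apply/negP => xu; apply: nu; exists x.
pose good a b := [/\ A a, B b, U (a + b) &
  forall a' b', A a' -> B b' -> U (a' + b') -> a' + b' < a + b -> a <= a'].
have next c : U c -> exists a b, [/\ good a b, a + b < c &
    forall a' b', A a' -> B b' -> U (a' + b') -> a' + b' < c -> a <= a'].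
  move=> Uc; have [c' Uc' c'c] := ltU c Uc.
  pose S := [set a | A a /\ exists b, [/\ B b, U (a + b) & a + b < c]].
  have [a [Aa [b [Bb Uab abc]]] amin] : exists2 m, S m & forall x, S x -> m <= x.
    apply: wA; first by move=> x [].
    have [a Aa Ba] := UAB _ Uc'; exists a; split=> //; exists (c' - a).
    by rewrite addrCA subrr addr0.
  exists a, b; split=> //; last first.
    by move=> a' b' Aa' Bb' Uab' lt'; apply: amin; split=> //; exists b'.
  split=> // a' b' Aa' Bb' Uab' lt'; apply: amin; split=> //; exists b'.
  by split=> //; apply: lt_trans abc.
pose T := [set b | exists a, good a b].
have [b [a gab] bmin] : exists2 m, T m & forall x, T x -> m <= x.
  apply: wB; first by move=> b [a []].
  by have [a [b [gab _ _]]] := next _ Uu0; exists b, a.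
have [Aa Bb Uab aP] := gab.
have [a' [b' [gab' lt' _]]] := next _ Uab.
have [Aa' Bb' Uab' _] := gab'.
have aa' := aP _ _ Aa' Bb' Uab' lt'.
have := bmin b' (ex_intro _ a' gab').
rewrite lexNgt => /negP; apply.
rewrite -(lexD2ltE a); apply: le_lt_trans lt'.
by rewrite lexD2rE.
Qed.

Lemma well_ordered_fiber A B (x : G) : well_ordered A -> well_ordered B ->
  finite_set [set a | A a /\ B (x - a)].
Proof.
move=> wA wB; set E := [set a | _].
have minE S : S `<=` E -> S !=set0 -> exists2 m, S m & forall y, S y -> m <= y.
  by move=> SE; apply: wA => a /SE[].
have maxE S : S `<=` E -> S !=set0 -> exists2 m, S m & forall y, S y -> y <= m.
  move=> SE [s Ss].
  have [] := wB [set x - a | a in S].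
  - by move=> _ [a /SE[_ Ba] <-].
  - by exists (x - s), s.
  move=> _ [m Sm <-] mP; exists m => // y Sy.
  have : x - m <= x - y by apply: mP; exists y.
  by rewrite lexD2lE -(lexD2rE (m + y)) addrA addNr add0r addrCA addNr addr0.
have [->|/set0P E0] := eqVneq E set0; first exact: finite_set0.
have [M EM MP] := maxE E (@subset_refl _ _) E0.
apply: contrapT => infE.
pose I := [set e | E e /\ ~ finite_set (E `&` [set y | y <= e])].
have [m [Em infm] mP] : exists2 m, I m & forall y, I y -> m <= y.
  apply: minE; first by move=> e [].
  exists M; split=> // fin; apply: infE; apply: sub_finite_set fin.
  by move=> y Ey; split=> //=; apply: MP.
pose L := E `&` [set y | y < m].
have infL : ~ finite_set L.
  move=> finL; apply: infm.
  apply: (@sub_finite_set _ _ (L `|` [set m])).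
    move=> y [Ey /= ym]; have [->|ne] := eqVneq y m; first by right.
    by left; split=> //=; rewrite lt_neqAle ne.
  by rewrite finite_setU; split=> //; exact: finite_set1.
have L0 : L !=set0.
  by apply/set0P; apply: contra_notN infL => /eqP ->.
have [m' [Em' /= m'm] m'P] := maxE L (@subIsetl _ _ _) L0.
suff /mP : I m' by rewrite lexNgt m'm.
split=> // fin; apply: infL; apply: sub_finite_set fin.
by move=> y Ly; split; [case: Ly | apply: m'P].
Qed.

End WellOrdered.

(* Convolution of functions with well-ordered support, i.e. multiplication of
   Hahn series with coefficients in [A] and central indeterminates. *)
Section Convolution.
Variables (G : ordAbGroupType) (A : nzRingType).
Implicit Types f g h : G -> A.

Definition supp f : set G := [set x | f x != 0].

Lemma suppN0 f x : f x != 0 -> supp f x. Proof. by []. Qed.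

Definition conv f g (c : G) : A := \sum_(a \in [set: G]) f a * g (c - a).

Lemma fsum_seq (H : G -> A) (r : seq G) : uniq r ->
  (forall a, H a != 0 -> a \in r) ->
  \sum_(a \in [set: G]) H a = \sum_(a <- r) H a.
Proof.
move=> ur Hr; rewrite (@fsbigE _ _ _ _ _ r) //.
  by apply: eq_bigl => i; rewrite in_setT.
by move=> i _ ir; apply/eqP; apply: contraNT ir => /Hr.
Qed.

Lemma fiber_seq (S T : set G) c : well_ordered S -> well_ordered T ->
  exists2 r : seq G, uniq r & forall a, a \in r <-> S a /\ T (c - a).
Proof.
move=> wS wT; have /finite_seqP[r rE] := well_ordered_fiber c wS wT.
exists (undup r); first exact: undup_uniq.
move=> a; rewrite mem_undup; have := congr1 (fun X : set G => X a) rE.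
by rewrite /= => <-.
Qed.

Lemma mul_neq0l (x y : A) : x * y != 0 -> x != 0.
Proof. by apply: contra_neq => ->; rewrite mul0r. Qed.

Lemma mul_neq0r (x y : A) : x * y != 0 -> y != 0.
Proof. by apply: contra_neq => ->; rewrite mulr0. Qed.

Lemma supp_conv f g :
  supp (conv f g) `<=` [set x | exists2 a, supp f a & supp g (x - a)].
Proof.
move=> c; rewrite /supp /= => cN0; apply: contrapT => nex.
move/eqP: cN0; apply; rewrite /conv fsbig1 // => a _.
apply/eqP/negPn/negP => N0; apply: nex; exists a.
  exact: mul_neq0l N0.
exact: mul_neq0r N0.
Qed.

Lemma convA f g h : well_ordered (supp f) -> well_ordered (supp g) ->
  well_ordered (supp h) -> conv f (conv g h) = conv (conv f g) h.
Proof.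
move=> wf wg wh; apply/funext => c.
have [r ur rP] := fiber_seq c (well_orderedD wf wg) wh.
have [s us sP] := fiber_seq c wf (well_orderedD wg wh).
rewrite [RHS](@fsum_seq _ r) //; last first.
  move=> b N0; apply/rP; split; last exact: mul_neq0r N0.
  by apply: supp_conv; apply: mul_neq0l N0.
rewrite [LHS](@fsum_seq _ s) //; last first.
  move=> b N0; apply/sP; split; first exact: mul_neq0l N0.
  by apply: supp_conv; apply: mul_neq0r N0.
transitivity (\sum_(a <- s) \sum_(b <- r) f a * g (b - a) * h (c - b)).
  rewrite !big_seq; apply: eq_bigr => a /sP[fa _]; rewrite /conv.
  have bij : bijective (fun b : G => b - a).
    by exists (fun b => b + a) => b; rewrite ?subrK ?addrK.
  rewrite (reindex_fsbigT _ _ bij) (@fsum_seq _ r) //.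
    rewrite big_distrr /=; apply: eq_bigr => b _.
    by rewrite mulrA opprB addrA subrK.
  move=> b; rewrite opprB addrA subrK => N0.
  apply/rP; split; last exact: mul_neq0r N0.
  by exists a => //; exact: mul_neq0l N0.
rewrite exchange_big /= !big_seq; apply: eq_bigr => b /rP[_ hb].
rewrite -big_distrl /=; congr (_ * _); rewrite /conv.
have [q uq qP] := fiber_seq b wf wg.
rewrite [RHS](@fsum_seq _ s) // => a N0.
apply/sP; split; first exact: mul_neq0l N0.
exists (b - a); first exact: mul_neq0r N0.
by rewrite opprB addrA subrK.
Qed.

Lemma convDl f f' g : well_ordered (supp f) -> well_ordered (supp f') ->
  well_ordered (supp g) ->
  conv (fun c => f c + f' c) g = (fun c => conv f g c + conv f' g c).
Proof.
move=> wf wf' wg; apply/funext => c.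
have [r ur rP] := fiber_seq c (well_orderedU wf wf') wg.
rewrite /conv !(@fsum_seq _ r) //.
- by rewrite -big_split; apply: eq_bigr => a _; rewrite /= mulrDl.
- move=> a N0; apply/rP; split; last exact: mul_neq0r N0.
  by right; exact: mul_neq0l N0.
- move=> a N0; apply/rP; split; last exact: mul_neq0r N0.
  by left; exact: mul_neq0l N0.
- move=> a N0; apply/rP; split; last exact: mul_neq0r N0.
  have [fa|/suppN0 fa] := eqVneq (f a) 0; last by left.
  by right; apply/negP => /eqP f'a; move: N0; rewrite fa f'a addr0 mul0r eqxx.
Qed.

Lemma convDr f g g' : well_ordered (supp f) -> well_ordered (supp g) ->
  well_ordered (supp g') ->
  conv f (fun c => g c + g' c) = (fun c => conv f g c + conv f g' c).
Proof.
move=> wf wg wg'; apply/funext => c.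
have [r ur rP] := fiber_seq c wf (well_orderedU wg wg').
rewrite /conv !(@fsum_seq _ r) //.
- by rewrite -big_split; apply: eq_bigr => a _; rewrite /= mulrDr.
- move=> a N0; apply/rP; split; first exact: mul_neq0l N0.
  by right; exact: mul_neq0r N0.
- move=> a N0; apply/rP; split; first exact: mul_neq0l N0.
  by left; exact: mul_neq0r N0.
- move=> a N0; apply/rP; split; first exact: mul_neq0l N0.
  have [ga|/suppN0 ga] := eqVneq (g (c - a)) 0; last by left.
  by right; apply/negP => /eqP g'a; move: N0; rewrite ga g'a addr0 mulr0 eqxx.
Qed.

End Convolution.

(* Representatives [u s] given by the Skolem-Noether theorem. Galois groups act
   on the right: [(s * t) x = t (s x)], in accordance with the exponential
   notation [x ^ (s * t) = (x ^ s) ^ t]. *)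
Record skolem_noether (F : fieldType) (A : falgType F)
    (K : splittingFieldType F) (iota : 'AHom(K, A)) := SkolemNoether {
  sn_elt :> gal_of {:K} -> A;
  sn_unit : forall s, sn_elt s \is a GRing.unit;
  sn_conj : forall (s : gal_of {:K}) (x : K),
    iota (s x) = (sn_elt s)^-1 * iota x * sn_elt s;
  sn_id : sn_elt 1%g = 1
}.

Record gal_hom (G : zmodType) (F : fieldType) (K : splittingFieldType F) :=
  GalHom {
    gal_hom_fun :> G -> gal_of {:K};
    gal_homD : forall a b,
      gal_hom_fun (a + b) = (gal_hom_fun a * gal_hom_fun b)%g
  }.

(* [f] stands for the formal series with coefficient [f a] in the centralizer
   of [K] to the right of the indeterminate indexed by [a]. The parameters [u]
   and [eps] only serve to determine the multiplication. *)
Record malcev_neumann (F : fieldType) (A : falgType F)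
    (K : splittingFieldType F) (iota : 'AHom(K, A)) (u : skolem_noether iota)
    (G : ordAbGroupType) (eps : gal_hom G K) := MalcevNeumann {
  mn_coef :> G -> A;
  mn_cent : forall a, mn_coef a \in 'C(limg iota)%VS;
  mn_wo : well_ordered [set a | mn_coef a != 0]
}.

Arguments MalcevNeumann {F A K iota u G eps mn_coef} mn_cent mn_wo.
Arguments mn_cent {F A K iota u G eps} _ _.
Arguments mn_wo {F A K iota u G eps} _.

Section MalcevNeumann.
Variables (F : fieldType) (A : falgType F) (K : splittingFieldType F).
Variables (iota : 'AHom(K, A)) (u : skolem_noether iota).
Variables (G : ordAbGroupType) (eps : gal_hom G K).

Local Notation malcev_neumann := (malcev_neumann u eps).

HB.instance Definition _ := gen_eqMixin malcev_neumann.
HB.instance Definition _ := gen_choiceMixin malcev_neumann.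

Lemma mnP (f g : malcev_neumann) : (forall a, f a = g a) -> f = g.
Proof.
case: f g => [f cf wf] [g cg wg] /= fg.
have {}fg : f = g by apply/funext.
by case: _ / fg in cg wg *; congr MalcevNeumann; exact: Prop_irrelevance.
Qed.

Let C := 'C(limg iota)%VS.

Lemma mem_centP (r : A) :
  reflect (forall x : K, r * iota x = iota x * r) (r \in C).
Proof.
apply: (iffP centvP) => [h x|h v /memv_imgP[x _ ->]]; last exact: h.
by apply: h; apply: memv_img; exact: memvf.
Qed.

(* r a_b = a_b (twist b r) *)
Definition twist (b : G) (r : A) : A := (u (eps b))^-1 * r * u (eps b).

(* a_a a_b = a_(a + b) (cocycle a b) *)
Definition cocycle (a b : G) : A :=
  (u (eps a * eps b)%g)^-1 * u (eps a) * u (eps b).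

Definition mn_mul_coef (f g : G -> A) (c : G) : A :=
  \sum_(a \in [set: G]) cocycle a (c - a) * twist (c - a) (f a) * g (c - a).

Let utw (f : G -> A) (a : G) : A := u (eps a) * f a.

Let supp_utw f : supp (utw f) = supp f.
Proof.
apply/funext => a; apply/propext; rewrite /supp /utw /=.
by rewrite mulrI_eq0 //; exact/mulrI/sn_unit.
Qed.

Let mul_term f g a c :
  cocycle a (c - a) * twist (c - a) (f a) * g (c - a) =
  (u (eps c))^-1 * (utw f a * utw g (c - a)).
Proof.
rewrite /cocycle /twist /utw -gal_homD addrCA subrr addr0 !mulrA.
by rewrite (mulrK (sn_unit u _)).
Qed.

Let term_neq0 f g a c :
  cocycle a (c - a) * twist (c - a) (f a) * g (c - a) != 0 ->
  utw f a * utw g (c - a) != 0.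
Proof. by rewrite mul_term => /mul_neq0r. Qed.

Lemma utw_mul f g : well_ordered (supp f) -> well_ordered (supp g) ->
  utw (mn_mul_coef f g) = conv (utw f) (utw g).
Proof.
move=> wf wg; apply/funext => c.
have [r ur rP] := fiber_seq c wf wg.
have rE a : utw f a * utw g (c - a) != 0 -> a \in r.
  move=> N0; apply/rP; rewrite -(supp_utw f) -(supp_utw g); split.
    exact: mul_neq0l N0.
  exact: mul_neq0r N0.
rewrite /conv {1}/utw /mn_mul_coef !(@fsum_seq _ _ _ r) //.
  rewrite big_distrr /=; apply: eq_bigr => a _.
  by rewrite mul_term mulrA divrr ?mul1r //; exact: sn_unit.
by move=> a /term_neq0; exact: rE.
Qed.

Let utw_inj f g : utw f = utw g -> f = g.
Proof.
move=> fg; apply/funext => a; have := congr1 (fun h => h a) fg.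
by rewrite /utw => /(mulrI (sn_unit u _)).
Qed.

Lemma twist_cent b r : r \in C -> twist b r \in C.
Proof.
move=> /mem_centP rC; apply/mem_centP => x; rewrite /twist.
have [y ->] : exists y, x = eps b y.
  exists ((eps b)^-1%g x).
  by rewrite -galM ?memvf // mulVg gal_id.
rewrite (sn_conj u) !mulrA !(mulrK (sn_unit u _)).
by rewrite -[_ * r * _]mulrA rC mulrA.
Qed.

Lemma cocycle_cent a b : cocycle a b \in C.
Proof.
apply/mem_centP => x.
have [y ->] : exists y, x = (eps a * eps b)%g y.
  exists ((eps a * eps b)^-1%g x).
  by rewrite -galM ?memvf // mulVg gal_id.
rewrite {2}(sn_conj u) galM ?memvf // !(sn_conj u) /cocycle !mulrA.
by rewrite !(mulrK (sn_unit u _)).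
Qed.

Lemma cent_mul r s : r \in C -> s \in C -> r * s \in C.
Proof.
move=> /mem_centP rC /mem_centP sC; apply/mem_centP => x.
by rewrite -mulrA sC mulrA rC mulrA.
Qed.

Fact mn_mul_cent (f g : malcev_neumann) c : mn_mul_coef f g c \in C.
Proof.
have [r ur rP] := fiber_seq c (mn_wo f) (mn_wo g).
rewrite /mn_mul_coef (@fsum_seq _ _ _ r) //.
  apply: memv_suml => a _; apply: cent_mul; last exact: mn_cent.
  by apply: cent_mul; [exact: cocycle_cent|apply/twist_cent/mn_cent].
move=> a /term_neq0 N0; apply/rP; split.
  by have := mul_neq0l N0; apply: contra_neq; rewrite /utw => ->; rewrite mulr0.
by have := mul_neq0r N0; apply: contra_neq; rewrite /utw => ->; rewrite mulr0.
Qed.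

Fact mn_mul_wo (f g : malcev_neumann) :
  well_ordered [set a | mn_mul_coef f g a != 0].
Proof.
rewrite -/(supp _) -supp_utw utw_mul; [|exact: mn_wo|exact: mn_wo].
apply: well_orderedS (@supp_conv _ _ _ _) _; rewrite !supp_utw.
by apply: well_orderedD; exact: mn_wo.
Qed.

Fact mn_zero_wo : well_ordered [set a : G | (0 : A) != 0].
Proof. by move=> S S0 [x /S0]; rewrite /= eqxx. Qed.

Fact mn_opp_wo (f : malcev_neumann) : well_ordered [set a | - f a != 0].
Proof. by apply: well_orderedS (mn_wo f) => a /=; rewrite oppr_eq0. Qed.

Fact mn_add_wo (f g : malcev_neumann) : well_ordered [set a | f a + g a != 0].
Proof.
apply: well_orderedS (well_orderedU (mn_wo f) (mn_wo g)) => a /= N0.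
have [fa|/suppN0 fa] := eqVneq (f a) 0; last by left.
by right; apply/negP => /eqP ga; move: N0; rewrite fa ga addr0 eqxx.
Qed.

Fact mn_one_cent a : ((a == 0 :> G)%:R : A) \in C.
Proof. by case: eqP => _; rewrite ?mem0v // centv1. Qed.

Fact mn_one_wo : well_ordered [set a : G | ((a == 0)%:R : A) != 0].
Proof.
apply: well_orderedS (@well_ordered1 _ 0) => a /=.
by have [->//|_] := eqVneq a 0; rewrite mulr0n eqxx.
Qed.

Arguments mn_mul_wo : clear implicits.
Arguments mn_zero_wo : clear implicits.
Arguments mn_opp_wo : clear implicits.
Arguments mn_add_wo : clear implicits.
Arguments mn_one_wo : clear implicits.

Definition mn_zero : malcev_neumann := MalcevNeumann (fun a => mem0v C) mn_zero_wo.

Definition mn_opp (f : malcev_neumann) : malcev_neumann :=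
  MalcevNeumann (fun a => etrans (memvN _ _) (mn_cent f a)) (mn_opp_wo f).

Definition mn_add (f g : malcev_neumann) : malcev_neumann :=
  MalcevNeumann (fun a => memvD (mn_cent f a) (mn_cent g a)) (mn_add_wo f g).

Definition mn_one : malcev_neumann := MalcevNeumann mn_one_cent mn_one_wo.

Definition mn_mul (f g : malcev_neumann) : malcev_neumann :=
  MalcevNeumann (mn_mul_cent f g) (mn_mul_wo f g).

Fact mn_addA : associative mn_add.
Proof. by move=> f g h; apply: mnP => a; exact: addrA. Qed.

Fact mn_addC : commutative mn_add.
Proof. by move=> f g; apply: mnP => a; exact: addrC. Qed.

Fact mn_add0 : left_id mn_zero mn_add.
Proof. by move=> f; apply: mnP => a; exact: add0r. Qed.

Fact mn_addN : left_inverse mn_zero mn_opp mn_add.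
Proof. by move=> f; apply: mnP => a; exact: addNr. Qed.

HB.instance Definition _ :=
  GRing.isZmodule.Build malcev_neumann mn_addA mn_addC mn_add0 mn_addN.

Let wu (f : malcev_neumann) : well_ordered (supp (utw f)).
Proof. by rewrite supp_utw; exact: mn_wo. Qed.

Let utw_mn (f g : malcev_neumann) :
  utw (mn_mul f g) = conv (utw f) (utw g).
Proof. by apply: utw_mul; exact: mn_wo. Qed.

Let mn_utwP (f g : malcev_neumann) : utw f = utw g -> f = g.
Proof. by move=> /utw_inj fg; apply: mnP => a; rewrite fg. Qed.

Let utwD (f g : malcev_neumann) :
  utw (mn_add f g) = (fun a => utw f a + utw g a).
Proof. by apply/funext => a; exact: mulrDr. Qed.

Fact mn_mulA : associative mn_mul.
Proof. by move=> f g h; apply: mn_utwP; rewrite !utw_mn convA. Qed.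

Let gal_hom0 : eps 0 = 1%g.
Proof. by apply: (mulgI (eps 0)); rewrite -gal_homD addr0 mulg1. Qed.

Let utw1 a : utw mn_one a = (a == 0)%:R.
Proof.
rewrite /utw /=; case: eqP => [->|_]; last by rewrite mulr0.
by rewrite gal_hom0 sn_id mulr1.
Qed.

Fact mn_mul1 : left_id mn_one mn_mul.
Proof.
move=> f; apply: mn_utwP; rewrite utw_mn; apply/funext => c.
rewrite /conv (@fsum_seq _ _ _ [:: 0]) //.
  by rewrite big_seq1 utw1 eqxx mul1r subr0.
by move=> a; rewrite utw1 inE; have [//|_] := eqVneq a 0; rewrite mulr0n mul0r eqxx.
Qed.

Fact mn_mulr1 : right_id mn_one mn_mul.
Proof.
move=> f; apply: mn_utwP; rewrite utw_mn; apply/funext => c.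
rewrite /conv (@fsum_seq _ _ _ [:: c]) //.
  by rewrite big_seq1 utw1 subrr eqxx mulr1.
move=> a; rewrite utw1 inE subr_eq0 eq_sym.
by have [//|_] := eqVneq c a; rewrite mulr0n mulr0 eqxx.
Qed.

Fact mn_mulDl : left_distributive mn_mul mn_add.
Proof.
move=> f g h; apply: mn_utwP.
by rewrite utwD !utw_mn utwD convDl.
Qed.

Fact mn_mulDr : right_distributive mn_mul mn_add.
Proof.
move=> f g h; apply: mn_utwP.
by rewrite utwD !utw_mn utwD convDr.
Qed.

Fact mn_one_neq0 : mn_one != mn_zero.
Proof.
apply/eqP => /(congr1 (fun f : malcev_neumann => f 0)) /= /eqP.
by rewrite eqxx oner_eq0.
Qed.

HB.instance Definition _ := GRing.Zmodule_isNzRing.Build malcev_neumann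
  mn_mulA mn_mul1 mn_mulr1 mn_mulDl mn_mulDr mn_one_neq0.

End MalcevNeumann.

(* Main.v *)
From HB Require Import structures.
Require Import Defs.
From mathcomp Require Import all_boot all_order all_algebra all_fingroup.
From mathcomp Require Import all_solvable all_field.
From mathcomp Require Import ring_quotient generic_quotient.
From mathcomp Require Import boolp classical_sets cardinality fsbigop.

Set Implicit Arguments.
Unset Strict Implicit.
Unset Printing Implicit Defensive.

Import Order.TTheory GRing.Theory Num.Theory.
Local Open Scope classical_set_scope.
Local Open Scope ring_scope.

(** Both conclusions concern a Galois extension M/E inside a division ring D
    with center E such that M is its own centralizer in D. For the first one
    D = A and E = F; for the second one D is the Mal'cev-Neumann ring and M/E
    exhibits it as a crossed product. Either way a contradiction is derived.

    Degree. Choose a generator x of M/E. The polynomial prod_s (X - s x) splits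
    D into the eigenspaces of d |-> x d relative to right multiplication by the
    conjugates s x ([eigen_sum], [eigen_direct]), and none of these is zero
    ([exists_eigen], a form of the Skolem-Noether theorem that rests on
    [sandwich_free]). Each is a line over the centralizer of M, so
    dim D = [M:E]^2 ([gal_self_centralizing_basis]). Since dim D = p^4 in both
    cases, Gal(M/E) has order p^2.

    Invariance. Automorphisms of M/E are induced by conjugations of D, so every
    valuation of D is invariant under Gal(M/E) on M ([gal_val]). The order p^2
    of the group is invertible in the residue fields at hand, hence averaging
    over the group turns a residue, or a value, that is fixed by the group into
    one that comes from E ([residue_fixed], [value_fixed]). For the same
    reason a nontrivial s cannot satisfy s z = z modulo higher terms for all z
    ([tame_ramification]).

    At v2 the residue field of E is finite with q elements, where q is not 0 or
    1 modulo p. A nontrivial element s of the inertia group would have some z for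
    which s z / z has a nontrivial residue; this residue yields a root of unity
    of order p, which the p-group Gal(M/E) has to fix, so that p divides q - 1.
    Hence Gal(M/E) acts faithfully on the residue field, which is finite, and the
    group is generated by the element t that induces the Frobenius map
    ([unramified_galois_cyclic]).

    At v1 suppose that M contains some x whose value is not taken on E, and that
    t^p x / x has residue 1. If t acted nontrivially on the residue field, the
    argument of Hilbert's theorem 90 would produce an element with the same value
    as x and fixed by t modulo higher terms, whose average lies in E. So t acts
    trivially on residues, and then z |-> (residue of t z / z) is a character
    whose values include a root of unity of order p^2 in the residue field of E
    ([ramified_galois_root_of_unity]). This contradicts the hypothesis on v1.

    It remains to find x. As K/F is totally ramified, K contains an element x
    whose value is not taken on F ([ramified_element]), and x has degree p over F,
    so t^p fixes it ([fixed_by_power]). When D = A this x lies in M.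

    When D is the Mal'cev-Neumann ring, write its elements as Hahn series with
    central indeterminates and coefficients in A, graded by Gal(K/F) ([series]).
    D is a division ring because Hahn series are invertible by Neumann's lemma
    ([neumann], [hahn_inverse]), and a valuation of A extends to D by taking the
    valuation of the leading coefficient, with values ordered lexicographically
    ([series_valuation]); residues of central elements then come from F
    ([center_residue]). By the argument at v2, M contains an integral y whose
    conjugates have distinct residues. Its constant coefficient generates over F
    a commutative subfield of A of degree p^2, which is its own centralizer and
    therefore contains K ([commuting_in_span]). Thus x is a polynomial Q in the
    constant coefficient of y, and Q(y) is an element of M with the value of x. *)

(** * Linear algebra over the center of a division ring *)

Section CentralFamilies.
Variables (E : fieldType) (D : nzRingType) (i : {rmorphism E -> D}).

Definition lin_free (I : finType) (b : I -> D) : Prop :=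
  forall c : I -> E, \sum_k i (c k) * b k = 0 -> forall k, c k = 0.

Definition lin_spans (I : finType) (b : I -> D) (S : set D) : Prop :=
  forall x, S x -> exists c : I -> E, x = \sum_k i (c k) * b k.

Lemma card_free_le (I J : finType) (b : I -> D) (b' : J -> D) (S : set D) :
  lin_free b -> lin_spans b' S -> (forall k, S (b k)) -> (#|I| <= #|J|)%N.
Proof.
move=> bfree b'span Sb.
have /boolp.choice[c cE] : forall k, exists ck : J -> E,
    b k = \sum_l i (ck l) * b' l by move=> k; exact: b'span.
pose C := \matrix_(k < #|I|, l < #|J|) c (enum_val k) (enum_val l).
have : row_free C.
  rewrite -kermx_eq0; apply/rowV0P => u /sub_kermxP uC.
  apply/rowP => k; rewrite mxE.
  have := bfree (fun k => u 0 (enum_rank k)) _ (enum_val k).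
  rewrite enum_valK; apply.
  under eq_bigr => k' _ do rewrite cE big_distrr /=.
  rewrite exchange_big big1 //= => l _.
  under eq_bigr do rewrite mulrA -rmorphM.
  rewrite -big_distrl -rmorph_sum /=.
  suff -> : \sum_k' u 0 (enum_rank k') * c k' l = 0 by rewrite rmorph0 mul0r.
  have := congr1 (fun v : 'rV_#|J| => v 0 (enum_rank l)) uC; rewrite !mxE => {2}<-.
  rewrite [RHS](reindex (@enum_rank I)) /=; last first.
    by exists enum_val => ? _; rewrite ?enum_rankK ?enum_valK.
  by apply: eq_bigr => k' _; rewrite mxE !enum_rankK.
by rewrite -row_leq_rank => /leq_trans -> //; exact: rank_leq_col.
Qed.

Hypothesis i_central : forall a x, i a * x = x * i a.
Hypothesis Ddiv : division_ring D.
Hypothesis i_onto : forall z : D, ring_center z -> exists a, i a = z.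

(** The map a (x) b |-> (c |-> a c b) on the tensor product of D with its
    opposite is injective, as in the theorem of Artin and Whaples. In a shortest
    relation with some b_k = 1, commuting with any e gives a shorter one, so all
    b_k are central and the relation is one between the a_k. *)
Lemma sandwich_free n (a b : 'I_n -> D) : lin_free a ->
  (forall c, \sum_k a k * c * b k = 0) -> forall k, b k = 0.
Proof.
elim: n a b => [|n IHn] a b afree ab0 k; first by case: k.
have afree' : lin_free (fun k => a (widen_ord (leqnSn n) k)).
  move=> c c0 l.
  pose c' (k : 'I_n.+1) :=
    if (insub (k : nat) : option 'I_n) is Some k' then c k' else 0.
  have cE l' : c' (widen_ord (leqnSn n) l') = c l'.
    by rewrite /c' /= insubT //= => lt; congr c; apply: val_inj.
  have := afree c' _ (widen_ord (leqnSn n) l).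
  rewrite cE; apply; rewrite big_ord_recr /= [c' ord_max]/c' insubF ?ltnn //.
  rewrite rmorph0 mul0r addr0 -[RHS]c0; apply: eq_bigr => l' _.
  by rewrite cE.
have [bm0|bmN0] := eqVneq (b ord_max) 0.
  have b'0 := IHn _ (fun k => b (widen_ord (leqnSn n) k)) afree' _.
  have [|->] := unliftP ord_max k; last exact: bm0.
  move=> k' ->; rewrite -[lift _ _](_ : widen_ord (leqnSn n) k' = _).
    by apply: b'0 => c; have := ab0 c; rewrite big_ord_recr /= bm0 mulr0 addr0.
  by apply: val_inj; rewrite /= /bump leqNgt ltn_ord.
exfalso; have [v [vb bv]] := Ddiv bmN0.
have [b' b'E] : exists b' : 'I_n.+1 -> D, forall k, b' k = b k * v by eexists.
have ab'0 c : \sum_k a k * c * b' k = 0.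
  have := congr1 (fun z => z * v) (ab0 c); rewrite mul0r big_distrl /= => {2}<-.
  by apply: eq_bigr => l _; rewrite b'E !mulrA.
have b'm : b' ord_max = 1 by rewrite b'E.
have b'c l : ring_center (b' l).
  move=> e; have [|->] := unliftP ord_max l; last by rewrite b'm mul1r mulr1.
  move=> l' ->; rewrite -[lift _ _](_ : widen_ord (leqnSn n) l' = _); last first.
    by apply: val_inj; rewrite /= /bump leqNgt ltn_ord.
  apply/esym/eqP; rewrite -subr_eq0; apply/eqP.
  apply: (IHn _ (fun k => let z := b' (widen_ord (leqnSn n) k) in e * z - z * e)
    afree' _ l') => c.
  transitivity (\sum_(k < n.+1) a k * c * (e * b' k - b' k * e)).
    by rewrite big_ord_recr /= b'm mul1r mulr1 subrr mulr0 addr0.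
  under eq_bigr do rewrite mulrBr !mulrA.
  rewrite sumrB -[X in _ - X]big_distrl /= (ab'0 c) mul0r subr0 -[RHS](ab'0 (c * e)).
  by apply: eq_bigr => l'' _; rewrite !mulrA.
(* every [b' k] is central, so the relation evaluated at c = 1 is linear *)
have /boolp.choice[lam lamE] : forall k, exists l, i l = b' k.
  by move=> l; exact/i_onto/b'c.
have := ab'0 1; under eq_bigr do rewrite mulr1 -lamE -i_central.
move/afree/(_ ord_max)/(congr1 i); rewrite lamE b'm rmorph0 => /eqP.
by rewrite oner_eq0.
Qed.

End CentralFamilies.

(** * Eigenspaces of multiplication by an algebraic element *)

Section EigenDecomposition.
Variables (E : fieldType) (D : nzRingType) (i : {rmorphism E -> D}).
Hypothesis i_central : forall a x, i a * x = x * i a.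
Hypothesis Ddiv : division_ring D.
Hypothesis i_onto : forall z : D, ring_center z -> exists a, i a = z.
Variables (M : fieldType) (phi : {rmorphism M -> D}) (h : {rmorphism E -> M}).
Hypothesis phi_h : forall a, phi (h a) = i a.
Variables (I : finType) (eta : I -> M) (P : {poly E}) (i0 : I).
Hypothesis eta_inj : injective eta.
Hypothesis P_split : map_poly h P = \prod_k ('X - (eta k)%:P).
Hypothesis pow_free : lin_free i (fun m : 'I_#|I| => phi (eta i0) ^+ m).

Let x := phi (eta i0).

Definition eigen (k : I) (d : D) : Prop := x * d = d * phi (eta k).

(** For Q = sum_m q_m X^m this is sum_m x^m c q_m: Q with the variable replaced
    by multiplication by x on the left and the coefficients acting on the right. *)
Let sand N (Q : {poly M}) (c : D) : D := \sum_(m < N) x ^+ m * c * phi Q`_m.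

Let sand_shift N (Q : {poly M}) c t : (size Q <= N)%N ->
  x * sand N Q c - sand N Q c * phi t = sand N.+1 (Q * ('X - t%:P)) c.
Proof.
move=> szQ; rewrite /sand mulrBr.
under [RHS]eq_bigr do rewrite coefB rmorphB mulrBr.
rewrite sumrB; congr (_ - _).
  rewrite big_ord_recl coefMX eqxx rmorph0 mulr0 add0r big_distrr /=.
  by apply: eq_bigr => m _; rewrite coefMX /= !mulrA -exprS.
rewrite big_ord_recr /= coefMC nth_default // mul0r rmorph0 mulr0 addr0.
by rewrite big_distrl; apply: eq_bigr => m _; rewrite coefMC rmorphM mulrA.
Qed.

Let Q k : {poly M} := \prod_(l | l != k) ('X - (eta l)%:P).

Let Q_mul k : Q k * ('X - (eta k)%:P) = map_poly h P.
Proof. by rewrite P_split [RHS](bigD1 k) //= mulrC. Qed.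

Let Q_monic k : Q k \is monic. Proof. exact: monic_prod_XsubC. Qed.

Let size_index_enumI : size (index_enum I) = #|I|.
Proof. by rewrite cardE -deprecated_filter_index_enum filter_predT. Qed.

Let size_Q k : size (Q k) = #|I|.
Proof.
have := congr1 (fun q : {poly M} => size q) (Q_mul k).
rewrite P_split size_prod_XsubC size_Mmonic ?monicXsubC ?monic_neq0 //.
by rewrite size_XsubC addn2 /= size_index_enumI => -[].
Qed.

Let sand_P c : sand #|I|.+1 (map_poly h P) c = 0.
Proof.
rewrite /sand; under eq_bigr do rewrite coef_map /= phi_h -i_central mulrA.
rewrite -big_distrl /=.
have : phi (map_poly h P).[eta i0] = 0.
  rewrite P_split (bigD1 i0) //= hornerM hornerXsubC subrr mul0r.
  exact: rmorph0.
rewrite (@horner_coef_wide _ #|I|.+1); last first.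
  by rewrite P_split size_prod_XsubC size_index_enumI.
rewrite rmorph_sum /= => P0; rewrite -[RHS](mul0r c); congr (_ * _).
rewrite -[RHS]P0.
by apply: eq_bigr => m _; rewrite coef_map rmorphM rmorphXn /= phi_h.
Qed.

Let eigen_sand k c : eigen k (sand #|I| (Q k) c).
Proof.
by apply/eqP; rewrite -subr_eq0 sand_shift ?size_Q // Q_mul sand_P.
Qed.

(** If P = Q_k (X - eta_k), then inserting c into Q_k gives an element of the
    eigenspace of eta_k, because P has central coefficients and kills x. It is
    nonzero for some c by [sandwich_free], as Q_k is monic of degree less than
    the degree of x. *)
Lemma exists_eigen k : exists2 d, d != 0 & eigen k d.
Proof.
apply: contrapT => nd.
have s0 c : sand #|I| (Q k) c = 0.
  apply/eqP/negPn/negP => N0; apply: nd; exists (sand #|I| (Q k) c) => //.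
have I0 : (#|I|.-1 < #|I|)%N by rewrite prednK //; apply/card_gt0P; exists i0.
have := sandwich_free i_central Ddiv i_onto pow_free s0 (Ordinal I0).
move: (Q_monic k); rewrite monicE lead_coefE size_Q /= => /eqP ->.
by rewrite rmorph1 => /eqP; rewrite oner_eq0.
Qed.

Lemma eigenM k d (c : D) : eigen k d -> c * x = x * c -> eigen k (c * d).
Proof. by rewrite /eigen => kd cx; rewrite mulrA -cx -mulrA kd mulrA. Qed.

Let eigenX k d m : eigen k d -> x ^+ m * d = d * phi (eta k ^+ m).
Proof.
move=> kd; rewrite rmorphXn /=; elim: m => [|m IHm].
  by rewrite !expr0 mulr1 mul1r.
by rewrite exprS -mulrA IHm mulrA kd -mulrA exprS.
Qed.

Lemma eigen_horner k d (t : {poly E}) : eigen k d ->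
  phi (map_poly h t).[eta i0] * d = d * phi (map_poly h t).[eta k].
Proof.
move=> kd; rewrite !(@horner_coef_wide _ (size t)) ?size_map_poly //.
rewrite !rmorph_sum big_distrl big_distrr /=.
apply: eq_bigr => m _; rewrite coef_map /= !rmorphM /= phi_h -mulrA.
by rewrite rmorphXn (eigenX m kd) mulrA i_central -!mulrA i_central.
Qed.

Let sand_eigen k d N (R : {poly M}) : (size R <= N)%N -> eigen k d ->
  sand N R d = d * phi R.[eta k].
Proof.
move=> szR kd; rewrite /sand (horner_coef_wide _ szR) rmorph_sum big_distrr /=.
by apply: eq_bigr => m _; rewrite (eigenX m kd) -mulrA -rmorphM mulrC.
Qed.

Let Q_eta k l : ((Q k).[eta l] == 0) = (l != k).
Proof.
rewrite horner_prod prodf_seq_eq0 /=; apply/hasP/idP => [[m _]|lk].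
  by rewrite hornerXsubC subr_eq0 => /andP[mk /eqP/eta_inj ->].
by exists l; rewrite ?mem_index_enum // lk hornerXsubC subrr eqxx.
Qed.

(** Inserting an element of the l-th eigenspace into Q_k multiplies it by
    Q_k(eta_l), which vanishes exactly when l <> k. *)
Lemma eigen_direct (d : I -> D) : (forall k, eigen k (d k)) ->
  \sum_k d k = 0 -> forall k, d k = 0.
Proof.
move=> eigd d0 k.
have : sand #|I| (Q k) (\sum_l d l) = d k * phi (Q k).[eta k].
  rewrite /sand; under eq_bigr do rewrite big_distrr /= big_distrl /=.
  rewrite exchange_big (bigD1 k) //= [X in _ + X]big1 ?addr0.
    by rewrite -(@sand_eigen k _ #|I|) ?size_Q.
  move=> l lk; rewrite -[LHS]/(sand _ _ _) (@sand_eigen l) ?size_Q //.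
  by move: (Q_eta k l); rewrite lk => /eqP ->; rewrite rmorph0 mulr0.
rewrite d0 /sand big1 => [/esym/eqP|m _]; last by rewrite mulr0 mul0r.
have Qk0 : phi (Q k).[eta k] != 0.
  by rewrite fmorph_eq0 Q_eta eqxx.
have [v [_ vP]] := Ddiv Qk0.
by move=> /eqP/(congr1 (fun z => z * v)); rewrite -mulrA vP mulr1 mul0r.
Qed.

(** Lagrange interpolation of the constant 1 at the points eta_k. *)
Let lagrange : \sum_k ((Q k).[eta k])^-1 *: Q k = 1.
Proof.
apply/eqP; rewrite -subr_eq0; apply/eqP.
apply: (@roots_geq_poly_eq0 _ _ [seq eta k | k <- enum I]).
- apply/allP => _ /mapP[l _ ->]; rewrite /root hornerD hornerN hornerC.
  rewrite horner_sum (bigD1 l) //= big1 ?addr0.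
    by rewrite hornerZ mulVf ?subrr // Q_eta eqxx.
  move=> k kl; rewrite hornerZ; move: (Q_eta k l); rewrite eq_sym in kl; rewrite kl => /eqP ->.
  by rewrite mulr0.
- by rewrite map_inj_uniq ?enum_uniq.
- rewrite size_map -cardT (leq_trans (size_polyD _ _)) // geq_max.
  rewrite size_polyN size_poly1; apply/andP; split; last first.
    by apply/card_gt0P; exists i0.
  apply: (leq_trans (size_sum _ _ _)); apply/bigmax_leqP => k _.
  by rewrite (leq_trans (size_scale_leq _ _)) ?size_Q.
Qed.

(** The components of c are obtained by inserting it into the terms of the
    Lagrange interpolation of 1. *)
Lemma eigen_sum c : exists2 d : I -> D, (forall k, eigen k (d k))
  & c = \sum_k d k.
Proof.
exists (fun k => sand #|I| (Q k) c * phi ((Q k).[eta k])^-1).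
  move=> k; rewrite /eigen mulrA (eigen_sand k c) -!mulrA -!rmorphM.
  by rewrite [eta k * _]mulrC.
transitivity (sand #|I| 1 c).
  rewrite /sand -(prednK (_ : 0 < #|I|)%N); last by apply/card_gt0P; exists i0.
  rewrite big_ord_recl coef1 eqxx expr0 mul1r rmorph1 mulr1 big1 ?addr0 //.
  by move=> m _; rewrite coef1 rmorph0 mulr0.
rewrite -lagrange /sand; under eq_bigr do rewrite coef_sum rmorph_sum big_distrr /=.
rewrite exchange_big /=; apply: eq_bigr => k _; rewrite big_distrl /=.
by apply: eq_bigr => m _; rewrite coefZ mulrC rmorphM mulrA.
Qed.

Let cent : set D := [set c | c * x = x * c].

(** Right multiplication by [u k] maps the centralizer of x onto the k-th
    eigenspace, so bases of the centralizer give bases of D. *)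
Section Basis.
Variables (J : finType) (b : J -> D) (u : I -> D).
Hypothesis eigen_u : forall k, eigen k (u k).
Hypothesis u_neq0 : forall k, u k != 0.

Let bu (jk : J * I) : D := b jk.1 * u jk.2.

Let sum_bu (c : J * I -> E) :
  \sum_jk i (c jk) * bu jk = \sum_k (\sum_j i (c (j, k)) * b j) * u k.
Proof.
transitivity (\sum_jk i (c (jk.1, jk.2)) * bu (jk.1, jk.2)).
  by apply: eq_bigr => -[].
rewrite -(pair_bigA _ (fun j k => i (c (j, k)) * bu (j, k))) /= exchange_big /=.
apply: eq_bigr => k _; rewrite big_distrl /=.
by apply: eq_bigr => j _; rewrite mulrA.
Qed.

Lemma free_eigen_mul : lin_free i b -> (forall j, cent (b j)) ->
  lin_free i bu.
Proof.
move=> bfree bcent c; rewrite sum_bu => c0 [j k].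
apply: (bfree (fun j => c (j, k))).
pose s k := \sum_j i (c (j, k)) * b j.
have eigs l : eigen l (s l * u l).
  apply: eigenM => //; rewrite big_distrl big_distrr /=.
  by apply: eq_bigr => j' _; rewrite -mulrA bcent mulrA i_central mulrA.
have := eigen_direct eigs c0 k.
have [v [_ vP]] := Ddiv (u_neq0 k).
by move/(congr1 (fun z => z * v)); rewrite -mulrA vP mulr1 mul0r.
Qed.

Lemma spans_eigen_mul : lin_spans i b cent -> lin_spans i bu setT.
Proof.
move=> bspan z _; have [d eigd ->] := eigen_sum z.
have /boolp.choice[c cE] : forall k, exists c : J -> E,
    d k = (\sum_j i (c j) * b j) * u k.
  move=> k; have [v [vu uv]] := Ddiv (u_neq0 k).
  have [|c cE] := bspan (d k * v); last first.
    by exists c; rewrite -cE -mulrA vu mulr1.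
  have xv : phi (eta k) * v = v * x.
    rewrite -[LHS]mul1r -vu -mulrA [u k * _]mulrA -eigen_u.
    by rewrite -!mulrA uv mulr1.
  by rewrite /cent /= -mulrA -xv mulrA -eigd mulrA.
exists (fun jk => c jk.2 jk.1); rewrite sum_bu.
by apply: eq_bigr => k _; rewrite cE.
Qed.

End Basis.
End EigenDecomposition.

(** * Galois extensions in a division ring *)

Section OrbitPolynomial.
Variables (F N : fieldType) (gT : finGroupType) (gb : gT -> {rmorphism N -> N}).
Hypothesis gbM : forall s t c, gb (s * t)%g c = gb t (gb s c).
Variable h : {rmorphism F -> N}.
Hypothesis gb_fixed : forall c, (forall s, gb s c = c) -> exists a, h a = c.

Lemma action_orbit_poly (y : N) : exists P : {poly F},
  map_poly h P = \prod_s ('X - (gb s y)%:P).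
Proof.
set Q := \prod_s _.
have Qg t : map_poly (gb t) Q = Q.
  rewrite rmorph_prod [RHS](reindex_inj (mulIg t)) /=.
  by apply: eq_bigr => s _; rewrite map_polyXsubC gbM.
have /boolp.choice[a aE] : forall n, exists a, h a = Q`_n.
  by move=> n; apply: gb_fixed => s; rewrite -{2}(Qg s) coef_map.
exists (\poly_(n < size Q) a n); apply/polyP => n.
rewrite coef_map coef_poly; case: ltnP => szQ /=; first exact: aE.
by rewrite rmorph0 nth_default.
Qed.

End OrbitPolynomial.

Section GaloisBasics.
Variables (E : fieldType) (M : splittingFieldType E).
Hypothesis galM : galois 1 {:M}.

Lemma mem_gal1 (s : gal_of {:M}) : s \in 'Gal({:M} / 1)%g.
Proof. by rewrite gal_kHom ?sub1v // k1AHom. Qed.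

Lemma galMv (s t : gal_of {:M}) x : (s * t)%g x = t (s x).
Proof. exact/galois.galM/memvf. Qed.

Lemma gal_fix_base (x : M) : (forall s : gal_of {:M}, s x = x) ->
  exists e : E, x = e%:A.
Proof.
move=> fx; apply/vlineP; move/galois_fixedField: galM => <-.
by apply/fixedFieldP => [|s _]; [exact: memvf | exact: fx].
Qed.

Lemma gal_alg (s : gal_of {:M}) (e : E) : s e%:A = e%:A.
Proof. by rewrite linearZ rmorph1. Qed.

Lemma orbit_poly (y : M) : exists P : {poly E},
  map_poly (in_alg M) P = \prod_(s : gal_of {:M}) ('X - (s y)%:P).
Proof.
apply: (action_orbit_poly (gb := fun s : gal_of {:M} => (s : {rmorphism M -> M}))).
  exact: galMv.
by move=> c /gal_fix_base[e ->]; exists e.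
Qed.

Lemma gal_primitive : exists x : M, <<1; x>>%VS = {:M}%VS.
Proof.
have /and3P[_ sepM _] := galM; exists (separable_generator 1 {:M}).
by rewrite -(eq_adjoin_separable_generator sepM (sub1v _)).
Qed.

Lemma gal_eval_inj (x : M) (s t : gal_of {:M}) :
  <<1; x>>%VS = {:M}%VS -> s x = t x -> s = t.
Proof.
move=> xM st; apply/eqP/gal_eqP => y _.
have /Fadjoin1_polyP[q ->] : y \in <<1; x>>%VS by rewrite xM memvf.
rewrite -!horner_map /= st; congr (_.[_]); apply/polyP => k.
by rewrite !coef_map /= !gal_alg.
Qed.

End GaloisBasics.

Section GaloisInDivisionRing.
Variables (E : fieldType) (M : splittingFieldType E) (D : nzRingType).
Variable j : {rmorphism M -> D}.
Hypothesis galM : galois 1 {:M}.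
Hypothesis Ddiv : division_ring D.
Hypothesis jE : range (fun e : E => j e%:A) = ring_center (D := D).

Let i : {rmorphism E -> D} := j \o in_alg M.

Lemma base_central (a : E) x : i a * x = x * i a.
Proof.
have : ring_center (i a) by rewrite -jE; exists a.
exact.
Qed.

Lemma base_onto (z : D) : ring_center z -> exists a, i a = z.
Proof. by rewrite -jE => -[a _ <-]; exists a. Qed.

(** A polynomial over E with root y has all conjugates of y as roots. *)
Lemma gal_pow_free (y : M) : injective (fun s : gal_of {:M} => s y) ->
  lin_free i (fun m : 'I_#|{: gal_of {:M}}| => j ((1%g : gal_of {:M}) y) ^+ m).
Proof.
move=> yinj c; rewrite gal_id => c0 m.
pose R : {poly E} := \poly_(m < #|{: gal_of {:M}}|) (if insub m is Some k then c k else 0).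
suff R0 : map_poly (in_alg M) R = 0.
  move/eqP: R0; rewrite map_poly_eq0 => /eqP /(congr1 (fun q : {poly E} => q`_m)).
  by rewrite coef_poly ltn_ord coef0 valK.
have Ry : (map_poly (in_alg M) R).[y] = 0.
  apply: (fmorph_inj j); rewrite rmorph0 -[RHS]c0.
  rewrite (@horner_coef_wide _ #|{: gal_of {:M}}|); last first.
    by rewrite size_map_poly size_poly.
  rewrite rmorph_sum; apply: eq_bigr => k _.
  by rewrite coef_map coef_poly ltn_ord valK rmorphM rmorphXn.
apply: (@roots_geq_poly_eq0 _ _ [seq s y | s : gal_of {:M}]).
- apply/allP => _ /mapP[s _ ->]; rewrite /root.
  have -> : map_poly (in_alg M) R = map_poly s (map_poly (in_alg M) R).
    by apply/polyP => k; rewrite !coef_map /= gal_alg.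
  by rewrite horner_map Ry rmorph0.
- by rewrite map_inj_uniq ?enum_uniq.
- by rewrite size_map -cardT size_map_poly size_poly.
Qed.

Lemma gal_skolem_noether (s : gal_of {:M}) :
  exists2 d, d != 0 & forall x, j x * d = d * j (s x).
Proof.
have [y yM] := gal_primitive galM.
have yinj : injective (fun s : gal_of {:M} => s y).
  by move=> t t'; exact: gal_eval_inj.
have [P PE] := orbit_poly galM y.
have [d d0 ed] := exists_eigen base_central Ddiv base_onto
  (fun a => erefl) PE (gal_pow_free yinj) s.
exists d => // x.
have : x \in <<1; y>>%VS by rewrite yM memvf.
case/Fadjoin1_polyP => q ->.
have := eigen_horner base_central (fun a => erefl) q ed.
rewrite /= gal_id => ->; congr (_ * j _).
rewrite -horner_map; congr (_.[_]); apply/polyP => k.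
by rewrite !coef_map /= gal_alg.
Qed.

Lemma gal_eigen_sum z : exists2 d : gal_of {:M} -> D,
  (forall s x, j x * d s = d s * j (s x)) & z = \sum_s d s.
Proof.
have [y yM] := gal_primitive galM.
have yinj : injective (fun s : gal_of {:M} => s y).
  by move=> t t'; exact: gal_eval_inj.
have [P PE] := orbit_poly galM y.
have [d ed zE] := eigen_sum base_central (fun a => erefl) (1%g : gal_of {:M}) yinj PE z.
exists d => // s x.
have : x \in <<1; y>>%VS by rewrite yM memvf.
case/Fadjoin1_polyP => q ->.
have := eigen_horner base_central (fun a => erefl) q (ed s).
rewrite /= gal_id => ->; congr (_ * j _).
rewrite -horner_map; congr (_.[_]); apply/polyP => k.
by rewrite !coef_map /= gal_alg.
Qed.

Definition centralizes : set D := [set c | forall x, c * j x = j x * c].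

Lemma gal_basis (J : finType) (b : J -> D) (u : gal_of {:M} -> D) :
  (forall s, u s != 0) -> (forall s x, j x * u s = u s * j (s x)) ->
  lin_free i b -> lin_spans i b centralizes -> (forall k, centralizes (b k)) ->
  let bu (ks : J * gal_of {:M}) := b ks.1 * u ks.2 in
  lin_free i bu /\ lin_spans i bu setT.
Proof.
move=> u0 uE bfree bspan bcent bu.
have [y yM] := gal_primitive galM.
have yinj : injective (fun s : gal_of {:M} => s y).
  by move=> t t'; exact: gal_eval_inj.
have [P PE] := orbit_poly galM y.
have eu s : eigen j (fun s : gal_of {:M} => s y) 1%g s (u s).
  by rewrite /eigen gal_id.
split.
  apply: (free_eigen_mul base_central Ddiv yinj PE eu u0 bfree) => k.
  by rewrite /= gal_id; exact: bcent.
apply: (spans_eigen_mul base_central Ddiv (fun a => erefl) yinj PE eu u0) => c.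
rewrite /= gal_id => cy; apply: bspan => x.
have : x \in <<1; y>>%VS by rewrite yM memvf.
case/Fadjoin1_polyP => q ->; rewrite horner_coef rmorph_sum big_distrr big_distrl /=.
apply: eq_bigr => k _; rewrite coef_map rmorphM rmorphXn /=.
rewrite mulrA -[c * _]base_central -!mulrA; congr (_ * _).
elim: (k : nat) => [|m IHm]; first by rewrite expr0 mulr1 mul1r.
by rewrite exprSr mulrA IHm -!mulrA cy.
Qed.

(** This gives dim D = [M:E]^2 when M is its own centralizer: each of the [M:E]
    eigenspaces is a line over M. *)
Lemma gal_self_centralizing_basis : centralizes `<=` range j ->
  exists b : 'I_#|{: gal_of {:M}}| * gal_of {:M} -> D,
    lin_free i b /\ lin_spans i b setT.
Proof.
move=> selfc.
have [y yM] := gal_primitive galM.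
have yinj : injective (fun s : gal_of {:M} => s y).
  by move=> t t'; exact: gal_eval_inj.
have /boolp.choice[u uP] : forall s : gal_of {:M}, exists d,
    d != 0 /\ forall x, j x * d = d * j (s x).
  by move=> s; have [d d0 dP] := gal_skolem_noether s; exists d.
exists (fun ks : 'I_#|{: gal_of {:M}}| * gal_of {:M} => j ((1%g : gal_of {:M}) y) ^+ ks.1 * u ks.2).
apply: (@gal_basis _ (fun k : 'I_#|{: gal_of {:M}}| => j ((1%g : gal_of {:M}) y) ^+ k)) => [s|s x|||k x].
- by have [] := uP s.
- by have [_] := uP s; exact.
- exact: gal_pow_free.
- move=> _ /selfc[x _ <-].
  have [P PE] := orbit_poly galM y.
  have : x \in <<1; y>>%VS by rewrite yM memvf.
  case/Fadjoin1_polyP => q ->.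
  pose r := (q %% P)%R.
  have szP : size P = #|{: gal_of {:M}}|.+1.
    rewrite -(size_map_poly (in_alg M)) PE size_prod_XsubC.
    by rewrite cardE -deprecated_filter_index_enum filter_predT.
  have P0 : P != 0 by rewrite -size_poly_eq0 szP.
  exists (fun k : 'I_#|{: gal_of {:M}}| => r`_k); rewrite gal_id.
  have -> : (map_poly (in_alg M) q).[y] = (map_poly (in_alg M) r).[y].
    rewrite {1}(divp_eq q P) rmorphD rmorphM /= hornerD hornerM PE.
    rewrite [X in _ * X + _](_ : _ = 0) ?mulr0 ?add0r //.
    by rewrite (bigD1 1%g) //= hornerM hornerXsubC gal_id subrr mul0r.
  rewrite (@horner_coef_wide _ #|{: gal_of {:M}}|); last first.
    by rewrite size_map_poly -ltnS -szP ltn_modp.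
  rewrite rmorph_sum; apply: eq_bigr => k _.
  by rewrite coef_map rmorphM rmorphXn.
- by rewrite -rmorphXn -!rmorphM mulrC.
Qed.

(** By the Skolem-Noether theorem s is conjugation by some d, and the value of d
    cancels because the value group is commutative. *)
Lemma gal_val (H : ordAbGroupType) (W : valuation D H) (s : gal_of {:M}) x :
  W (j (s x)) = W (j x).
Proof.
have [d d0 dP] := gal_skolem_noether s.
have := congr1 W (dP x); rewrite !val_mul.
have : W d <> None by move/(val_infty W) => dd; rewrite dd eqxx in d0.
case: (W d) => [g _|//]; case: (W _) (W _) => [a|] [b|] //= [].
by rewrite addrC => /addrI ->.
Qed.

End GaloisInDivisionRing.

(** * Residues and tame ramification *)

Lemma rmorphism_of (R S : nzRingType) (f : R -> S) :
  zmod_morphism f -> monoid_morphism f ->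
  exists g : {rmorphism R -> S}, g =1 f.
Proof.
move=> fB fM.
pose fa := GRing.isZmodMorphism.Build R S f fB.
pose fm := GRing.isMonoidMorphism.Build R S f fM.
pose g : GRing.RMorphism.type R S := HB.pack f fa fm.
by exists g.
Qed.

Section Residues.
Variables (L : fieldType) (G : ordAbGroupType) (v : valuation L G).

Definition pos_val (x : option G) : bool := ~~ infty_le x (Some 0).

Lemma in_valring x : (x \in valring v) = infty_le (Some 0) (v x).
Proof. by []. Qed.

Lemma residueE (x : L) (xO : x \in valring v) :
  residue v x = \pi_({ideal_quot (@valmax L G v)})%qT (ValringSub xO).
Proof.
rewrite /residue; congr (\pi_({ideal_quot _})%qT _).
by apply: val_inj; rewrite /= insubdK.
Qed.

Lemma residue_eq0 x : x \in valring v -> (residue v x == 0) = pos_val (v x).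
Proof.
move=> xO; rewrite (residueE xO).
rewrite -[0](@rmorph0 _ _ (\pi_({ideal_quot (@valmax L G v)})%qT)).
by rewrite -Quotient.idealrBE subr0.
Qed.

Lemma residueB : {in valring v &, {morph residue v : x y / x - y}}.
Proof.
move=> x y xO yO; have xyO := rpredB xO yO.
rewrite (residueE xO) (residueE yO) (residueE xyO).
rewrite -[RHS](@rmorphB _ _ (\pi_({ideal_quot (@valmax L G v)})%qT)).
by congr (\pi_({ideal_quot _})%qT _); apply: val_inj.
Qed.

Lemma residueM : {in valring v &, {morph residue v : x y / x * y}}.
Proof.
move=> x y xO yO; have xyO := rpredM xO yO.
rewrite (residueE xO) (residueE yO) (residueE xyO).
rewrite -[RHS](@rmorphM _ _ (\pi_({ideal_quot (@valmax L G v)})%qT)).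
by congr (\pi_({ideal_quot _})%qT _); apply: val_inj.
Qed.

Lemma residue1 : residue v 1 = 1.
Proof.
have O1 : 1 \in valring v by exact: rpred1.
rewrite (residueE O1) -[RHS](@rmorph1 _ _ (\pi_({ideal_quot (@valmax L G v)})%qT)).
by congr (\pi_({ideal_quot _})%qT _); apply: val_inj.
Qed.

Lemma residue0 : residue v 0 = 0.
Proof. by apply/eqP; rewrite residue_eq0 ?rpred0 // val0. Qed.

Lemma residueD : {in valring v &, {morph residue v : x y / x + y}}.
Proof.
move=> x y xO yO; have NyO : - y \in valring v by rewrite rpredN.
have := residueB xO NyO; rewrite opprK => ->; congr (_ + _).
by have := residueB (rpred0 _) yO; rewrite residue0 !sub0r => ->; rewrite opprK.
Qed.

Lemma residueX x n : x \in valring v -> residue v (x ^+ n) = residue v x ^+ n.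
Proof.
move=> xO; elim: n => [|n IHn]; first by rewrite !expr0 residue1.
by rewrite !exprS residueM ?rpredX // IHn.
Qed.

Lemma residue_sum (I : finType) (f : I -> L) : (forall k, f k \in valring v) ->
  residue v (\sum_k f k) = \sum_k residue v (f k).
Proof.
move=> fO; elim: (index_enum I) => [|k s IHs]; first by rewrite !big_nil residue0.
by rewrite !big_cons residueD ?rpred_sum // IHs.
Qed.

Lemma residue_surj (c : residue_field v) :
  exists2 x, x \in valring v & residue v x = c.
Proof.
pose x := repr (c : {ideal_quot (@valmax L G v)}).
exists (val x); first exact: valP.
rewrite -[RHS](@reprK _ {ideal_quot (@valmax L G v)}) (residueE (valP x)).
by congr (\pi_({ideal_quot _})%qT _); apply: val_inj.
Qed.

Lemma val_eq0 x : x \in valring v -> residue v x != 0 -> v x = Some 0.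
Proof.
move=> xO; rewrite residue_eq0 // negbK; move: xO; rewrite in_valring.
by case: (v x) => //= g g0 g0'; congr Some; apply/eqP; rewrite eq_le g0 g0'.
Qed.

Lemma val_unit x : v x = Some 0 -> x \in valring v /\ residue v x != 0.
Proof.
move=> vx; have xO : x \in valring v by rewrite in_valring vx /= lexx.
by rewrite residue_eq0 // /pos_val vx /= lexx.
Qed.

Lemma valV x g : v x = Some g -> v x^-1 = Some (- g).
Proof.
move=> vx; have x0 : x != 0 by apply/eqP => /(val_infty v _).2; rewrite vx.
have := val_mul v x^-1 x; rewrite mulVf // Defs.val1 vx.
case: (v _) => [h|] //= [] h0; congr Some.
by apply/eqP; rewrite -addr_eq0 -h0.
Qed.

Lemma val_div x y g : v x = Some g -> v y = Some g -> v (x / y) = Some 0.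
Proof. by move=> vx vy; rewrite val_mul (valV vy) vx /= subrr. Qed.

Lemma residueV x : v x = Some 0 -> residue v x^-1 = (residue v x)^-1.
Proof.
move=> vx; have [xO rx0] := val_unit vx.
have [xVO _] : x^-1 \in valring v /\ residue v x^-1 != 0.
  by apply: val_unit; rewrite (valV vx) oppr0.
apply: (mulIf rx0); rewrite mulVf // -residueM // mulVf ?residue1 //.
by apply/eqP => /(val_infty v _).2; rewrite vx.
Qed.

End Residues.

Section TameGalois.
Variables (E : fieldType) (M : splittingFieldType E).
Hypothesis galM : galois 1 {:M}.
Variables (H : ordAbGroupType) (w : valuation M H).
Hypothesis w_gal : forall (s : gal_of {:M}) x, w (s x) = w x.
Variables (k : fieldType) (h : {rmorphism k -> residue_field w}).
Hypothesis h_residue : forall e : E, e%:A \in valring w ->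
  exists a, h a = residue w e%:A.
Hypothesis h_lift : forall a, exists2 e : E, e%:A \in valring w &
  residue w e%:A = h a.
Hypothesis card_gal_neq0 : (#|{: gal_of {:M}}|%:R : k) != 0.

Local Notation O := (valring w).
Local Notation r := (residue w).

Lemma gal_valring (s : gal_of {:M}) x : (s x \in O) = (x \in O).
Proof. by rewrite !in_valring w_gal. Qed.

Lemma gal_unit (s : gal_of {:M}) z : z != 0 -> w (s z / z) = Some 0.
Proof.
by move=> /(val_neq0 w)[g wz]; apply: (@val_div _ _ _ _ _ g); rewrite ?w_gal.
Qed.

(** Invariance of w under the Galois group makes it act on the residue field. *)
Lemma residue_action : exists gb : gal_of {:M} ->
    {rmorphism residue_field w -> residue_field w},
  [/\ forall s x, x \in O -> gb s (r x) = r (s x),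
      forall s t c, gb (s * t)%g c = gb t (gb s c),
      forall c, gb 1%g c = c
    & forall s a, gb s (h a) = h a].
Proof.
have [l lP] : exists l : residue_field w -> M, forall c, l c \in O /\ r (l c) = c.
  have /boolp.choice[l lP] : forall c : residue_field w, exists x, x \in O /\ r x = c.
    by move=> c; have [x xO <-] := residue_surj c; exists x.
  by exists l.
have lr (s : gal_of {:M}) x : x \in O -> r (s (l (r x))) = r (s x).
  move=> xO; apply/eqP; rewrite -subr_eq0 -residueB ?gal_valring ?(lP _).1 //.
  rewrite -rmorphB residue_eq0 ?gal_valring ?rpredB ?(lP _).1 // w_gal.
  by rewrite -residue_eq0 ?rpredB ?(lP _).1 // residueB ?(lP _).1 // (lP _).2 subrr.
have /boolp.choice[gb gbE] : forall s : gal_of {:M},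
    exists g : {rmorphism residue_field w -> residue_field w},
      g =1 (fun c => r (s (l c))).
  move=> s; apply: rmorphism_of => [a b|].
    rewrite -[in LHS](lP a).2 -[in LHS](lP b).2 -residueB ?(lP _).1 //.
    by rewrite lr ?rpredB ?(lP _).1 // rmorphB residueB ?gal_valring ?(lP _).1.
  split=> [|a b]; first by rewrite -residue1 lr ?rpred1 // rmorph1.
  rewrite -[in LHS](lP a).2 -[in LHS](lP b).2 -residueM ?(lP _).1 //.
  by rewrite lr ?rpredM ?(lP _).1 // rmorphM residueM ?gal_valring ?(lP _).1.
have gbr s x : x \in O -> gb s (r x) = r (s x) by move=> xO; rewrite gbE lr.
exists gb; split=> // [s t c|c|s a].
- have [x xO <-] := residue_surj c.
  by rewrite !gbr ?gal_valring // galMv.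
- by have [x xO <-] := residue_surj c; rewrite gbr // gal_id.
- by have [e eO <-] := h_lift a; rewrite gbr // gal_alg.
Qed.

Lemma gal_sum_base x : exists e : E, \sum_(s : gal_of {:M}) s x = e%:A.
Proof.
apply: gal_fix_base => // t; rewrite rmorph_sum [RHS](reindex_inj (mulIg t)) /=.
by apply: eq_bigr => s _; rewrite galMv.
Qed.

Lemma residue_card_neq0 : (#|{: gal_of {:M}}|%:R : residue_field w) != 0.
Proof. by rewrite -(rmorph_nat h) fmorph_eq0. Qed.

(** The average of the conjugates of x lies in E and has the residue of x. *)
Lemma residue_fixed x : x \in O -> (forall s : gal_of {:M}, r (s x) = r x) ->
  exists a, h a = r x.
Proof.
move=> xO fx; have [e eE] := gal_sum_base x.
have eO : e%:A \in O by rewrite -eE rpred_sum // => s _; rewrite gal_valring.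
have [a aE] := h_residue eO; exists (a / #|{: gal_of {:M}}|%:R).
rewrite fmorph_div aE -eE rmorph_nat residue_sum; last by move=> s; rewrite gal_valring.
under eq_bigr do rewrite fx.
rewrite sumr_const -[_ *+ _]mulr_natr mulfK ?residue_card_neq0 //.
Qed.

(** The sum of the conjugates of z is |G| z up to terms of higher value. *)
Lemma value_fixed z : z != 0 -> (forall s : gal_of {:M}, r (s z / z) = 1) ->
  exists e : E, w e%:A = w z.
Proof.
move=> z0 fz; have [e eE] := gal_sum_base z; exists e; rewrite -eE.
have zO (s : gal_of {:M}) : s z / z \in O by apply: (val_unit (gal_unit s z0)).1.
have -> : \sum_(s : gal_of {:M}) s z = (\sum_(s : gal_of {:M}) s z / z) * z.
  by rewrite big_distrl; apply: eq_bigr => s _; rewrite /= mulfVK.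
rewrite val_mul val_eq0 ?rpred_sum //; first by case: (w z) => //= g; rewrite add0r.
rewrite residue_sum //; under eq_bigr do rewrite fz.
by rewrite sumr_const residue_card_neq0.
Qed.

(** The map s |-> (residue of s z / z) is a 1-cocycle. *)
Lemma residue_twistM (s t : gal_of {:M}) z : z != 0 ->
  r ((s * t)%g z / z) = r (t (s z / z)) * r (t z / z).
Proof.
move=> z0; rewrite -residueM ?gal_valring; first last.
- exact: (val_unit (gal_unit _ z0)).1.
- exact: (val_unit (gal_unit _ z0)).1.
congr (r _); rewrite galMv fmorph_div mulrA mulfVK //.
by rewrite fmorph_eq0.
Qed.

Lemma residue_twistX (s : gal_of {:M}) n z : z != 0 ->
  r (s z / z) = 1 -> r ((s ^+ n)%g z / z) = 1.
Proof.
move=> z0 rs; elim: n => [|n IHn]; first by rewrite gal_id divff // residue1.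
rewrite expgSr residue_twistM // rs mulr1.
have O1 := (val_unit (gal_unit (s ^+ n)%g z0)).1.
apply/eqP; rewrite -subr_eq0 -residue1 -residueB ?gal_valring ?rpred1 //.
rewrite -(rmorph1 s) -rmorphB residue_eq0 ?gal_valring ?rpredB ?rpred1 // w_gal.
by rewrite -residue_eq0 ?rpredB ?rpred1 // residueB ?rpred1 // IHn residue1 subrr.
Qed.

(** For z = s y - y the sum of the s^n z over a period vanishes. If s z / z had
    residue 1, then this sum divided by z would have the order of s as residue,
    and this order is invertible. *)
Lemma tame_ramification (s : gal_of {:M}) : s != 1%g ->
  exists2 z, z != 0 & r (s z / z) != 1.
Proof.
move=> s1; have [y sy] : exists y, s y != y.
  apply: contrapT => ny; move/eqP: s1; apply; apply/eqP/gal_eqP => y _.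
  by rewrite gal_id; apply/eqP/negPn/negP => yy; apply: ny; exists y.
pose z := s y - y; have z0 : z != 0 by rewrite subr_eq0.
exists z => //; apply/eqP => rs.
have zn n := residue_twistX n z0 rs.
have zO n : (s ^+ n)%g z / z \in O by apply: (val_unit (gal_unit _ z0)).1.
have : \sum_(n < #[s]%g) (s ^+ n)%g z = 0.
  transitivity (\sum_(n < #[s]%g) ((s ^+ n.+1)%g y - (s ^+ n)%g y)).
    by apply: eq_bigr => n _; rewrite expgS galMv rmorphB.
  rewrite -(big_mkord xpredT (fun n => (s ^+ n.+1)%g y - (s ^+ n)%g y)).
  by rewrite telescope_sumr // expg_order expg0 subrr.
move/(congr1 (fun x => r (x / z))); rewrite mul0r residue0 big_distrl /=.
rewrite residue_sum //; under eq_bigr do rewrite zn.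
rewrite sumr_const card_ord => /eqP; apply/negP.
have : (#[s]%g %| #|{: gal_of {:M}}|)%N.
  by rewrite -cardsT (cardSg (finset.subsetT <[s]>%g)).
move=> /dvdnP[m mE]; have := residue_card_neq0; rewrite mE natrM mulf_eq0 negb_or.
by case/andP.
Qed.

End TameGalois.

(** * Automorphism groups with finite fixed field *)

Section FiniteFields.
Variables (k : fieldType) (s : seq k) (s_enum : Finite.axiom s).

Lemma mem_enumeration x : x \in s.
Proof. by rewrite -has_pred1 has_count s_enum. Qed.

Lemma enumeration_uniq : uniq s.
Proof. by apply/count_mem_uniq => x; rewrite s_enum mem_enumeration. Qed.

Lemma finite_field_facts :
  [/\ (1 < size s)%N, forall a : k, a ^+ size s = a,
      [pchar k].-nat (size s)
    & exists z : k, forall c, c != 0 -> exists n, c = z ^+ n].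
Proof.
have idxK : cancel (fun x : k => index x s) (fun n => nth 0 s n).
  by move=> x; rewrite nth_index ?mem_enumeration.
(* [k] itself, enumerated by [s], so that the theory of finite fields applies *)
pose Q : finFieldType := HB.pack (k : Type) (GRing.Field.class k)
  (isFinite.Build k s_enum) (CanIsCountable idxK).
have cardQ : #|Q| = size s.
  have /card_uniqP <- : uniq (s : seq Q) by exact: enumeration_uniq.
  by apply/esym/eq_card => x; rewrite inE; apply: mem_enumeration.
have s_gt1 : (1 < size s)%N by rewrite -cardQ; exact: finNzRing_gt1.
have sX (a : k) : a ^+ size s = a by rewrite -cardQ; exact: (@expf_card Q a).
split=> //.
  have [l l_pr lk] := finPcharP Q.
  have := pprimeChar_pgroup lk; rewrite /pgroup cardsT cardQ => lnat.
  by apply: sub_in_pnat lnat => m _; rewrite inE => /eqP ->.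
have n_gt0 : (0 < (size s).-1)%N by rewrite -subn1 subn_gt0.
have sX1 (c : k) : c != 0 -> (size s).-1.-unity_root c.
  move=> c0; rewrite unity_rootE; apply/eqP/(mulfI c0).
  by rewrite -exprS prednK ?sX ?mulr1 // ltnW.
have := @has_prim_root k (size s).-1 (rem 0 s) n_gt0.
case/(_ _ _ _)/hasP => [|||z _ zprim].
- by apply/allP => c; rewrite mem_rem_uniq ?enumeration_uniq // inE => /andP[/sX1].
- by rewrite rem_uniq ?enumeration_uniq.
- by rewrite size_rem ?mem_enumeration.
exists z => c c0; have /sX1 := c0; rewrite unity_rootE => /eqP c1.
by have [n ->] := prim_rootP zprim c1; exists n.
Qed.

End FiniteFields.

(** A duplicate-free list of maximal length contains every element. *)
Lemma enumeration_of_roots (k : fieldType) (f : {poly k}) : f != 0 ->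
  (forall c, root f c) -> exists s : seq k, Finite.axiom s.
Proof.
move=> f0 froot.
pose P n := `[< exists2 s : seq k, uniq s & size s = n >].
have P0 : exists n, P n by exists 0%N; apply/asboolP; exists [::].
have Pb n : P n -> (n <= size f)%N.
  move=> /asboolP[s us <-]; apply/ltnW/max_poly_roots => //.
  by apply/allP => c _.
have [n /asboolP[s us sn] nmax] := ex_maxnP P0 Pb; exists s => x.
rewrite count_uniq_mem //; apply/eqP; rewrite eqb1.
apply/negPn/negP => xs; suff /nmax : P n.+1 by rewrite ltnn.
by apply/asboolP; exists (x :: s); rewrite /= ?xs ?sn.
Qed.

Section FiniteFixedField.
Variables (R : fieldType) (gT : finGroupType) (g : gT -> {rmorphism R -> R}).
Hypothesis gM : forall s t c, g (s * t)%g c = g t (g s c).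
Hypothesis g1 : forall c, g 1%g c = c.
Variables (k : fieldType) (h : {rmorphism k -> R}).
Hypothesis gh : forall s a, g s (h a) = h a.
Hypothesis g_fixed : forall c, (forall s, g s c = c) -> exists a, h a = c.
Variables (ks : seq k) (ks_enum : Finite.axiom ks).

Let q := size ks.

Let q_gt1 : (1 < q)%N.
Proof. by have [] := finite_field_facts ks_enum. Qed.

Let hX a : h a ^+ q = h a.
Proof. by have [_ kX _ _] := finite_field_facts ks_enum; rewrite -rmorphXn kX. Qed.

Let frobB : zmod_morphism (fun c : R => c ^+ q).
Proof.
move=> a b.
have qR : [pchar R].-nat q.
  have [_ _ qk _] := finite_field_facts ks_enum.
  by apply: sub_in_pnat qk => m _; rewrite (fmorph_pchar h).
rewrite exprDn_pchar //; congr (_ + _).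
apply/eqP; rewrite -addr_eq0 -exprDn_pchar // addNr expr0n /=.
by rewrite -[q]prednK // ltnW.
Qed.

Let frob : exists F : {rmorphism R -> R}, F =1 (fun c => c ^+ q).
Proof.
apply: rmorphism_of; first exact: frobB.
by split=> [|a b]; rewrite ?expr1n ?exprMn.
Qed.

Lemma frobenius_in_orbit c : exists s, c ^+ q = g s c.
Proof.
have [F FE] := frob; have [P PE] := action_orbit_poly gM g_fixed c.
(* the coefficients lie in the finite field [k], so raising them to the power
   [q] fixes them, and raising a root to the power [q] gives a root *)
have PF : map_poly F (map_poly h P) = map_poly h P.
  by apply/polyP => m; rewrite !coef_map /= FE hX.
have : root (map_poly h P) (c ^+ q).
  rewrite -FE -PF /root horner_map fmorph_eq0 PE horner_prod (bigD1 1%g) //=.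
  by rewrite hornerXsubC g1 subrr mul0r.
rewrite PE /root horner_prod prodf_seq_eq0 => /hasP[s _ /=].
by rewrite hornerXsubC subr_eq0 => /eqP ->; exists s.
Qed.

Let frobX c n : exists s, c ^+ (q ^ n) = g s c.
Proof.
elim: n => [|n [s IHn]]; first by exists 1%g; rewrite g1 expr1.
have [t tE] := frobenius_in_orbit c; exists (t * s)%g.
by rewrite expnSr exprM IHn -rmorphXn tE gM.
Qed.

(** By [frobX] two of the first |G| + 1 iterates of the Frobenius map agree at c,
    so c is a root of X^(q^N) - X for N = |G|!. *)
Lemma finite_of_finite_fixed : exists s : seq R, Finite.axiom s.
Proof.
have [F FE] := frob.
pose N := (#|gT|)`!.
have FN (c : R) : c ^+ (q ^ N) = c.
  have /boolp.choice[s sE] : forall n : 'I_#|gT|.+1, exists s, c ^+ (q ^ n) = g s c.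
    by move=> n; exact: frobX.
  have /injectivePn[a [b ab sab]] : ~~ injectiveb s.
    by apply/injectiveP => /leq_card; rewrite card_ord ltnn.
  wlog ltab : a b ab sab / (a < b)%N.
    move=> WL; have := ab; rewrite -val_eqE neq_ltn => /orP[|] lt.
      exact: (WL a b).
    by apply: (WL b a) => //; rewrite eq_sym.
  have cX m e : (c ^+ m) ^+ (q ^ e) = (c ^+ (q ^ e)) ^+ m by rewrite -!exprM mulnC.
  have cba : c ^+ (q ^ (b - a)) = c.
    have Finj n x y : x ^+ (q ^ n) = y ^+ (q ^ n) -> x = y :> R.
      elim: n x y => [|n IHn] x y; first by rewrite !expr1.
      by rewrite expnS !exprM => /IHn; rewrite -!FE => /fmorph_inj.
    apply: (Finj a); rewrite -exprM -expnD subnK ?(ltnW ltab) //.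
    by rewrite !sE sab.
  have /dvdnP[m ->] : (b - a %| N)%N.
    rewrite dvdn_fact // subn_gt0 ltab /= leq_subLR.
    by rewrite (leq_trans _ (leq_addl _ _)) // -ltnS.
  elim: m => [|m IHm]; first by rewrite mul0n expr1.
  by rewrite mulSn expnD exprM cba.
apply: (@enumeration_of_roots _ ('X^(q ^ N) - 'X)).
  rewrite subr_eq0; apply/eqP => /(congr1 (fun p : {poly R} => size p)).
  rewrite size_polyXn size_polyX => -[] /eqP.
  rewrite -[X in _ == X](expn0 q) eqn_exp2l // /N.
  by have := fact_gt0 #|gT|; case: (_`!).
by move=> c; rewrite /root !hornerE FN subrr.
Qed.

Hypothesis g_faithful : forall s, (forall c, g s c = c) -> s = 1%g.

(** Let z generate the multiplicative group and let t be the element of the group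
    with z^q = t z. Then t induces the Frobenius map, so the polynomial with roots
    the t^n z has coefficients in the field of q elements, which is the fixed
    field of the whole group. Hence s z is one of the t^n z for every s. *)
Lemma finite_fixed_cyclic : exists z t,
  injective (fun s => g s z) /\ forall s : gT, s \in <[t]>%g.
Proof.
have [rs rs_enum] := finite_of_finite_fixed.
have [_ _ _ [z zP]] := finite_field_facts rs_enum.
have zinj : injective (fun s => g s z).
  move=> s t st; suff /g_faithful : forall c, g (s * t^-1)%g c = c.
    by move/(canRL (mulgKV _)); rewrite mul1g.
  move=> c; have [->|/zP[n ->]] := eqVneq c 0; first by rewrite rmorph0.
  by rewrite rmorphXn /= gM st -gM mulgV g1.
have [t tE] := frobenius_in_orbit z.
have tX c : c ^+ q = g t c.
  have [->|/zP[n ->]] := eqVneq c 0.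
    by rewrite rmorph0 expr0n; case: q q_gt1 => //.
  by rewrite rmorphXn /= -tE -!exprM mulnC.
exists z, t; split=> // s.
pose Q := \prod_(u in <[t]>%g) ('X - (g u z)%:P).
have Qt : map_poly (g t) Q = Q.
  rewrite rmorph_prod [RHS](reindex_inj (mulIg t)) /=.
  apply: eq_big => [u|u _]; first by rewrite groupMr ?cycle_id.
  by rewrite map_polyXsubC gM.
have Qs : map_poly (g s) Q = Q.
  apply/polyP => m; rewrite coef_map /=.
  have Qm : Q`_m ^+ q = Q`_m by rewrite tX -{2}Qt coef_map.
  suff /mapP[a _ ->] : Q`_m \in [seq h a | a <- ks] by rewrite gh.
  (* the q elements of [k] already exhaust the roots of X^q - X *)
  apply/negPn/negP => Qmks.
  have := @max_poly_roots _ ('X^q - 'X) (Q`_m :: [seq h a | a <- ks]).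
  rewrite /= Qmks map_inj_uniq ?enumeration_uniq //; last exact: fmorph_inj.
  rewrite size_map -/q size_polyDl size_polyXn ?size_polyN ?size_polyX //.
  rewrite ltnn => F; suff : false by []; apply: F.
  - rewrite subr_eq0; apply/eqP => /(congr1 (fun p : {poly R} => size p)).
    by rewrite size_polyXn size_polyX => -[] q1; move: q_gt1; rewrite q1.
  - rewrite /root !hornerE Qm subrr eqxx /=; apply/allP => _ /mapP[a _ ->].
    by rewrite /root !hornerE hX subrr.
  - by [].
have : root Q (g s z).
  rewrite -Qs /root horner_map fmorph_eq0 horner_prod (bigD1 1%g) ?group1 //=.
  by rewrite hornerXsubC g1 subrr mul0r.
rewrite /root horner_prod prodf_seq_eq0 => /hasP[u _ /= /andP[ut]].
by rewrite hornerXsubC subr_eq0 => /eqP/zinj ->.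
Qed.

End FiniteFixedField.

(** * Tame Galois extensions of degree p^2 *)

Section TameGaloisPrimeSquare.
Variables (E : fieldType) (M : splittingFieldType E).
Hypothesis galM : galois 1 {:M}.
Variables (H : ordAbGroupType) (w : valuation M H).
Hypothesis w_gal : forall (s : gal_of {:M}) x, w (s x) = w x.
Variables (k : fieldType) (h : {rmorphism k -> residue_field w}).
Hypothesis h_residue : forall e : E, e%:A \in valring w ->
  exists a, h a = residue w e%:A.
Hypothesis h_lift : forall a, exists2 e : E, e%:A \in valring w &
  residue w e%:A = h a.
Variable p : nat.
Hypothesis p_prime : prime p.
Hypothesis card_gal : #|{: gal_of {:M}}| = (p ^ 2)%N.
Hypothesis p_neq0 : (p%:R : k) != 0.

Local Notation O := (valring w).
Local Notation r := (residue w).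

Let card_neq0 : (#|{: gal_of {:M}}|%:R : k) != 0.
Proof. by rewrite card_gal natrX expf_neq0. Qed.

Let gal_exp (s : gal_of {:M}) : (s ^+ (p ^ 2) = 1)%g.
Proof.
apply/eqP; rewrite -order_dvdn -card_gal -cardsT.
by rewrite (cardSg (finset.subsetT <[s]>%g)).
Qed.

Let residue_twist_pow (s : gal_of {:M}) n z : z != 0 ->
  (forall x, x \in O -> r (s x) = r x) ->
  r ((s ^+ n)%g z / z) = r (s z / z) ^+ n.
Proof.
move=> z0 sr; elim: n => [|n IHn]; first by rewrite gal_id divff // residue1.
rewrite expgSr (residue_twistM w_gal) // sr ?IHn ?exprSr //.
exact: (val_unit (gal_unit w_gal _ z0)).1.
Qed.

Section FiniteResidueField.
Variables (ks : seq k) (ks_enum : Finite.axiom ks).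
Hypothesis q_neq1 : size ks <> 1 %[mod p].

(** If s acts trivially on residues, then n |-> (residue of s^n z / z) is a
    homomorphism, so a nontrivial s gives a residue of order p. The group acts on
    the powers of this residue through the units modulo p, whose order is prime
    to p, hence trivially: the residue comes from E and p divides q - 1. *)
Lemma inertia_trivial (s : gal_of {:M}) :
  (forall x, x \in O -> r (s x) = r x) -> s = 1%g.
Proof.
move=> sr; apply/eqP/negPn/negP => s1.
have [z z0 rz1] := tame_ramification w_gal h card_neq0 s1.
have [zO _] := val_unit (gal_unit w_gal s z0).
have rzp2 : r (s z / z) ^+ (p ^ 2) = 1.
  by rewrite -residue_twist_pow // gal_exp gal_id divff // residue1.
have [t [tO tp t1]] : exists t, [/\ t \in O, r t ^+ p = 1 & r t != 1].
  have [zp1|zp1] := eqVneq (r (s z / z) ^+ p) 1; first by exists (s z / z).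
  exists ((s z / z) ^+ p); split; first exact: rpredX.
    by rewrite (residueX _ zO) -exprM mulnn.
  by rewrite (residueX _ zO).
have tprim : p.-primitive_root (r t).
  have p_gt0 := prime_gt0 p_prime.
  have [m mprim mp] := prim_order_exists p_gt0 tp.
  move/primeP: p_prime => [_ /(_ m mp)] /orP[] /eqP mE; last by rewrite -mE.
  by move: (prim_expr_order mprim) t1; rewrite mE expr1 => ->; rewrite eqxx.
have [gb [gbr gbM gb1 gbh]] := residue_action w_gal h_lift.
have tfix (g : gal_of {:M}) : r (g t) = r t.
  have /(prim_rootP tprim)[m mE] : (gb g (r t)) ^+ p = 1.
    by rewrite -rmorphXn tp rmorph1.
  rewrite -gbr // mE.
  have gn n : gb (g ^+ n)%g (r t) = r t ^+ (m ^ n).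
    elim: n => [|n IHn]; first by rewrite gb1 expr1.
    by rewrite expgSr gbM IHn rmorphXn /= mE -exprM expnS.
  (* m^(p^2) = 1 modulo p, and m^(p^2) = m modulo p by Fermat *)
  have := gn (p ^ 2)%N; rewrite gal_exp gb1 => /esym/eqP.
  rewrite -{2}[r t]expr1 (eq_prim_root_expr tprim) => /eqP mp2.
  apply/eqP; rewrite -{2}[r t]expr1 (eq_prim_root_expr tprim); apply/eqP.
  rewrite -mp2 expnM; apply/esym; apply: etrans (fermat_little _ p_prime) _.
  exact: fermat_little.
have [a aE] := residue_fixed galM w_gal h_residue card_neq0 tO tfix.
have aprim : p.-primitive_root a by rewrite -(fmorph_primitive_root h) aE.
have [q_gt1 aq _ _] := finite_field_facts ks_enum.
have a0 : a != 0.
  apply/eqP => a0; have := prim_expr_order aprim.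
  by rewrite a0 expr0n gtn_eqF ?prime_gt0 // => /esym/eqP; rewrite oner_eq0.
apply: q_neq1; apply/eqP.
rewrite eqn_mod_dvd ?(ltnW q_gt1) // (prim_order_dvd aprim).
apply/eqP/(mulfI a0); rewrite -exprS subn1 prednK ?aq ?mulr1 //.
exact: ltnW.
Qed.

Lemma unramified_cyclic : exists y (t : gal_of {:M}),
  [/\ y \in O, injective (fun s : gal_of {:M} => r (s y))
    & forall s : gal_of {:M}, s \in <[t]>%g].
Proof.
have [gb [gbr gbM gb1 gbh]] := residue_action w_gal h_lift.
have gfix c : (forall s, gb s c = c) -> exists a, h a = c.
  have [x xO <-] := residue_surj c => fx.
  apply: (residue_fixed galM w_gal h_residue card_neq0 xO) => s.
  by rewrite -gbr.
have gfaith s : (forall c, gb s c = c) -> s = 1%g.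
  by move=> fs; apply: inertia_trivial => x xO; rewrite -gbr.
have [z [t [zinj tgen]]] :=
  finite_fixed_cyclic gbM gb1 gbh gfix ks_enum gfaith.
have [y yO yz] := residue_surj z; exists y, t; split=> // s u.
by rewrite -!gbr // yz => /zinj.
Qed.

End FiniteResidueField.

(** Dedekind's independence of characters, for the distinct multiplicative maps
    x |-> (residue of t^n x) on the valuation ring. *)
Lemma dedekind_residue (t : gal_of {:M}) m :
  (forall n, (0 < n < m)%N -> exists2 x, x \in O & r ((t ^+ n)%g x) != r x) ->
  forall a : 'I_m -> residue_field w,
    (forall x, x \in O -> \sum_(n < m) a n * r ((t ^+ n)%g x) = 0) ->
  forall n, a n = 0.
Proof.
move=> tdist.
suff main l : (l <= m)%N -> forall a : nat -> residue_field w,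
    (forall x, x \in O -> \sum_(n < l) a n * r ((t ^+ n)%g x) = 0) ->
  forall n, (n < l)%N -> a n = 0.
  move=> a a0 n; have := main m (leqnn _) (fun n => if insub n is Some n' then a n' else 0).
  move=> /(_ _ n (ltn_ord n)); rewrite valK; apply => x xO; rewrite -[RHS](a0 x xO).
  by apply: eq_bigr => n' _; rewrite valK.
elim: l => [//|l IHl] ltlm a a0.
have al0 n : (n < l)%N -> a n = 0.
  move=> ltnl; have [x xO xnl] : exists2 x, x \in O &
      r ((t ^+ n)%g x) != r ((t ^+ l)%g x).
    have [|x xO xln] := tdist (l - n)%N.
      by rewrite subn_gt0 ltnl (leq_ltn_trans _ ltlm) ?leq_subr.
    exists ((t ^- n)%g x); first by rewrite gal_valring.
    rewrite -!galMv mulVg gal_id -{1}(subnK (ltnW ltnl)) addnC expgD mulKg.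
    by rewrite eq_sym.
  suff /eqP : a n * (r ((t ^+ n)%g x) - r ((t ^+ l)%g x)) = 0.
    by rewrite mulf_eq0 subr_eq0 (negPf xnl) orbF => /eqP.
  (* the difference of the relations at x * y and, scaled, at y has no l-th term *)
  apply: (IHl (ltnW ltlm) (fun n => a n * (r ((t ^+ n)%g x) - r ((t ^+ l)%g x)))) => // y yO.
  transitivity (\sum_(n < l.+1) a n * r ((t ^+ n)%g (x * y))
    - (\sum_(n < l.+1) a n * r ((t ^+ n)%g y)) * r ((t ^+ l)%g x)); last first.
    by rewrite !a0 ?rpredM // mul0r subr0.
  rewrite !big_ord_recr /= mulrDl opprD addrACA.
  rewrite rmorphM residueM ?gal_valring // [X in _ = _ + X](_ : _ = 0); last first.
    by rewrite [r _ * r _]mulrC mulrA subrr.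
  rewrite addr0 big_distrl -sumrB /=; apply: eq_bigr => m' _.
  rewrite rmorphM residueM ?gal_valring //.
  by rewrite mulrBr mulrBl -!mulrA; congr (_ * _ - _ * _); rewrite mulrC.
move=> n; rewrite ltnS leq_eqVlt => /orP[/eqP ->|/al0 //].
have := a0 1 (rpred1 _); rewrite big_ord_recr /= big1 ?add0r.
  by rewrite rmorph1 residue1 mulr1.
by move=> n' _; rewrite al0 // mul0r.
Qed.

(** Let m be the order of the action of t on residues; it divides p^2. If m > 1
    then p divides m, so t^m x / x has residue 1, and for a suitable b the sum S
    of the t^n (x b), n < m, has the value of x while t S / S has residue 1. Then
    the value of x is taken on E, a contradiction. So t acts trivially on
    residues, and [tame_ramification] for t^p provides a residue of t z / z whose
    p-th power is not 1. *)
Lemma ramified_cyclic_unity_root (t : gal_of {:M}) (x : M) :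
  (forall s : gal_of {:M}, s \in <[t]>%g) ->
  x != 0 -> (forall e : E, w e%:A != w x) -> r ((t ^+ p)%g x / x) = 1 ->
  exists a : k, (p ^ 2)%N.-primitive_root a.
Proof.
move=> tgen x0 wx xtp.
have tE s : exists n, s = (t ^+ n)%g by apply/cycleP/tgen.
pose P m := (0 < m)%N && `[< forall y, y \in O -> r ((t ^+ m)%g y) = r y >].
have Pp2 : P (p ^ 2)%N.
  rewrite /P expn_gt0 prime_gt0 //=; apply/asboolP => y yO.
  by rewrite gal_exp gal_id.
have [m /andP[m_gt0 /asboolP tm] mmin] := ex_minnP (ex_intro P _ Pp2).
have tdist n : (0 < n < m)%N -> exists2 y, y \in O & r ((t ^+ n)%g y) != r y.
  move=> /andP[n_gt0 ltnm]; apply: contrapT => ny.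
  have : (m <= n)%N.
    apply: mmin; rewrite /P n_gt0; apply/asboolP => y yO.
    by apply/eqP/negPn/negP => yy; apply: ny; exists y.
  by rewrite leqNgt ltnm.
have tmn y n : y \in O -> r ((t ^+ (n * m))%g y) = r y.
  move=> yO; elim: n => [|n IHn]; first by rewrite gal_id.
  by rewrite mulSn addnC expgD galMv tm // gal_valring.
have mp2 : (m %| p ^ 2)%N.
  apply/negPn/negP; rewrite /dvdn -lt0n => mod0.
  have [|y yO] := tdist (p ^ 2 %% m)%N; first by rewrite mod0 ltn_pmod.
  suff -> : (t ^+ (p ^ 2 %% m))%g = (t ^- ((p ^ 2 %/ m) * m))%g.
    apply/negP; rewrite negbK.
    rewrite -(tmn _ (p ^ 2 %/ m)%N); last by rewrite gal_valring.
    by rewrite -galMv mulVg gal_id.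
  apply: (mulIg (t ^+ (p ^ 2 %/ m * m))%g).
  by rewrite mulVg -expgD addnC -divn_eq gal_exp.
have xO (s : gal_of {:M}) : s x / x \in O by apply: (val_unit (gal_unit w_gal s x0)).1.
have [m1|m_neq1] := eqVneq m 1%N; last first.
  exfalso.
  have [m' mE] : exists m', m = (p * m')%N.
    move: mp2 => /(dvdn_pfactor _ _ p_prime)[[|e] _ mE].
      by rewrite mE in m_neq1.
    by exists (p ^ e)%N; rewrite mE expnS.
  have xtm : r ((t ^+ m)%g x / x) = 1.
    by rewrite mE expgM (residue_twistX w_gal).
  have [b bO bN0] : exists2 b, b \in O &
      \sum_(n < m) r ((t ^+ n)%g x / x) * r ((t ^+ n)%g b) != 0.
    apply: contrapT => nb.
    have := dedekind_residue tdist (a := fun n => r ((t ^+ n)%g x / x)) _ (Ordinal m_gt0).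
    rewrite gal_id divff // residue1 => F; suff /eqP : 1 = 0 :> residue_field w.
      by rewrite oner_eq0.
    apply: F => b bO; apply/eqP/negPn/negP => b0; apply: nb; exists b => //.
  (* the Lagrange resolvent of Hilbert's theorem 90 *)
  pose S := \sum_(n < m) (t ^+ n)%g (x * b).
  have SE : S / x = \sum_(n < m) ((t ^+ n)%g x / x) * (t ^+ n)%g b.
    rewrite /S big_distrl; apply: eq_bigr => n _ /=.
    by rewrite rmorphM mulrAC.
  have SxO : S / x \in O.
    by rewrite SE rpred_sum // => n _; rewrite rpredM ?gal_valring.
  have rS : r (S / x) != 0.
    rewrite SE residue_sum; last by move=> n; rewrite rpredM ?gal_valring.
    by under eq_bigr do rewrite residueM ?gal_valring //.
  have wSx : w (S / x) = Some 0 by apply: val_eq0.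
  have wS : w S = w x.
    rewrite -[S](mulfVK x0) val_mul wSx; case: (w x) => //= g; first by rewrite add0r.
  have S0 : S != 0.
    by apply/eqP => S0; move: wSx; rewrite S0 mul0r val0.
  have tS : r (t S / S) = 1.
    have [tSO _] := val_unit (gal_unit w_gal t S0).
    apply/eqP; rewrite -subr_eq0 -residue1 -residueB ?rpred1 //.
    rewrite -(divff S0) -mulrBl.
    (* t S - S telescopes to t^m (x b) - x b *)
    have -> : t S - S = x * ((t ^+ m)%g x / x * (t ^+ m)%g b - b).
      rewrite mulrBr mulrA [x * _]mulrC mulfVK //.
      transitivity (\sum_(n < m) ((t ^+ n.+1)%g (x * b) - (t ^+ n)%g (x * b))).
        rewrite /S rmorph_sum -sumrB; apply: eq_bigr => n _.
        by rewrite expgSr galMv.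
      rewrite -(big_mkord xpredT (fun n => (t ^+ n.+1)%g (x * b) - (t ^+ n)%g (x * b))).
      by rewrite telescope_sumr // gal_id rmorphM.
    have xSO : x / S \in O.
      have [g wg] := val_neq0 w x0.
      by apply: (val_unit (val_div wg _)).1; rewrite wS.
    have tbO : (t ^+ m)%g b \in O by rewrite gal_valring.
    have ctbO : (t ^+ m)%g x / x * (t ^+ m)%g b \in O by exact: rpredM.
    rewrite mulrAC (residueM xSO (rpredB ctbO bO)) (residueB ctbO bO).
    by rewrite (residueM (xO _) tbO) xtm mul1r tm // subrr mulr0.
  have [e we] : exists e : E, w e%:A = w S.
    apply: (value_fixed galM w_gal h card_neq0 S0) => s.
    by have [n ->] := tE s; rewrite (residue_twistX w_gal).
  by have := wx e; rewrite we wS eqxx.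
have triv (s : gal_of {:M}) y : y \in O -> r (s y) = r y.
  have [n ->] := tE s; move=> yO; have := tmn y n yO.
  by rewrite m1 muln1.
have tp1 : (t ^+ p)%g != 1%g.
  apply/negP => /eqP tp.
  have : (#[t]%g %| p)%N by rewrite order_dvdn tp.
  have -> : #[t]%g = (p ^ 2)%N.
    by rewrite -card_gal; apply: eq_card => s; rewrite tgen.
  move=> /(dvdn_leq (prime_gt0 p_prime)).
  by rewrite -[X in (_ <= X)%N]expn1 leq_exp2l // prime_gt1.
have [z z0 rz1] := tame_ramification w_gal h card_neq0 tp1.
rewrite residue_twist_pow // in rz1; last by move=> y yO; exact: triv.
have [zO _] := val_unit (gal_unit w_gal t z0).
have rzp2 : r (t z / z) ^+ (p ^ 2) = 1.
  rewrite -residue_twist_pow //; last by move=> y yO; exact: triv.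
  by rewrite gal_exp gal_id divff // residue1.
have [a aE] : exists a, h a = r (t z / z).
  apply: (residue_fixed galM w_gal h_residue card_neq0 zO) => s.
  exact: triv.
exists a; rewrite -(fmorph_primitive_root h) aE.
have p2_gt0 : (0 < p ^ 2)%N by rewrite expn_gt0 prime_gt0.
have [n nprim np2] := prim_order_exists p2_gt0 rzp2.
move: np2 => /(dvdn_pfactor _ _ p_prime)[[|[|[|e]]] // _ nE].
- move: (prim_expr_order nprim) rz1; rewrite nE expr1 => ->.
  by rewrite expr1n eqxx.
- by move: (prim_expr_order nprim) rz1; rewrite nE expn1 => ->; rewrite eqxx.
- by rewrite -nE.
Qed.

End TameGaloisPrimeSquare.

(** * Inverses of Hahn series *)

Section NeumannLemma.
Variables (G : ordAbGroupType) (S : set G).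
Hypothesis S_wo : well_ordered S.
Hypothesis S_pos : forall s, S s -> 0 < s.

Definition word (l : seq G) : Prop := forall s, s \in l -> S s.

Definition monoid_span : set G :=
  [set g | exists2 l, word l & g = \sum_(s <- l) s].

Lemma monoid_span0 : monoid_span 0.
Proof. by exists [::]; rewrite ?big_nil. Qed.

Lemma monoid_spanD s g : S s -> monoid_span g -> monoid_span (s + g).
Proof.
move=> Ss [l Sl ->]; exists (s :: l); last by rewrite big_cons.
by move=> s'; rewrite inE => /orP[/eqP -> //|]; exact: Sl.
Qed.

Lemma word_sum_ge0 l : word l -> 0 <= \sum_(s <- l) s.
Proof.
elim: l => [|s l IHl] Sl; first by rewrite big_nil.
rewrite big_cons -[X in X <= _]addr0; apply: lexD.
  by apply/ltW/S_pos/Sl; rewrite mem_head.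
by apply: IHl => s' s'l; apply: Sl; rewrite inE s'l orbT.
Qed.

Let sumw (l : seq G) : G := \sum_(s <- l) s.

Let descending (f : nat -> seq G) :=
  (forall n, word (f n)) /\ forall n, sumw (f n.+1) < sumw (f n).

Let bad (l : seq G) := exists2 f, descending f & f 0%N = l.

Let bad_next l : bad l -> exists2 l', bad l' & sumw l' < sumw l.
Proof.
case=> f [fS fd] <-; exists (f 1%N); last exact: fd.
by exists (fun n => f n.+1); split=> // n.
Qed.

Let min_size (P : seq G -> Prop) : (exists l, P l) ->
  exists2 l, P l & forall l', P l' -> (size l <= size l')%N.
Proof.
move=> [l Pl]; have ex : exists n, `[< exists2 l, P l & size l = n >].
  by exists (size l); apply/asboolP; exists l.
have [n /asboolP[l0 Pl0 <-] nmin] := ex_minnP ex.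
by exists l0 => // l' Pl'; apply: nmin; apply/asboolP; exists l'.
Qed.

Let nondecreasing_indices (a : nat -> G) : (forall n, S (a n)) ->
  exists f : nat -> nat, (forall n, (f n < f n.+1)%N) /\
    forall n, a (f n) <= a (f n.+1).
Proof.
move=> aS.
have /boolp.choice[am amP] : forall n, exists m, (n <= m)%N /\
    forall m', (n <= m')%N -> a m <= a m'.
  move=> n; have [_ [m nm <-] mP] :=
    @S_wo [set a m | m in [set m | (n <= m)%N]]
      ltac:(by move=> _ [m _ <-]; exact: aS) (ex_intro _ (a n) (imageP a (leqnn n))).
  by exists m; split=> // m' nm'; apply: mP; exists m'.
exists (fun n => iter n (fun m => am m.+1) (am 0%N)); split=> n /=.
  by have [] := amP (iter n (fun m => am m.+1) (am 0%N)).+1.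
set m := iter n _ _.
have [_ mP] : (m <= m)%N /\ exists b, (b <= m)%N /\ forall m', (b <= m')%N -> a m <= a m'.
  split=> //; rewrite /m; case: n @m => [|n] m /=.
    by exists 0%N; have [? ?] := amP 0%N.
  by eexists; exact: amP.
have [b [bm mP']] := mP; apply: mP'; apply: leq_trans bm _.
by apply: leq_trans (leqnSn _) _; have [] := amP m.+1.
Qed.

(** Otherwise consider infinite sequences of words over S with decreasing sums,
    and build one greedily, taking each word as short as possible. Some
    subsequence has nondecreasing first letters; removing these letters keeps the
    sums decreasing and makes the first word of the subsequence shorter, against
    its choice (the minimal bad sequence argument of Nash-Williams). *)
Lemma neumann : well_ordered monoid_span.
Proof.
move=> U US [g0 Ug0]; apply: contrapT => nomin.
have /boolp.choice[nxt nxtP] : forall g, exists g', U g -> U g' /\ g' < g.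
  move=> g; have [Ug|] := pselect (U g); last by exists g.
  apply: contrapT => ng; apply: nomin; exists g => // x Ux.
  by rewrite lexNgt; apply/negP => xg; apply: ng; exists x.
have /boolp.choice[wd wdP] : forall g, exists l, U g -> word l /\ g = sumw l.
  move=> g; have [Ug|] := pselect (U g); last by exists [::].
  by have [l Sl gE] := US _ Ug; exists l.
have Uit n : U (iter n nxt g0).
  by elim: n => //= n Un; have [] := nxtP _ Un.
have bad0 : exists l, bad l.
  exists (wd g0), (fun n => wd (iter n nxt g0)) => //; split=> n.
    by have [] := wdP _ (Uit n).
  by rewrite -(wdP _ (Uit n)).2 -(wdP _ (Uit n.+1)).2; have [] := nxtP _ (Uit n).
have [l0 badl0 l0min] := min_size bad0.
have /boolp.choice[nx nxP] : forall l, exists l', bad l -> [/\ bad l', sumw l' < sumw l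
    & forall l'', bad l'' -> sumw l'' < sumw l -> (size l' <= size l'')%N].
  move=> l; have [bl|] := pselect (bad l); last by exists [::].
  have [|l' [bl' l'l] l'min] := @min_size (fun l' => bad l' /\ sumw l' < sumw l).
    by have [l' ? ?] := bad_next bl; exists l'.
  by exists l' => _; split=> // l'' ? ?; apply: l'min.
pose L n := iter n nx l0.
have badL n : bad (L n) by elim: n => //= n bn; have [] := nxP _ bn.
have LS n : word (L n) by have [f [fS _] <-] := badL n; exact: fS.
have Ld n : sumw (L n.+1) < sumw (L n) by have [] := nxP _ (badL n).
have LE n : L n = head 0 (L n) :: behead (L n).
  case E : (L n) (Ld n) => [|//]; rewrite {2}/sumw big_nil ltxNge.
  by rewrite word_sum_ge0.
have aS n : S (head 0 (L n)) by apply: (LS n); rewrite [L n]LE mem_head.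
have [f [fd fa]] := nondecreasing_indices aS.
have Ldn m n : (m < n)%N -> sumw (L n) < sumw (L m).
  elim: n => // n IHn; rewrite ltnS leq_eqVlt => /orP[/eqP -> //|/IHn].
  by apply: lt_trans; exact: Ld.
have sumL n : sumw (L n) = head 0 (L n) + sumw (behead (L n)).
  by rewrite {1}(LE n) /sumw big_cons.
have badt : bad (behead (L (f 0%N))).
  exists (fun n => behead (L (f n))) => //; split=> n.
    by move=> s sL; apply: (LS (f n)); rewrite [L _]LE inE sL orbT.
  have := Ldn _ _ (fd n); rewrite !sumL !ltxNge; apply: contra => le1.
  by apply: lexD.
have szt : (size (behead (L (f 0%N))) < size (L (f 0%N)))%N.
  by rewrite [X in (_ < size X)%N]LE.
case E : (f 0%N) => [|n] in badt szt.
  by have := l0min _ badt; rewrite leqNgt szt.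
have [_ _ /(_ _ badt)] := nxP _ (badL n); rewrite -[nx _]/(L n.+1) leqNgt szt.
move=> F; suff : false by []; apply: F; apply: le_lt_trans (Ld n).
rewrite sumL -{1}[sumw _]add0r lexD2rE; exact/ltW/S_pos.
Qed.

End NeumannLemma.

Lemma well_ordered_wf (G : ordAbGroupType) (T : set G) : well_ordered T ->
  well_founded (fun a b : G => [/\ T a, T b & a < b]).
Proof.
move=> wT x; apply: contrapT => nax.
have NT y : ~ Acc (fun a b : G => [/\ T a, T b & a < b]) y -> T y.
  by move=> ny; apply: contrapT => nT; apply: ny; constructor => z [].
have [m [Tm nam] mmin] :=
  wT [set y | T y /\ ~ Acc (fun a b : G => [/\ T a, T b & a < b]) y]
    ltac:(by move=> y []) (ex_intro _ x (conj (NT x nax) nax)).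
apply: nam; constructor => z [Tz _ zm]; apply: contrapT => nz.
by have := mmin z (conj Tz nz); rewrite lexNgt zm.
Qed.

Lemma well_ordered_shift (G : ordAbGroupType) (T : set G) c : well_ordered T ->
  well_ordered [set x | T (x + c)].
Proof.
move=> wT; apply: well_orderedS (well_orderedD (@well_ordered1 _ (- c)) wT).
by move=> x Tx; exists (- c) => //; rewrite opprK.
Qed.

Section HahnInverse.
Variables (G : ordAbGroupType) (A : nzRingType).
Hypothesis Adiv : division_ring A.
Variable V : G -> set A.
Hypothesis V0 : forall a, V a 0.
Hypothesis V1 : V 0 1.
Hypothesis VB : forall a x y, V a x -> V a y -> V a (x - y).
Hypothesis VM : forall a b x y, V a x -> V b y -> V (a + b) (x * y).
Hypothesis VV : forall a x y, V a x -> x * y = 1 -> V (- a) y.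

(** The subsets [V a] play the role of homogeneous components, so that the inverse
    of a series lies in the same graded subring. Comparing coefficients in
    X Y = 1 expresses Y in degree g through its values in degrees g - a, where a
    ranges over the positive differences between the support of X and its least
    element. By [neumann] these degrees stay in a well-ordered set, over which
    the recursion terminates. *)
Lemma hahn_inverse (X : G -> A) : well_ordered (supp X) ->
  (exists a, X a != 0) -> (forall a, V a (X a)) ->
  exists Y : G -> A, [/\ well_ordered (supp Y), forall a, V a (Y a)
    & conv X Y = (fun c => (c == 0)%:R)].
Proof.
move=> wX [a1 Xa1] XV.
have [a0 Xa0 a0min] : exists2 m, supp X m & forall x, supp X x -> m <= x.
  by apply: wX => //; exists a1.
have [c0 [c0X Xc0]] := Adiv Xa0.
pose X' a := if a == 0 then 0 else X (a + a0).
pose S := supp X'.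
have SX a : S a -> supp X (a + a0).
  by rewrite /S /supp /X' /=; case: (a == 0) => //; rewrite eqxx.
have S_wo : well_ordered S.
  by refine (well_orderedS _ (@well_ordered_shift _ _ a0 wX)) => a /SX.
have S_pos a : S a -> 0 < a.
  move=> Sa; rewrite lt_neqAle; apply/andP; split.
    by apply/eqP => a0'; move: Sa; rewrite /S /supp /X' /= -a0' !eqxx.
  by rewrite -(lexD2rE a0) add0r; apply/a0min/SX.
pose T := [set g | monoid_span S (g + a0)].
have T_wo : well_ordered T by exact: (@well_ordered_shift _ _ a0 (neumann S_wo S_pos)).
have Rwf := well_ordered_wf T_wo.
pose R a b := [/\ T a, T b & a < b].
pose F (g : G) (rec : forall g', R g' g -> A) : A :=
  if `[< T g >] then
    c0 * ((g == - a0)%:R - \sum_(a \in [set: G]) X' a *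
      match pselect (R (g - a) g) with left p => rec _ p | right _ => 0 end)
  else 0.
pose Y := Fix Rwf (fun _ => A) F.
have YE g : Y g = if `[< T g >] then
    c0 * ((g == - a0)%:R - conv X' Y g) else 0.
  rewrite /Y Fix_eq; last first.
    move=> x f g' fg; suff -> : f = g' by [].
    by apply: functional_extensionality_dep => y; apply/funext => q; exact: fg.
  rewrite -/Y /F; case: asboolP => // Tg; congr (_ * (_ - _)).
  apply: eq_fsbigr => a _; case: pselect => //= nR.
  have [X'a|X'a] := eqVneq (X' a) 0; first by rewrite X'a !mul0r.
  suff -> : Y (g - a) = 0 by [].
  rewrite /Y Fix_eq; last first.
    move=> x f g' fg; suff -> : f = g' by [].
    by apply: functional_extensionality_dep => y; apply/funext => q; exact: fg.
  rewrite {1}/F; case: asboolP => // Tga; case: nR; split=> //.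
  rewrite -{2}[g]addr0 lexD2ltE -(lexD2rtE a) addNr add0r.
  exact: S_pos.
have suppY g : supp Y g -> T g.
  by rewrite /supp /= YE; case: asboolP => //; rewrite eqxx.
have wY : well_ordered (supp Y) by apply: well_orderedS T_wo => g /suppY.
exists Y; split=> //.
- move=> g; elim/(well_founded_ind Rwf) : g => g IHg.
  rewrite YE; case: asboolP => // Tg.
  suff VT : V (g + a0) ((g == - a0)%:R - conv X' Y g).
    by have := VM (VV (XV a0) Xc0) VT; rewrite addrCA addNr addr0.
  apply: VB; first by case: eqP => [->|_]; rewrite ?addNr.
  have [r ur rP] := fiber_seq g S_wo wY.
  rewrite /conv (@fsum_seq _ _ _ r) //; last first.
    by move=> a N0; apply/rP; split; [exact: mul_neq0l N0 | exact: mul_neq0r N0].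
  rewrite big_seq; apply: (big_ind (V (g + a0))) => // [x y Vx Vy|a].
    by have := VB Vx (VB (V0 _) Vy); rewrite sub0r opprK.
  move=> /rP[Sa /suppY Tga].
  have -> : g + a0 = (a + a0) + (g - a) by rewrite addrAC addrCA subrr addr0.
  apply: VM; first by rewrite /X'; case: eqP.
  apply: IHg; split=> //.
  rewrite -{2}[g]addr0 lexD2ltE -(lexD2rtE a) addNr add0r.
  exact: S_pos.
- apply/funext => c.
  pose g := c - a0; have cE : c = g + a0 by rewrite subrK.
  pose e (a : G) : A := if a == 0 then X a0 else 0.
  have esupp : well_ordered (supp e).
    apply: well_orderedS (@well_ordered1 _ 0) => a.
    by rewrite /supp /e /=; have [->|_] := eqVneq a 0; rewrite ?eqxx.
  transitivity (conv (fun a => X' a + e a) Y g).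
    have bij : bijective (fun a : G => a + a0).
      by exists (fun a => a - a0) => a; rewrite ?addrK ?subrK.
    rewrite /conv (reindex_fsbigT _ _ bij); apply: eq_fsbigr => a _ /=.
    rewrite cE opprD addrACA subrr addr0; congr (_ * _).
    rewrite /X' /e; have [->|_] := eqVneq a 0; first by rewrite !add0r.
    by rewrite addr0.
  rewrite (convDl S_wo esupp wY).
  have -> : conv e Y g = X a0 * Y g.
    rewrite /conv (@fsum_seq _ _ _ [:: 0]) //.
      by rewrite big_seq1 /e eqxx subr0.
    by move=> a; rewrite /e inE; have [//|_] := eqVneq a 0; rewrite mul0r eqxx.
  rewrite YE -subr_eq0 -/g; case: asboolP => Tg.
    by rewrite mulrA Xc0 mul1r addrC subrK subr_eq0 -[_ == - a0]subr_eq0 opprK -cE.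
  rewrite mulr0 addr0.
  have -> : conv X' Y g = 0.
    rewrite /conv fsbig1 // => a _; apply/eqP/negPn/negP => N0.
    apply: Tg; rewrite /T /=.
    have -> : g + a0 = a + (g - a + a0) by rewrite [RHS]addrA (addrC a) -[g - a + a]addrA addNr addr0.
    apply: monoid_spanD; first exact: mul_neq0l N0.
    by apply/suppY/(mul_neq0r N0).
  case: eqP => // c0E; case: Tg; rewrite /T /= /g c0E subrK.
  exact: monoid_span0.
Qed.

End HahnInverse.

(** * The Mal'cev-Neumann ring as a ring of graded series *)

Section Monomials.
Variables (G : ordAbGroupType) (A : nzRingType).

Definition mono (g : G) (d : A) (a : G) : A := if a == g then d else 0.

Lemma mono_wo g d : well_ordered (supp (mono g d)).
Proof.
apply: well_orderedS (@well_ordered1 _ g) => a.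
by rewrite /supp /mono /=; have [->|_] := eqVneq a g; rewrite ?eqxx.
Qed.

Lemma conv_monor (X : G -> A) g d c : conv X (mono g d) c = X (c - g) * d.
Proof.
rewrite /conv (@fsum_seq _ _ _ [:: c - g]) //.
  by rewrite big_seq1 /mono opprB addrCA subrr addr0 eqxx.
move=> a; rewrite /mono inE; have [<-|_] := eqVneq (c - a) g.
  by rewrite opprB addrCA subrr addr0 eqxx.
by rewrite mulr0 eqxx.
Qed.

Lemma conv_monol (X : G -> A) g d c : conv (mono g d) X c = d * X (c - g).
Proof.
rewrite /conv (@fsum_seq _ _ _ [:: g]) //; first by rewrite big_seq1 /mono eqxx.
by move=> a; rewrite /mono inE; have [//|_] := eqVneq a g; rewrite mul0r eqxx.
Qed.

Lemma conv_comm (X Y : G -> A) : (forall a b, X a * Y b = Y b * X a) ->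
  conv X Y = conv Y X.
Proof.
move=> XY; apply/funext => c; rewrite /conv.
have bij : bijective (fun a : G => c - a).
  by exists (fun a => c - a) => a; rewrite opprB addrCA subrr addr0.
rewrite (reindex_fsbigT _ _ bij); apply: eq_fsbigr => a _ /=.
by rewrite opprB addrCA subrr addr0 XY.
Qed.

End Monomials.

Section MalcevNeumannAsGradedSeries.
Variables (F : fieldType) (A : falgType F) (K : splittingFieldType F).
Variables (iota : 'AHom(K, A)) (u : skolem_noether iota).
Variables (G : ordAbGroupType) (eps : gal_hom G K).

Local Notation D := (malcev_neumann u eps).

(** The eigenspace of A relative to s, spanned by [u s] over the centralizer. *)
Definition twisted (s : gal_of {:K}) : set A :=
  [set d | forall x, iota x * d = d * iota (s x)].

(** The image of f under the embedding into Hahn series over A that maps the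
    indeterminate of index a to the central indeterminate times [u (eps a)]. It
    turns the twisted multiplication into convolution, see [seriesM], and its
    image consists of the series with coefficient of degree a in
    [twisted (eps a)], see [series_exists]. *)
Definition series (f : D) (a : G) : A := u (eps a) * f a.

Lemma twisted_sn s : twisted s (u s).
Proof. by move=> x; rewrite (sn_conj u) !mulrA (mulrV (sn_unit u s)) mul1r. Qed.

Lemma twisted_series (f : D) a : twisted (eps a) (series f a).
Proof.
move=> x; rewrite /series mulrA twisted_sn -!mulrA; congr (_ * _).
by have /mem_centP -> := mn_cent f a.
Qed.

Lemma eps0 : eps 0 = 1%g.
Proof. by apply: (mulgI (eps 0)); rewrite -gal_homD addr0 mulg1. Qed.

Lemma epsN a : eps (- a) = (eps a)^-1%g.
Proof. by apply/(mulgI (eps a)); rewrite -gal_homD subrr eps0 mulgV. Qed.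

Lemma twistedM s t d e : twisted s d -> twisted t e -> twisted (s * t)%g (d * e).
Proof. by move=> sd te x; rewrite mulrA sd -mulrA te galMv mulrA. Qed.

Lemma twisted0 s : twisted s 0.
Proof. by move=> x; rewrite mulr0 mul0r. Qed.

Lemma twisted1 : twisted 1%g 1.
Proof. by move=> x; rewrite gal_id mulr1 mul1r. Qed.

Lemma twistedB s d e : twisted s d -> twisted s e -> twisted s (d - e).
Proof. by move=> sd se x; rewrite mulrBr mulrBl sd se. Qed.

Lemma twistedV s d e : twisted s d -> d * e = 1 -> e * d = 1 ->
  twisted s^-1%g e.
Proof.
move=> sd de ed x.
have {1}-> : x = s ((s^-1)%g x) by rewrite -galMv mulVg gal_id.
by rewrite -[LHS]mul1r -ed -!mulrA [d * _]mulrA -sd -!mulrA de mulr1.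
Qed.

Lemma twisted_cent d : twisted 1%g d -> d \in 'C(limg iota)%VS.
Proof. by move=> d1; apply/mem_centP => x; rewrite d1 gal_id. Qed.

Lemma supp_series (f : D) : supp (series f) = [set a | f a != 0].
Proof.
apply/funext => a; apply/propext; rewrite /supp /series /=.
by rewrite mulrI_eq0 //; exact/mulrI/sn_unit.
Qed.

Lemma series_wo (f : D) : well_ordered (supp (series f)).
Proof. by rewrite supp_series; exact: mn_wo. Qed.

Lemma seriesM (f g : D) : series (f * g) = conv (series f) (series g).
Proof. exact: (@utw_mul F A K iota u G eps f g (mn_wo f) (mn_wo g)). Qed.

Lemma seriesD (f g : D) a : series (f + g) a = series f a + series g a.
Proof. exact: mulrDr. Qed.

Lemma seriesN (f : D) a : series (- f) a = - series f a.
Proof. exact: mulrN. Qed.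

Lemma series0 a : series (0 : D) a = 0.
Proof. exact: mulr0. Qed.

Lemma series1 : series (1 : D) = mono 0 1.
Proof.
apply/funext => a; rewrite /series /mono /=.
by have [->|_] := eqVneq a 0; rewrite ?mulr0 // eps0 sn_id mulr1.
Qed.

Lemma series_inj (f g : D) : series f = series g -> f = g.
Proof.
move=> fg; apply: mnP => a; have := congr1 (fun h => h a) fg.
by rewrite /series => /(mulrI (sn_unit u _)).
Qed.

Lemma series_sum (I : finType) (f : I -> D) a :
  series (\sum_k f k) a = \sum_k series (f k) a.
Proof.
elim: (index_enum I) => [|k s IHs]; first by rewrite !big_nil series0.
by rewrite !big_cons seriesD IHs.
Qed.

Lemma series_exists (X : G -> A) : well_ordered (supp X) ->
  (forall a, twisted (eps a) (X a)) -> exists f : D, series f = X.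
Proof.
move=> wX tX; pose f a := (u (eps a))^-1 * X a.
have fX a : u (eps a) * f a = X a by rewrite /f mulVKr ?sn_unit.
have fC a : f a \in 'C(limg iota)%VS.
  apply: twisted_cent; rewrite -(mulVg (eps a)).
  apply: twistedM (tX a); apply: (twistedV (twisted_sn _)).
    exact/mulrV/sn_unit.
  exact/mulVr/sn_unit.
have wf : well_ordered [set a | f a != 0].
  apply: well_orderedS wX => a; rewrite /supp /= -fX.
  by apply: contra_neq => ufa; rewrite -(mulKr (sn_unit u (eps a)) (f a)) ufa mulr0.
by exists (MalcevNeumann fC wf); apply/funext => a; exact: fX.
Qed.

Lemma neq0_series (f : D) : f != 0 -> exists a, series f a != 0.
Proof.
move=> f0; apply: contrapT => nf; move/eqP: f0; apply.
apply: series_inj; apply/funext => a; rewrite series0.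
by apply/eqP/negPn/negP => fa; apply: nf; exists a.
Qed.

Hypothesis A_division : division_ring A.

(** It suffices to have right inverses of all nonzero elements. *)
Lemma malcev_neumann_division : division_ring D.
Proof.
have rinv (f : D) : f != 0 -> exists g, f * g = 1.
  move=> /neq0_series f0.
  have [|||||Y [wY tY XY]] := @hahn_inverse G A A_division
    (fun a => twisted (eps a)) _ _ _ _ _ (series f) (@series_wo f) f0
    (twisted_series f).
  - by move=> a; exact: twisted0.
  - by rewrite eps0; exact: twisted1.
  - by move=> a x y; exact: twistedB.
  - by move=> a b x y ax b_y; rewrite gal_homD; exact: twistedM.
  - move=> a x y ax xy; rewrite epsN; apply: (twistedV ax xy).
    have x0 : x != 0.
      by apply/eqP => x0; move/eqP: xy; rewrite x0 mul0r eq_sym oner_eq0.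
    have [z [zx xz]] := A_division x0.
    by rewrite -[y]mul1r -zx -[z * x * y]mulrA xy mulr1.
  have [g gY] := series_exists wY tY; exists g.
  apply: series_inj; rewrite seriesM gY XY series1.
  by apply/funext => c; rewrite /mono; case: eqP.
move=> f /[dup] f0 /rinv[g fg]; exists g; split=> //.
have /rinv[h gh] : g != 0.
  by apply/eqP => g0; move/eqP: fg; rewrite g0 mulr0 eq_sym oner_eq0.
suff -> : f = h by [].
by rewrite -[f]mulr1 -gh mulrA fg mul1r.
Qed.

Lemma const_exists (c : F) : exists f : D, series f = mono 0 c%:A.
Proof.
apply: series_exists => [|a]; first exact: mono_wo.
rewrite /mono; case: eqP => [->|_]; last exact: twisted0.
by rewrite eps0 => x; rewrite gal_id -scalerAr -scalerAl mulr1 mul1r.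
Qed.

Lemma const_morphism : exists kap : {rmorphism F -> D},
  forall c, series (kap c) = mono 0 c%:A.
Proof.
have /boolp.choice[f fE] := const_exists.
have fB : zmod_morphism f.
  move=> a b; apply: series_inj; apply/funext => c.
  rewrite seriesD seriesN !fE /mono; case: eqP => _; last by rewrite subr0.
  by rewrite scalerBl.
have fM : monoid_morphism f.
  split=> [|a b]; apply: series_inj.
    by rewrite series1 fE scale1r.
  apply/funext => c; rewrite seriesM !fE conv_monol subr0 /mono.
  by case: eqP => _; rewrite ?mulr0 // -scalerAl mul1r scalerA.
by have [kap kapE] := rmorphism_of fB fM; exists kap => c; rewrite kapE.
Qed.

Lemma central_series (f : D) : (forall a b, GRing.comm (series f a) b) ->
  ring_center f.
Proof.
move=> fc g; apply: series_inj; rewrite !seriesM; apply: conv_comm => a b.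
exact: fc.
Qed.

Hypothesis A_central : 'Z({:A})%VS = 1%VS.
Hypothesis K_galois : galois 1 {:K}.
Hypothesis eps_onto : forall s, exists g, eps g = s.

Lemma center_alg (z : A) : (forall d, z * d = d * z) -> exists c : F, z = c%:A.
Proof.
move=> zc; apply/vlineP; rewrite -A_central.
by rewrite memv_cap memvf; apply/centvP => d _; exact: zc.
Qed.

Lemma alg_center : range (fun c : F => iota c%:A) = ring_center (D := A).
Proof.
apply/seteqP; split=> z /=.
  by move=> [c _ <-] d; rewrite linearZ rmorph1 /= -scalerAr -scalerAl mulr1 mul1r.
by move=> /center_alg[c ->]; exists c => //; rewrite linearZ rmorph1.
Qed.

(** Commuting with the monomials with coefficient in [twisted s], for all s, forces
    the coefficients of z to commute with all of A, which is the sum of these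
    eigenspaces. A nonzero scalar is only twisted by the identity. *)
Lemma series_center (z : D) : ring_center z ->
  forall a, exists2 c : F, series z a = c%:A & c != 0 -> eps a = 1%g.
Proof.
move=> zc a.
have comm_tw s d : twisted s d -> series z a * d = d * series z a.
  move=> sd; have [g gs] := eps_onto s.
  have [f fE] : exists f : D, series f = mono g d.
    apply: series_exists => [|b]; first exact: mono_wo.
    by rewrite /mono; case: eqP => [->|_]; [rewrite gs | exact: twisted0].
  have := congr1 (fun h => series h (a + g)) (zc f).
  by rewrite /= !seriesM fE conv_monor conv_monol addrK.
have [c zE] : exists c : F, series z a = c%:A.
  apply: center_alg => d.
  have [e eE ->] := gal_eigen_sum (j := iota) K_galois alg_center d.
  rewrite mulr_sumr mulr_suml; apply: eq_bigr => s _.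
  by apply: (comm_tw s) => x; exact: eE.
exists c => // c0; apply/eqP/gal_eqP => x _; rewrite gal_id.
have := twisted_series z a x; rewrite zE -scalerAr -scalerAl mulr1 mul1r.
by move/(scalerI c0)/fmorph_inj.
Qed.

End MalcevNeumannAsGradedSeries.

(** * Valuations of the Mal'cev-Neumann ring *)

Section LexicographicGroup.
Variables G1 G2 : ordAbGroupType.

Definition lex_group : Type := (G1 * G2)%type.

HB.instance Definition _ := GRing.Zmodule.on lex_group.

Definition lex_le (x y : lex_group) : bool :=
  (x.1 < y.1) || ((x.1 == y.1) && (x.2 <= y.2)).

Fact lex_le_refl : reflexive lex_le.
Proof. by move=> x; rewrite /lex_le eqxx lexx orbT. Qed.

Fact lex_le_anti : antisymmetric lex_le.
Proof.
move=> [a b] [c d]; rewrite /lex_le /= => /andP[].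
move=> /orP[ac|/andP[/eqP -> bd]] /orP[ca|/andP[/eqP ca db]].
- by have := lt_trans ac ca; rewrite ltxx.
- by rewrite ca ltxx in ac.
- by rewrite ltxx in ca.
- by congr (_, _); apply/eqP; rewrite eq_le bd db.
Qed.

Fact lex_le_trans : transitive lex_le.
Proof.
move=> [a b] [c d] [e f]; rewrite /lex_le /=.
move=> /orP[ca|/andP[/eqP -> db]] /orP[ae|/andP[/eqP <- bf]].
- by rewrite (lt_trans ca ae).
- by rewrite ca.
- by rewrite ae.
- by rewrite eqxx (le_trans db bf) orbT.
Qed.

HB.instance Definition _ := Order.Le_isPOrder.Build ring_display lex_group
  lex_le_refl lex_le_anti lex_le_trans.

Fact lex_le_total : total (<=%R : rel lex_group).
Proof.
move=> [a b] [c d]; rewrite /Order.le /= /lex_le /=.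
have [<-|ac] := eqVneq a c; first by rewrite ltxx /=; exact: lex_total.
rewrite /= !orbF.
by rewrite !lt_neqAle ac eq_sym ac /=; exact: lex_total.
Qed.

Fact lex_le_add (z x y : lex_group) : x <= y -> x + z <= y + z.
Proof.
case: x y z => [a b] [c d] [e f]; rewrite /Order.le /= /lex_le /=.
by rewrite lexD2rtE lexD2rE (inj_eq (addIr e)).
Qed.

HB.instance Definition _ :=
  POrderedZmodule_isOrdAbGroup.Build lex_group lex_le_total lex_le_add.

Lemma lexE (x y : lex_group) :
  (x <= y) = (x.1 < y.1) || ((x.1 == y.1) && (x.2 <= y.2)).
Proof. by []. Qed.

End LexicographicGroup.

Lemma infty_le_refl (G : ordAbGroupType) (a : option G) : infty_le a a.
Proof. by case: a => //= g; exact: lexx. Qed.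

Section SeriesValuation.
Variables (F : fieldType) (A : falgType F) (K : splittingFieldType F).
Variables (iota : 'AHom(K, A)) (u : skolem_noether iota).
Variables (G : ordAbGroupType) (eps : gal_hom G K).
Hypothesis A_division : division_ring A.
Variables (H : ordAbGroupType) (w : valuation A H).

Local Notation D := (malcev_neumann u eps).

Definition lead (f : D) (m : G) : Prop :=
  series f m != 0 /\ forall a, series f a != 0 -> m <= a.

Lemma lead_exists (f : D) : f != 0 -> exists m, lead f m.
Proof.
move=> /neq0_series[a fa].
have [m fm mmin] : exists2 m, supp (series f) m & forall x, supp (series f) x -> m <= x.
  by apply: (@series_wo _ _ _ _ _ _ _ f) => //; exists a.
by exists m.
Qed.

Lemma lead_uniq (f : D) m n : lead f m -> lead f n -> m = n.
Proof.
move=> [fm mmin] [fn nmin]; apply/eqP; rewrite eq_le.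
by rewrite (mmin _ fn) (nmin _ fm).
Qed.

Lemma series_lt_lead (f : D) m a : lead f m -> a < m -> series f a = 0.
Proof.
move=> [_ mmin] am; apply/eqP/negPn/negP => /mmin.
by rewrite lexNgt am.
Qed.

Lemma division_mul_neq0 (x y : A) : x != 0 -> y != 0 -> x * y != 0.
Proof.
move=> x0 y0; have [z [zx _]] := A_division x0.
apply: contra_neq y0 => xy; by rewrite -[y]mul1r -zx -mulrA xy mulr0.
Qed.

Lemma seriesM_low (f g : D) m n : (forall a, a < m -> series f a = 0) ->
  (forall a, a < n -> series g a = 0) ->
  (forall a, a < m + n -> series (f * g) a = 0) /\
  series (f * g) (m + n) = series f m * series g n.
Proof.
move=> fm gn; split=> [c cmn|].
  rewrite seriesM /conv fsbig1 // => a _.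
  have [am|ma] := boolP (a < m); first by rewrite fm ?mul0r.
  rewrite gn ?mulr0 //; rewrite -lexNgt in ma.
  rewrite -(lexD2ltE a) [a + (c - a)]addrC subrK; apply: (lt_le_trans cmn).
  by rewrite lexD2rE.
rewrite seriesM /conv (@fsum_seq _ _ _ [:: m]) //.
  by rewrite big_seq1 [m + n]addrC addrK.
move=> a N0; rewrite inE eq_le; apply/andP; split.
  rewrite lexNgt; apply: contraNN N0 => ma; rewrite gn ?mulr0 //.
  by rewrite -(lexD2ltE a) [a + (_ - a)]addrC subrK lexD2rtE.
by rewrite lexNgt; apply: contraNN N0 => am; rewrite fm ?mul0r.
Qed.

Lemma leadM (f g : D) m n : lead f m -> lead g n ->
  lead (f * g) (m + n) /\ series (f * g) (m + n) = series f m * series g n.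
Proof.
move=> fm gn.
have [low mn] := seriesM_low (fun a => series_lt_lead fm (a := a))
  (fun a => series_lt_lead gn (a := a)).
split=> //; split; first by rewrite mn division_mul_neq0 ?fm.1 ?gn.1.
by move=> a fga; rewrite lexNgt; apply/negP => am; rewrite low ?eqxx in fga.
Qed.

(** The composite of the valuation by the least degree with w: the value of f is
    the pair formed by the least degree and the value of the coefficient there. *)
Lemma series_valuation : exists W : valuation D (lex_group G H),
  [/\ forall f g b, infty_le (Some ((g, b) : lex_group G H)) (W f) <->
        (forall a, a < g -> series f a = 0) /\
        infty_le (Some b) (w (series f g))
    & forall f m, lead f m ->
        W f = omap (fun b => (m, b) : lex_group G H) (w (series f m))].
Proof.
have /boolp.choice[V VP] : forall f : D, exists v : option (lex_group G H),
    (f = 0 -> v = None) /\ forall m, lead f m ->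
      v = omap (fun b => (m, b) : lex_group G H) (w (series f m)).
  move=> f; have [->|f0] := eqVneq f 0.
    by exists None; split=> // m []; rewrite series0 eqxx.
  have [m fm] := lead_exists f0.
  exists (omap (fun b => (m, b) : lex_group G H) (w (series f m))).
  split=> [f00|n fn]; first by rewrite f00 eqxx in f0.
  by rewrite (lead_uniq fm fn).
have Vlead f m : lead f m -> exists2 b, w (series f m) = Some b & V f = Some (m, b).
  move=> fm; have -> := (VP f).2 _ fm.
  case E : (w (series f m)) => [b|]; first by exists b.
  by have := fm.1; rewrite ((val_infty w _).1 E) eqxx.
have V_infty f : V f = None <-> f = 0.
  split; last exact: (VP f).1.
  have [//|/lead_exists[m /Vlead[b _ ->]]] := eqVneq f 0.
  by [].
have V_ge f g b : infty_le (Some ((g, b) : lex_group G H)) (V f) <->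
    (forall a, a < g -> series f a = 0) /\ infty_le (Some b) (w (series f g)).
  have [->|f0] := eqVneq f 0.
    rewrite ((V_infty 0).2 erefl) series0 ((val_infty w 0).2 erefl) /=.
    by split=> // _; split=> // a _; rewrite series0.
  have [m fm] := lead_exists f0; have [d wd ->] := Vlead _ _ fm.
  rewrite /infty_le lexE /=; split.
    move=> /orP[gm|/andP[/eqP -> bd]]; last first.
      by rewrite wd bd; split=> // a; exact: series_lt_lead.
    rewrite (series_lt_lead fm gm) ((val_infty w 0).2 erefl); split=> // a ag.
    by apply: (series_lt_lead fm); apply: lt_trans gm.
  move=> [low]; have : g <= m.
    by rewrite lexNgt; apply/negP => /low fm0; move: fm.1; rewrite fm0 eqxx.
  by rewrite le_eqVlt => /orP[/eqP -> | ->//]; rewrite wd eqxx => ->; rewrite orbT.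
have V_add x y : infty_le (infty_min (V x) (V y)) (V (x + y)).
  have: infty_le (infty_min (V x) (V y)) (V x) && infty_le (infty_min (V x) (V y)) (V y).
    by rewrite -infty_le_min infty_le_refl.
  case: (infty_min _ _) => [[g b]|].
    move=> /andP[/V_ge[xl xb] /V_ge[yl yb]]; apply/V_ge; split.
      by move=> a ag; rewrite seriesD xl ?yl ?addr0.
    rewrite seriesD; apply: infty_le_trans (val_add w _ _).
    by rewrite infty_le_min xb.
  case Ex : (V x) => [//|]; case Ey : (V y) => [//|] _.
  by rewrite ((V_infty x).1 Ex) ((V_infty y).1 Ey) addr0 ((V_infty 0).2 erefl).
have V_mul x y : V (x * y) = infty_add (V x) (V y).
  have [->|x0] := eqVneq x 0; first by rewrite mul0r ((V_infty 0).2 erefl).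
  have [->|y0] := eqVneq y 0.
    by rewrite mulr0 ((V_infty 0).2 erefl); case: (V x).
  have [m xm] := lead_exists x0; have [n yn] := lead_exists y0.
  have [xym xyE] := leadM xm yn.
  have [a wa ->] := Vlead _ _ xm; have [b wb ->] := Vlead _ _ yn.
  by rewrite ((VP _).2 _ xym) xyE val_mul wa wb.
exists (Valuation V_infty V_add V_mul); split=> // f m fm.
exact: (VP f).2.
Qed.

End SeriesValuation.

(** * The Mal'cev-Neumann ring as a vector space over its center *)

Section VectorFamilies.
Variables (F : fieldType) (A : falgType F) (i : {rmorphism F -> A}).
Hypothesis iE : forall c, i c = c%:A.

Lemma vspace_family (V : {vspace A}) : exists b : 'I_(\dim V) -> A,
  [/\ lin_free i b, lin_spans i b [set x | x \in V] & forall k, b k \in V].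
Proof.
exists (fun k => (vbasis V)`_k); split.
- move=> c c0 k; have /freeP := basis_free (vbasisP V); apply.
  by rewrite -[RHS]c0; apply: eq_bigr => l _; rewrite iE -scalerAl mul1r.
- move=> x xV; exists (fun k => coord (vbasis V) k x).
  by rewrite {1}(coord_vbasis xV); apply: eq_bigr => l _; rewrite iE -scalerAl mul1r.
- by move=> k; apply/vbasis_mem/mem_nth; rewrite size_tuple.
Qed.

Lemma card_lin_free (I : finType) (b : I -> A) : lin_free i b ->
  (#|I| <= \dim {:A})%N.
Proof.
move=> bfree; have [b' [_ b'span _]] := vspace_family {:A}.
have := card_free_le bfree b'span; rewrite card_ord; apply=> k /=.
exact: memvf.
Qed.

Lemma card_lin_basis (I : finType) (b : I -> A) : lin_free i b ->
  lin_spans i b setT -> #|I| = \dim {:A}.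
Proof.
move=> bfree bspan; apply/eqP; rewrite eqn_leq (card_lin_free bfree) /=.
have [b' [b'free _ _]] := vspace_family {:A}.
by have := card_free_le b'free bspan; rewrite card_ord; apply.
Qed.

End VectorFamilies.

Section MalcevNeumannBasis.
Variables (F : fieldType) (A : falgType F) (K : splittingFieldType F).
Variables (iota : 'AHom(K, A)) (u : skolem_noether iota).
Variables (G : ordAbGroupType) (eps : gal_hom G K).
Hypothesis A_division : division_ring A.
Hypothesis A_central : 'Z({:A})%VS = 1%VS.
Hypothesis K_galois : galois 1 {:K}.
Hypothesis eps_onto : forall s, exists g, eps g = s.

Local Notation D := (malcev_neumann u eps).

Let C := 'C(limg iota)%VS.
Let i : {rmorphism F -> A} := iota \o in_alg K.

Let iE c : i c = c%:A.
Proof. by rewrite /= linearZ rmorph1. Qed.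

Lemma sn_neq0 s : u s != 0.
Proof. by apply/eqP => us0; have := sn_unit u s; rewrite us0 unitr0. Qed.

Lemma cent_sn_basis : exists b : 'I_(\dim C) -> A,
  let bu (ks : 'I_(\dim C) * gal_of {:K}) := b ks.1 * u ks.2 in
  [/\ lin_free i bu, lin_spans i bu setT, lin_spans i b [set x | x \in C]
    & forall k, b k \in C].
Proof.
have [b [bfree bspan bC]] := vspace_family iE C; exists b => bu.
have [|||||bufree buspan] := @gal_basis _ _ _ iota K_galois A_division (alg_center iota A_central) _ b u.
- exact: sn_neq0.
- by move=> s x; exact: (twisted_sn u).
- by [].
- by move=> x xC; apply: bspan; apply/mem_centP.
- by move=> k; apply/mem_centP/bC.
by split.
Qed.

Lemma central_series_exists (l : G -> F) : well_ordered [set a | l a != 0] ->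
  (forall a, l a != 0 -> eps a = 1%g) ->
  exists2 z : D, ring_center z & forall a, series z a = (l a)%:A.
Proof.
move=> lwo l1; have [||z zE] := @series_exists _ _ _ _ u _ eps (fun a => (l a)%:A).
- apply: well_orderedS lwo => a; rewrite /supp /=.
  by apply: contra_neq => ->; rewrite scale0r.
- move=> a x; have [->|/l1 ->] := eqVneq (l a) 0; first by rewrite scale0r mulr0 mul0r.
  by rewrite gal_id -scalerAr -scalerAl mulr1 mul1r.
exists z => [|a]; last by rewrite zE.
by apply: central_series => a d; rewrite zE /GRing.comm -scalerAr -scalerAl mulr1 mul1r.
Qed.

Section Monomials.
Variables (b : 'I_(\dim C) -> A) (gam : gal_of {:K} -> G).
Variable B : 'I_(\dim C) * gal_of {:K} -> D.
Hypothesis gamE : forall s, eps (gam s) = s.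
Hypothesis bspan : lin_spans i b [set x | x \in C].
Hypothesis BE : forall ks, series (B ks) = mono (gam ks.2) (b ks.1 * u ks.2).

(** The coefficient of f in degree a lies in one eigenspace, the one of [eps a],
    and the degrees with eps a = s form a coset of the kernel of eps; so the
    degrees of one coset are collected in the central coefficients of the
    monomials of degree [gam s]. *)
Lemma monomials_span (f : D) : exists z : 'I_(\dim C) * gal_of {:K} -> D,
  (forall ks, ring_center (z ks)) /\ f = \sum_ks z ks * B ks.
Proof.
have /boolp.choice[lam lamE] : forall a, exists l : 'I_(\dim C) -> F,
    (series f a = 0 -> forall k, l k = 0) /\
    series f a = (\sum_k i (l k) * b k) * u (eps a).
  move=> a; have [fa0|fa0] := eqVneq (series f a) 0.
    exists (fun=> 0); split=> //; rewrite fa0 big1 ?mul0r // => k _.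
    by rewrite rmorph0 mul0r.
  have [|l lE] := bspan (x := series f a * (u (eps a))^-1).
    apply: twisted_cent; rewrite -(mulgV (eps a)).
    apply: (twistedM (twisted_series f a)).
    apply: (twistedV (twisted_sn u _)); first exact/mulrV/sn_unit.
    exact/mulVr/sn_unit.
  exists l; split=> [fa|]; first by rewrite fa eqxx in fa0.
  by rewrite -lE mulrVK ?sn_unit.
have /boolp.choice[z zP] : forall ks : 'I_(\dim C) * gal_of {:K}, exists z : D,
    ring_center z /\ forall a, series z a =
      (if eps a == 1%g then lam (a + gam ks.2) ks.1 else 0)%:A.
  move=> [k s]; have [||z zc zE] := @central_series_exists
    (fun a => if eps a == 1%g then lam (a + gam s) k else 0); last by exists z.
    apply: well_orderedS (@well_ordered_shift _ _ (gam s) (@series_wo _ _ _ _ u _ eps f)) => a.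
    rewrite /supp /=; case: (eps a =P 1%g) => _; last by rewrite eqxx.
    by apply: contraNneq => /(lamE _).1/(_ k) ->.
  by move=> a; case: (eps a =P 1%g) => //; rewrite eqxx.
exists z; split=> [ks|]; first exact: (zP ks).1.
apply: series_inj; apply/funext => a; rewrite series_sum.
transitivity (\sum_ks series (z ks) (a - gam ks.2) * (b ks.1 * u ks.2)); last first.
  by apply: eq_bigr => ks _; rewrite seriesM BE conv_monor.
transitivity (\sum_k \sum_s series (z (k, s)) (a - gam s) * (b k * u s)); last first.
  by rewrite pair_bigA; apply: eq_bigr => -[].
rewrite exchange_big (bigD1 (eps a)) //= [X in _ + X]big1 ?addr0.
  rewrite (lamE a).2 big_distrl; apply: eq_bigr => k _ /=.
  by rewrite (zP _).2 gal_homD epsN gamE mulgV eqxx subrK /= -[iota _]/(i _) iE mulrA.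
move=> s sa; rewrite big1 // => k _; rewrite (zP _).2 gal_homD epsN gamE.
by rewrite -eq_mulgV1 eq_sym (negPf sa) scale0r mul0r.
Qed.

End Monomials.

Let monomials : exists b gam (B : 'I_(\dim C) * gal_of {:K} -> D),
  [/\ lin_free i (fun ks => b ks.1 * u ks.2), lin_spans i b [set x | x \in C],
      forall s, eps (gam s) = s
    & forall ks, series (B ks) = mono (gam ks.2) (b ks.1 * u ks.2)].
Proof.
have [b [bfree _ bspan bC]] := cent_sn_basis.
have /boolp.choice[gam gamE] := eps_onto.
have /boolp.choice[B BE] : forall ks : 'I_(\dim C) * gal_of {:K},
    exists f : D, series f = mono (gam ks.2) (b ks.1 * u ks.2).
  move=> [k s]; apply: series_exists => [|a]; first exact: mono_wo.
  rewrite /mono; case: eqP => [->|_]; last exact: twisted0.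
  have b1 : twisted iota 1%g (b k).
    by move=> x; rewrite gal_id; have /mem_centP -> := bC k.
  by have := twistedM b1 (twisted_sn u s); rewrite mul1g gamE.
by exists b, gam, B.
Qed.

(** The dimension over the center is that of A over F. *)
Lemma malcev_neumann_basis (E : fieldType) (e : {rmorphism E -> D}) :
  range e = ring_center (D := D) ->
  exists B : 'I_(\dim C) * gal_of {:K} -> D,
    lin_free e B /\ lin_spans e B setT.
Proof.
move=> eE; have [b [gam [B [bfree bspan gamE BE]]]] := monomials.
exists B; split; last first.
  move=> f _; have [z [zc ->]] := monomials_span gamE bspan BE f.
  have /boolp.choice[c cE] : forall ks, exists c, e c = z ks.
    by move=> ks; have := zc ks; rewrite -eE => -[c _ <-]; exists c.
  by exists c; apply: eq_bigr => ks _; rewrite cE.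
move=> c c0.
have zc ks : ring_center (e (c ks)) by rewrite -eE; exists (c ks).
have /boolp.choice[lam lamE] : forall ks, exists l : G -> F,
    forall a, series (e (c ks)) a = (l a)%:A.
  move=> ks; have /boolp.choice[l lE] : forall a, exists l : F,
      series (e (c ks)) a = l%:A; last by exists l.
  by move=> a; have [l ? _] := series_center A_central K_galois eps_onto (zc ks) a; exists l.
move=> ks0; apply: (fmorph_inj e); rewrite rmorph0; apply: series_inj.
apply/funext => a; rewrite series0 lamE.
have := bfree (fun ks => lam ks (a + gam ks0.2 - gam ks.2)) _ ks0.
rewrite addrK => ->; first by rewrite scale0r.
have := congr1 (fun f : D => series f (a + gam ks0.2)) c0.
rewrite series_sum series0 => {2}<-; apply: eq_bigr => ks _.
by rewrite seriesM BE conv_monor lamE iE.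
Qed.

Lemma malcev_neumann_finite : finite_dim_over_center D.
Proof.
have [b [gam [B [_ bspan gamE BE]]]] := monomials.
exists #|{: 'I_(\dim C) * gal_of {:K}}|, (fun n => B (enum_val n)) => f.
have [z [zc ->]] := monomials_span gamE bspan BE f.
exists (fun n => z (enum_val n)); split=> //.
rewrite (reindex (fun n : 'I_#|{: 'I_(\dim C) * gal_of {:K}}| => enum_val n)) //.
exact/onW_bij/enum_val_bij.
Qed.

Lemma dim_cent_mul : (\dim C * #|{: gal_of {:K}}|)%N = \dim {:A}.
Proof.
have [b [bfree bspan _ _]] := cent_sn_basis.
by rewrite -(card_lin_basis iE bfree bspan) card_prod card_ord.
Qed.

End MalcevNeumannBasis.

(** * Maximal commutative subrings are self-centralizing *)

Section Bicommutant.
Variables (D : nzRingType) (S : set D).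
Hypothesis S_comm : forall x y, S x -> S y -> x * y = y * x.

Definition commutant (T : set D) : set D :=
  [set c | forall s, T s -> c * s = s * c].

(** The bicommutant replaces the subring generated by S: it is closed under
    inverses without any further construction. *)
Lemma bicommutant_comm_subring : comm_subring (commutant (commutant S)).
Proof.
have SC : S `<=` commutant S by move=> x Sx s Ss; exact: S_comm.
split.
- by move=> c _; rewrite mul1r mulr1.
- by move=> x y Tx Ty c Cc; rewrite mulrBl mulrBr Tx // Ty.
- by move=> x y Tx Ty c Cc; rewrite -mulrA Ty // mulrA Tx // mulrA.
- by move=> x y Tx Ty; apply: Tx => s /SC Cs; rewrite Ty.
Qed.

Lemma sub_bicommutant : S `<=` commutant (commutant S).
Proof. by move=> x Sx c Cc; rewrite Cc. Qed.

Lemma center_bicommutant : ring_center (D := D) `<=` commutant (commutant S).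
Proof. by move=> z zc c _; exact: zc. Qed.

Lemma bicommutant_inv x y : commutant (commutant S) x -> y * x = 1 ->
  x * y = 1 -> commutant (commutant S) y.
Proof.
move=> Tx yx xy c Cc.
by rewrite -[LHS]mulr1 -xy -!mulrA [c * _]mulrA -Tx // !mulrA yx mul1r.
Qed.

End Bicommutant.

Section SelfCentralizing.
Variables (D : nzRingType) (M : comNzRingType) (j : {rmorphism M -> D}).

Let add_one (d : D) : (forall x, d * j x = j x * d) ->
  forall x y, (range j `|` [set d]) x -> (range j `|` [set d]) y -> x * y = y * x.
Proof.
move=> dj x y [[a _ <-]|->] [[b _ <-]|->] //.
by rewrite -!rmorphM mulrC.
Qed.

Lemma maximal_comm_subalg_centralizes : maximal_comm_subalg (range j) ->
  [set c | forall x, c * j x = j x * c] `<=` range j.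
Proof.
move=> [_ jmax] d dj; pose S := range j `|` [set d].
apply: (jmax (commutant (commutant S))).
- split; last exact: center_bicommutant.
  exact/bicommutant_comm_subring/add_one.
- by apply: subset_trans (@sub_bicommutant _ _); left.
- by apply: (@sub_bicommutant _ _); right.
Qed.

Lemma maximal_subfield_centralizes : division_ring D ->
  maximal_subfield (range j) -> [set c | forall x, c * j x = j x * c] `<=` range j.
Proof.
move=> Ddiv [_ jmax] d dj; pose S := range j `|` [set d].
apply: (jmax (commutant (commutant S))).
- split; first exact/bicommutant_comm_subring/add_one.
  move=> x Tx x0; have [y [yx xy]] := Ddiv _ x0; exists y => //.
  exact: bicommutant_inv Tx yx xy.
- by apply: subset_trans (@sub_bicommutant _ _); left.
- by apply: (@sub_bicommutant _ _); right.
Qed.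

End SelfCentralizing.

(** * Galois extensions in a valued division ring *)

Section Restriction.
Variables (D : nzRingType) (H : ordAbGroupType) (W : valuation D H).
Variables (M : fieldType) (j : {rmorphism M -> D}).

Fact restrict_infty x : W (j x) = None <-> x = 0.
Proof.
split=> [/val_infty/eqP|->]; last by rewrite rmorph0; apply/val_infty.
by rewrite fmorph_eq0 => /eqP.
Qed.

Fact restrict_add x y :
  infty_le (infty_min (W (j x)) (W (j y))) (W (j (x + y))).
Proof. by rewrite rmorphD; exact: val_add. Qed.

Fact restrict_mul x y : W (j (x * y)) = infty_add (W (j x)) (W (j y)).
Proof. by rewrite rmorphM; exact: val_mul. Qed.

Definition restrict : valuation M H :=
  Valuation restrict_infty restrict_add restrict_mul.

End Restriction.

Section ResidueLink.
Variables (F : fieldType) (Gv : ordAbGroupType) (v : valuation F Gv).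
Variables (M : fieldType) (H : ordAbGroupType) (w : valuation M H).
Variable kap : {rmorphism F -> M}.
Hypothesis kap_ge0 : forall c, c \in valring v -> kap c \in valring w.
Hypothesis kap_pos : forall c, pos_val (v c) -> pos_val (w (kap c)).

Lemma residue_morphism : exists h : {rmorphism residue_field v -> residue_field w},
  forall c, c \in valring v -> h (residue v c) = residue w (kap c).
Proof.
have /boolp.choice[l lP] : forall a : residue_field v,
    exists c, c \in valring v /\ residue v c = a.
  by move=> a; have [c cO <-] := residue_surj a; exists c.
have lr c : c \in valring v -> residue w (kap (l (residue v c))) = residue w (kap c).
  move=> cO; have [lO lE] := lP (residue v c).
  apply/eqP; rewrite -subr_eq0 -residueB ?kap_ge0 // -rmorphB residue_eq0.
    by apply: kap_pos; rewrite -residue_eq0 ?rpredB // residueB // lE subrr.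
  by rewrite kap_ge0 ?rpredB.
have hB : zmod_morphism (fun a => residue w (kap (l a))).
  move=> a b; have [aO aE] := lP a; have [bO bE] := lP b.
  rewrite -{1}aE -{1}bE -residueB // lr ?rpredB // rmorphB residueB ?kap_ge0 //.
have hM : monoid_morphism (fun a => residue w (kap (l a))).
  split=> [|a b]; first by rewrite -(residue1 v) lr ?rpred1 // rmorph1 residue1.
  have [aO aE] := lP a; have [bO bE] := lP b.
  rewrite -{1}aE -{1}bE -residueM // lr ?rpredM // rmorphM residueM ?kap_ge0 //.
have [h hE] := rmorphism_of hB hM; exists h => c cO.
by rewrite hE lr.
Qed.

End ResidueLink.

Lemma rmorphism_factor (F M D : nzRingType) (kap : {rmorphism F -> D})
    (j : {rmorphism M -> D}) : injective j -> range kap `<=` range j ->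
  exists k : {rmorphism F -> M}, forall c, j (k c) = kap c.
Proof.
move=> j_inj kj.
have /boolp.choice[f fE] : forall c, exists x, j x = kap c.
  by move=> c; have [x _ <-] := kj _ (imageT kap c); exists x.
have [||k kE] := @rmorphism_of F M f; last by exists k => c; rewrite kE.
  by move=> a b; apply: j_inj; rewrite rmorphB !fE rmorphB.
by split=> [|a b]; apply: j_inj; rewrite ?rmorph1 ?rmorphM !fE ?rmorph1 ?rmorphM.
Qed.

Section GaloisValuations.
Variables (p : nat) (p_prime : prime p).
Variables (E : fieldType) (M : splittingFieldType E) (D : nzRingType).
Variable j : {rmorphism M -> D}.
Hypothesis galM : galois 1 {:M}.
Hypothesis Ddiv : division_ring D.
Hypothesis jE : range (fun e : E => j e%:A) = ring_center (D := D).
Hypothesis card_gal : #|{: gal_of {:M}}| = (p ^ 2)%N.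
Variables (F : fieldType) (kap : {rmorphism F -> D}).
Hypothesis kap_center : forall c, ring_center (kap c).

Lemma base_lift : exists k : {rmorphism F -> M},
  (forall c, j (k c) = kap c) /\ forall c, exists e : E, k c = e%:A.
Proof.
have [|k kE] := @rmorphism_factor F M D kap j (@fmorph_inj _ _ j).
  by move=> _ [c _ <-]; have := kap_center c; rewrite -jE => -[e _ <-]; exists e%:A.
exists k; split=> // c; have := kap_center c; rewrite -jE => -[e _ ekc].
by exists e; apply: (fmorph_inj j); rewrite kE.
Qed.

Section Link.
Variables (Gv H : ordAbGroupType) (v : valuation F Gv) (W : valuation D H).
Hypothesis W_ge0 : forall c, infty_le (Some 0) (v c) -> infty_le (Some 0) (W (kap c)).
Hypothesis W_pos : forall c, pos_val (v c) -> pos_val (W (kap c)).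
Hypothesis W_residue : forall z, ring_center z -> infty_le (Some 0) (W z) ->
  exists2 c, infty_le (Some 0) (v c) & pos_val (W (z - kap c)).

(** The residue field of E, inside that of M, is the image of the residue field of
    F, even if E is larger than F. *)
Lemma residue_link : exists h : {rmorphism residue_field v -> residue_field (restrict W j)},
  (forall e : E, e%:A \in valring (restrict W j) ->
     exists a, h a = residue (restrict W j) e%:A) /\
  (forall a, exists2 e : E, e%:A \in valring (restrict W j) &
     residue (restrict W j) e%:A = h a).
Proof.
have [k [kE kalg]] := base_lift.
have [||h hE] := @residue_morphism F Gv v M H (restrict W j) k.
- by move=> c cO; rewrite in_valring /= kE; exact: W_ge0.
- by move=> c cO; rewrite /= kE; exact: W_pos.
have kO c : c \in valring v -> k c \in valring (restrict W j).
  by move=> cO; rewrite in_valring /= kE; exact: W_ge0.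
exists h; split=> [e eO|a].
  have [|c cO ec] := W_residue _ eO; first by rewrite -jE; exists e.
  exists (residue v c); rewrite hE //; apply/esym/eqP.
  rewrite -subr_eq0 -residueB ?kO // residue_eq0 ?rpredB ?kO //=.
  by rewrite rmorphB kE.
have [c cO <-] := residue_surj a; have [e eE] := kalg c.
by exists e; rewrite -eE ?kO // hE.
Qed.

Let w_gal (s : gal_of {:M}) x : restrict W j (s x) = restrict W j x.
Proof. exact: (gal_val galM Ddiv jE). Qed.

Lemma unramified_galois_cyclic (ks : seq (residue_field v)) : Finite.axiom ks ->
  size ks <> 0 %[mod p] -> size ks <> 1 %[mod p] ->
  exists y (t : gal_of {:M}),
    [/\ infty_le (Some 0) (W (j y)),
        forall s s' : gal_of {:M}, s != s' -> ~~ pos_val (W (j (s y - s' y)))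
      & forall s : gal_of {:M}, s \in <[t]>%g].
Proof.
move=> ks_enum q0 q1; have [h [hr hl]] := residue_link.
(* in characteristic p the number of elements would be a power of p *)
have p_neq0 : (p%:R : residue_field v) != 0.
  apply/negP => p0; have [q_gt1 _ qnat _] := finite_field_facts ks_enum.
  apply: q0; apply/eqP; rewrite mod0n.
  have pk : p \in [pchar (residue_field v)] by rewrite inE p_prime.
  have pq : p.-nat (size ks).
    by apply: sub_in_pnat qnat => l _; rewrite (pcharf_eq pk).
  have [n qE] := p_natP pq; rewrite -/(dvdn p (size ks)) qE.
  by case: n qE => [qE|n _]; [rewrite qE in q_gt1 | rewrite expnS dvdn_mulr].
have [y [t [yO yinj tgen]]] := unramified_cyclic galM w_gal hr hl p_prime
  card_gal p_neq0 ks_enum q1.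
exists y, t; split=> // s s' ss'.
have := residue_eq0 (rpredB (_ : s y \in valring (restrict W j)) (_ : s' y \in valring (restrict W j))).
rewrite !(gal_valring w_gal) => /(_ yO yO) /= <-.
by rewrite residueB ?(gal_valring w_gal) // subr_eq0 (inj_eq yinj).
Qed.

Lemma ramified_galois_root_of_unity (t : gal_of {:M}) (x : M) : (p%:R : residue_field v) != 0 ->
  (~ exists z : residue_field v, (p ^ 2)%N.-primitive_root z) ->
  (forall s : gal_of {:M}, s \in <[t]>%g) -> x != 0 ->
  (forall e : E, W (j e%:A) != W (j x)) ->
  pos_val (W (j ((t ^+ p)%g x / x - 1))) -> False.
Proof.
move=> p_neq0 no_root tgen x0 wx tpx; have [h [hr hl]] := residue_link.
apply: no_root.
apply: (ramified_cyclic_unity_root galM w_gal hr p_prime card_gal p_neq0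
  tgen x0 wx).
have xO := (val_unit (gal_unit w_gal (t ^+ p)%g x0)).1.
apply/eqP; rewrite -subr_eq0 -(residue1 (restrict W j)) -residueB ?rpred1 //.
by rewrite residue_eq0 ?rpredB ?rpred1.
Qed.

End Link.
End GaloisValuations.

(** * Galois extensions in A *)

Section Extensions.
Variables (R S : nzRingType) (G H : ordAbGroupType) (f : R -> S).
Variables (v : valuation R G) (w : valuation S H).
Hypothesis vw : extends f v w.

Lemma extends_ge0 x : infty_le (Some 0) (w (f x)) = infty_le (Some 0) (v x).
Proof.
have [phi [phiD phile ->]] := vw; case: (v x) => //= g.
have <- : phi 0 = 0 by apply: (addrI (phi 0)); rewrite -phiD !addr0.
exact: phile.
Qed.

Lemma extends_pos x : pos_val (w (f x)) = pos_val (v x).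
Proof.
have [phi [phiD phile ->]] := vw; rewrite /pos_val; case: (v x) => //= g.
have <- : phi 0 = 0 by apply: (addrI (phi 0)); rewrite -phiD !addr0.
by rewrite phile.
Qed.

End Extensions.

Section CyclicAction.
Variables (N F : fieldType) (gT : finGroupType) (gb : gT -> {rmorphism N -> N}).
Hypothesis gbM : forall s t c, gb (s * t)%g c = gb t (gb s c).
Hypothesis gb1 : forall c, gb 1%g c = c.
Variable h : {rmorphism F -> N}.
Hypothesis gbh : forall s a, gb s (h a) = h a.

(** Among z, t z, ..., t^p z two coincide, as all are roots of P. So z is fixed by
    some t^m with 0 < m <= p, and t^p is a power of t^m. *)
Lemma fixed_by_power (p : nat) (t : gT) (P : {poly F}) z : prime p ->
  #[t]%g = (p ^ 2)%N -> P != 0 -> (size P <= p.+1)%N ->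
  root (map_poly h P) z -> gb (t ^+ p)%g z = z.
Proof.
move=> p_prime ot P0 szP Pz.
have gP s : root (map_poly h P) (gb s z).
  have -> : map_poly h P = map_poly (gb s) (map_poly h P).
    by apply/polyP => k; rewrite !coef_map /= gbh.
  by rewrite /root horner_map fmorph_eq0.
have /injectivePn[a [b ab tab]] :
    ~~ injectiveb (fun n : 'I_p.+1 => gb (t ^+ n)%g z).
  apply/negP => /injectiveP inj.
  have := @max_poly_roots _ (map_poly h P) [seq gb (t ^+ n)%g z | n : 'I_p.+1].
  rewrite map_poly_eq0 P0 map_inj_uniq ?enum_uniq // size_map -cardT card_ord.
  rewrite size_map_poly ltnNge szP => F1; suff : false by []; apply: F1 => //.
  by apply/allP => _ /mapP[n _ ->].
wlog ltab : a b ab tab / (a < b)%N.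
  move=> WL; have := ab; rewrite -val_eqE neq_ltn => /orP[|] lt.
    exact: (WL a b).
  by apply: (WL b a) => //; rewrite eq_sym.
have inj s : injective (gb s) by exact: fmorph_inj.
have tmz : gb (t ^+ (b - a))%g z = z.
  by apply: (inj (t ^+ a)%g); rewrite -gbM -expgD subnK ?(ltnW ltab).
have fixX s n : gb s z = z -> gb (s ^+ n)%g z = z.
  by move=> sz; elim: n => [|n IHn]; rewrite ?gb1 // expgSr gbM IHn.
have [bap|bap] := eqVneq (b - a)%N p; first by rewrite -bap.
have ba_lt : (b - a < p)%N.
  by rewrite ltn_neqAle bap (leq_trans (leq_subr _ _)) // -ltnS.
have cop : coprime #[t]%g (b - a).
  rewrite ot coprime_pexpl // prime_coprime // gtnNdvd //.
  by rewrite subn_gt0.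
have /cycleP[n ->] : (t ^+ p)%g \in <[t ^+ (b - a)]>%g.
  have : generator <[t]>%g (t ^+ (b - a))%g by rewrite generator_coprime.
  by rewrite /generator => /eqP <-; rewrite mem_cycle.
exact: fixX.
Qed.

End CyclicAction.

Section RamifiedElement.
Variables (F : fieldType) (K : splittingFieldType F) (p : nat).
Hypothesis K_galois : galois 1 {:K}.
Hypothesis K_degree : \dim {:K} = p.
Hypothesis p_gt1 : (1 < p)%N.
Variables (v : valuation F int) (H : ordAbGroupType) (w : valuation K H).
Hypothesis vw : extends (fun x : F => x%:A) v w.
Hypothesis w_gal : forall (s : gal_of {:K}) x, w (s x) = w x.
Hypothesis K_ramified : totally_ramified v K.

(** Total ramification is witnessed by some extension w' of v, a priori different
    from w. But an element integral for w is a root of a monic polynomial over the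
    valuation ring of v, hence integral for w'. So if w took all its values on F,
    then w' would too, against index p > 1. *)
Lemma ramified_element : exists2 x, x != 0 & forall c : F, w c%:A != w x.
Proof.
apply: contrapT => nx.
have wK x : x != 0 -> exists c : F, w c%:A = w x.
  move=> x0; apply: contrapT => nc; apply: nx; exists x => // c.
  by apply/eqP => wc; apply: nc; exists c.
have [H' [w' [vw' ind]]] := K_ramified.
have OO x : x \in valring w -> x \in valring w'.
  move=> xO; rewrite in_valring; apply/negPn/negP => w'x.
  have x0 : x != 0 by apply: contraNneq w'x => ->; rewrite val0.
  have [g wx] := val_neq0 w' x0.
  have [P PE] := orbit_poly K_galois x.
  have PO : map_poly (in_alg K) P \is a polyOver (valring w).
    rewrite PE rpred_prod // => s _; rewrite polyOverXsubC.
    by rewrite in_valring w_gal.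
  have cO n : (P`_n)%:A \in valring w'.
    have := polyOverP PO n; rewrite coef_map /= !in_valring.
    by rewrite (extends_ge0 vw) (extends_ge0 vw').
  have yO : x^-1 \in valring w'.
    move: w'x; rewrite in_valring (valV wx) wx /= -ltxNge => /ltW g0.
    by rewrite -(lexD2rE g) addNr add0r.
  have y_pos : pos_val (w' x^-1).
    move: w'x; rewrite /pos_val (valV wx) wx /= -!ltxNge => g0.
    by rewrite -(lexD2rtE g) addNr add0r.
  have ry : residue w' x^-1 = 0 by apply/eqP; rewrite residue_eq0.
  have Pmon : map_poly (in_alg K) P \is monic by rewrite PE monic_prod_XsubC.
  have Px : root (map_poly (in_alg K) P) x.
    by rewrite PE /root horner_prod (bigD1 1%g) //= hornerXsubC gal_id subrr mul0r.
  have szP : size (map_poly (in_alg K) P) = #|{: gal_of {:K}}|.+1.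
    rewrite PE size_prod_XsubC cardE.
    by rewrite -deprecated_filter_index_enum filter_predT.
  pose n := #|{: gal_of {:K}}|.
  (* P(x) = 0 divided by x^n: all terms but the leading one are in the maximal
     ideal of w' *)
  have : \sum_(k < n) (P`_k)%:A * x^-1 ^+ (n - k) = -1.
    move: Px; rewrite /root horner_coef szP big_ord_recr /=.
    have := Pmon; rewrite monicE lead_coefE szP /= => /eqP ->; rewrite mul1r.
    rewrite addr_eq0 => /eqP Px; apply: (mulIf (expf_neq0 n x0)).
    rewrite mulN1r -Px big_distrl; apply: eq_bigr => k _ /=.
    rewrite coef_map /= -mulrA; congr (_ * _).
    have -> : x ^+ n = x ^+ (n - k) * x ^+ k.
      by rewrite -exprD subnK // ltnW.
    by rewrite exprVn mulrA mulVf ?mul1r ?expf_neq0.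
  move/(congr1 (residue w')); rewrite residue_sum; last first.
    by move=> k; rewrite rpredM ?rpredX.
  rewrite big1; last first.
    move=> k _; rewrite residueM ?rpredX // residueX // ry expr0n.
    by rewrite subn_eq0 leqNgt ltn_ord mulr0.
  have := residueB (rpred0 (valring w')) (rpred1 (valring w')).
  rewrite sub0r => -> /eqP; rewrite residue0 residue1 sub0r eq_sym oppr_eq0.
  by rewrite oner_eq0.
have unit_eq x c : x != 0 -> w c%:A = w x -> w' c%:A = w' x.
  move=> x0 wc; have [g wx] := val_neq0 w x0.
  have c0 : c%:A != 0 :> K by apply/eqP => c0; move: wc; rewrite c0 val0 wx.
  have [g' wx'] := val_neq0 w' x0; have [g'' wc'] := val_neq0 w' c0.
  have xcO : x / c%:A \in valring w'.
    by apply/OO/(val_unit (val_div (g := g) _ _)).1; rewrite ?wc.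
  have cxO : c%:A / x \in valring w'.
    by apply/OO/(val_unit (val_div (g := g) _ _)).1; rewrite ?wc.
  move: xcO cxO; rewrite !in_valring !val_mul (valV wx') (valV wc') wx' wc' /=.
  rewrite -(lexD2rE g'') add0r subrK -[in X in _ -> X -> _](lexD2rE g') add0r subrK.
  by move=> le1 le2; congr Some; apply/eqP; rewrite eq_le le1 le2.
have [r [rH rP]] := ind; rewrite K_degree in r rH rP.
pose a : 'I_p := Ordinal (ltnW p_gt1); pose b : 'I_p := Ordinal p_gt1.
have [x xa] := rH a; have [y yb] := rH b.
have x0 : x != 0 by apply/eqP => x0; move: xa; rewrite x0 val0.
have y0 : y != 0 by apply/eqP => y0; move: yb; rewrite y0 val0.
have [m [_ muniq]] := rP _ (rH a).
have ma : m = a.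
  by apply: muniq; exists 1; rewrite scale1r Defs.val1 subrr.
have : m = b.
  apply: muniq; have [c wc] := wK (x / y) (mulf_neq0 x0 (invr_neq0 y0)).
  exists c; rewrite (unit_eq _ _ _ wc) ?mulf_neq0 ?invr_neq0 //.
  by rewrite val_mul (valV yb) xa.
by rewrite ma => /(congr1 val).
Qed.

End RamifiedElement.

Section GaloisCard.
Variables (F : fieldType) (K : splittingFieldType F).
Hypothesis K_galois : galois 1 {:K}.

Lemma card_gal_dim : #|{: gal_of {:K}}| = \dim {:K}.
Proof.
have := galois_dim K_galois; rewrite dimv1 divn1 => ->.
by apply: eq_card => s; rewrite mem_gal1.
Qed.

Lemma orbit_poly_size x (P : {poly F}) :
  map_poly (in_alg K) P = \prod_(s : gal_of {:K}) ('X - (s x)%:P) ->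
  size P = (\dim {:K}).+1.
Proof.
move=> PE; rewrite -(size_map_poly (in_alg K)) PE size_prod_XsubC -card_gal_dim.
by rewrite cardE -deprecated_filter_index_enum filter_predT.
Qed.

Lemma orbit_poly_root x (P : {poly F}) :
  map_poly (in_alg K) P = \prod_(s : gal_of {:K}) ('X - (s x)%:P) ->
  root (map_poly (in_alg K) P) x.
Proof.
move=> ->; rewrite /root horner_prod (bigD1 1%g) //=.
by rewrite hornerXsubC gal_id subrr mul0r.
Qed.

End GaloisCard.

Lemma ahom_horner (F : fieldType) (A : falgType F) (K : fieldExtType F)
    (f : 'AHom(K, A)) (P : {poly F}) x :
  f (map_poly (in_alg K) P).[x] = \sum_(k < size P) P`_k *: f x ^+ k.
Proof.
rewrite horner_coef size_map_poly rmorph_sum; apply: eq_bigr => k _.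
by rewrite coef_map rmorphM rmorphXn /= linearZ rmorph1 -scalerAl mul1r.
Qed.

Section GaloisMaximalSubfields.
Variables (p : nat) (F : fieldType) (A : falgType F).
Variables (K : splittingFieldType F) (iota : 'AHom(K, A)).
Variables (v1 v2 : valuation F int).
Hypothesis p_prime : prime p.
Hypothesis A_division : division_ring A.
Hypothesis A_central : 'Z({:A})%VS = 1%VS.
Hypothesis A_degree : \dim {:A} = ((p ^ 2) ^ 2)%N.
Hypothesis K_galois : galois 1 {:K}.
Hypothesis K_degree : \dim {:K} = p.
Hypothesis v1_ramified : totally_ramified v1 K.
Hypothesis v1_char : p \notin [pchar (residue_field v1)].
Hypothesis v1_mu : ~ exists z : residue_field v1, (p ^ 2)%N.-primitive_root z.
Hypothesis v2_finite : exists s : seq (residue_field v2), [/\ Finite.axiom s,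
  size s <> 0 %[mod p] & size s <> 1 %[mod p]].

Lemma v1_p_neq0 : (p%:R : residue_field v1) != 0.
Proof. by move: v1_char; rewrite inE p_prime. Qed.

Section Valuations.
Variables (G1 G2 : ordAbGroupType) (w1 : valuation A G1) (w2 : valuation A G2).
Hypothesis vw1 : extends (fun x : F => x%:A) v1 w1.
Hypothesis vw2 : extends (fun x : F => x%:A) v2 w2.

Lemma ramified_element_K :
  exists2 x : K, x != 0 & forall c : F, w1 (iota c%:A) != w1 (iota x).
Proof.
have vwK : extends (fun x : F => x%:A) v1 (restrict w1 iota).
  have [phi [phiD phile phiE]] := vw1; exists phi; split=> // x.
  by rewrite -phiE /= linearZ rmorph1.
have wg (s : gal_of {:K}) x : restrict w1 iota (s x) = restrict w1 iota x.
  exact: (gal_val K_galois A_division (alg_center iota A_central)).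
have [x x0 wx] := ramified_element K_galois K_degree (prime_gt1 p_prime) vwK wg
  v1_ramified.
by exists x.
Qed.

Let alg_residue (v : valuation F int) (G : ordAbGroupType) (w : valuation A G) :
  extends (fun x : F => x%:A) v w ->
  forall z, ring_center z -> infty_le (Some 0) (w z) ->
  exists2 c, infty_le (Some 0) (v c) & pos_val (w (z - in_alg A c)).
Proof.
move=> vw z /(center_alg A_central)[c ->] wz; exists c.
  by rewrite -(extends_ge0 vw).
by rewrite subrr ((val_infty w 0).2 erefl).
Qed.

(** The element of [ramified_element_K] lies in M, where [fixed_by_power] applies
    to it literally. *)
Lemma no_galois_self_centralizing (M : splittingFieldType F) (j : 'AHom(M, A)) :
  galois 1 {:M} -> range iota `<=` range j ->
  [set c | forall x, c * j x = j x * c] `<=` range j -> False.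
Proof.
move=> galM Kj selfc.
have jE := alg_center j A_central.
have card_gal : #|{: gal_of {:M}}| = (p ^ 2)%N.
  have [b [bfree bspan]] := gal_self_centralizing_basis galM A_division jE selfc.
  have iE c : (j \o in_alg M) c = c%:A by rewrite /= linearZ rmorph1.
  have := card_lin_basis iE bfree bspan.
  rewrite card_prod card_ord A_degree => /eqP.
  by rewrite mulnn eqn_exp2r // => /eqP.
have kapc c : ring_center (in_alg A c).
  by move=> x; rewrite /= -scalerAr -scalerAl mulr1 mul1r.
have [ks [ks_enum q0 q1]] := v2_finite.
have [||y [t [_ _ tgen]]] := unramified_galois_cyclic p_prime galM A_division jE card_gal kapc _ _
  (alg_residue vw2) ks_enum q0 q1.
- by move=> c; rewrite /= (extends_ge0 vw2).
- by move=> c; rewrite /= (extends_pos vw2).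
have ot : #[t]%g = (p ^ 2)%N.
  by rewrite -card_gal; apply: eq_card => s; rewrite tgen.
have [x x0 wx] := ramified_element_K.
have [X _ jX] := Kj _ (imageT iota x).
have X0 : X != 0.
  apply: contra_neq x0 => X0; apply: (fmorph_inj iota).
  by rewrite rmorph0; apply: etrans (esym jX) _; rewrite X0 rmorph0.
have [P PE] := orbit_poly K_galois x.
have szP := orbit_poly_size K_galois PE.
have tpX : (t ^+ p)%g X = X.
  have := @fixed_by_power M F _ (fun s : gal_of {:M} => (s : {rmorphism M -> M}))
    (@galMv _ M) (fun c => gal_id _ c) (in_alg M) (@gal_alg _ M) p t P X p_prime ot.
  apply.
  - by rewrite -size_poly_eq0 szP.
  - by rewrite szP K_degree.
  - apply/eqP/(fmorph_inj j); rewrite rmorph0.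
    have jP : j (map_poly (in_alg M) P).[X] = iota (map_poly (in_alg K) P).[x].
      by rewrite !ahom_horner jX.
    apply: etrans jP _.
    by have /eqP -> := orbit_poly_root PE; rewrite rmorph0.
apply: (ramified_galois_root_of_unity p_prime galM A_division jE card_gal kapc _ _
  (alg_residue vw1) v1_p_neq0 v1_mu tgen X0).
- by move=> c; rewrite /= (extends_ge0 vw1).
- by move=> c; rewrite /= (extends_pos vw1).
- move=> e; apply/eqP => eX; move/eqP: (wx e); apply.
  have wX : w1 (j X) = w1 (iota x) by rewrite jX.
  have we : w1 (iota e%:A) = w1 (j e%:A) by rewrite !linearZ !rmorph1.
  exact: etrans we (etrans eX wX).
- by rewrite tpX divff // subrr rmorph0 ((val_infty w1 0).2 erefl).
Qed.

End Valuations.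
End GaloisMaximalSubfields.

(** * Galois extensions in the Mal'cev-Neumann ring *)

Section MaximalOrbit.
Variables (F : fieldType) (A : falgType F).
Hypothesis A_division : division_ring A.
Hypothesis A_central : 'Z({:A})%VS = 1%VS.
Variables (N : fieldType) (gT : finGroupType) (gb : gT -> {rmorphism N -> N}).
Hypothesis gbM : forall s t c, gb (s * t)%g c = gb t (gb s c).
Hypothesis gb1 : forall c, gb 1%g c = c.
Variables (h : {rmorphism F -> N}) (phi : {rmorphism N -> A}).
Hypothesis gbh : forall s a, gb s (h a) = h a.
Hypothesis gb_fixed : forall c, (forall s, gb s c = c) -> exists a, h a = c.
Hypothesis phi_h : forall a, phi (h a) = a%:A.
Variable y : N.
Hypothesis y_inj : injective (fun s => gb s y).

Let i : {rmorphism F -> A} := in_alg A.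

Let i_central a x : i a * x = x * i a.
Proof. by rewrite /= -scalerAr -scalerAl mulr1 mul1r. Qed.

Let i_onto z : ring_center z -> exists a, i a = z.
Proof. by move=> /(center_alg A_central)[c ->]; exists c. Qed.

Let root_small (R : {poly F}) : (size R <= #|gT|)%N ->
  (map_poly h R).[y] = 0 -> R = 0.
Proof.
move=> szR Ry; suff : map_poly h R = 0 by move/eqP; rewrite map_poly_eq0 => /eqP.
apply: (@roots_geq_poly_eq0 _ _ [seq gb s y | s : gT]).
- apply/allP => _ /mapP[s _ ->]; rewrite /root.
  have -> : map_poly h R = map_poly (gb s) (map_poly h R).
    by apply/polyP => k; rewrite !coef_map /= gbh.
  by rewrite horner_map Ry rmorph0.
- by rewrite map_inj_uniq ?enum_uniq.
- by rewrite size_map -cardT size_map_poly.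
Qed.

Let eval_sum n (c : 'I_n -> F) :
  let R := \poly_(k < n) (if insub k is Some k' then c k' else 0) in
  phi (map_poly h R).[y] = \sum_(k < n) i (c k) * phi y ^+ k.
Proof.
move=> R; rewrite (@horner_coef_wide _ n) ?size_map_poly ?size_poly //.
rewrite rmorph_sum; apply: eq_bigr => k _.
by rewrite coef_map coef_poly ltn_ord valK rmorphM rmorphXn /= phi_h.
Qed.

Let pow_free : lin_free i (fun m : 'I_#|gT| => phi y ^+ m).
Proof.
move=> c c0 m; pose R : {poly F} := \poly_(k < #|gT|)
  (if insub k is Some k' then c k' else 0).
have : R = 0.
  apply: root_small; first exact: size_poly.
  by apply: (fmorph_inj phi); rewrite rmorph0 eval_sum.
by move/(congr1 (fun q : {poly F} => q`_m)); rewrite coef_poly ltn_ord valK coef0.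
Qed.

(** The |G| conjugates of y give |G| eigenspaces, each of the dimension of the
    centralizer of y. So this centralizer has dimension at most |G|, and it is
    spanned by the powers of y. *)
Lemma commuting_in_span x : (#|gT| ^ 2)%N = \dim {:A} ->
  x * phi y = phi y * x -> exists Q : {poly F}, phi (map_poly h Q).[y] = x.
Proof.
move=> dimA xy; have [P PE] := action_orbit_poly gbM gb_fixed y.
have pf : lin_free i (fun m : 'I_#|gT| => phi (gb 1%g y) ^+ m) by rewrite gb1.
have /boolp.choice[u uP] : forall s, exists d, d != 0 /\ eigen phi (fun s => gb s y) 1%g s d.
  move=> s; have [d d0 dP] := exists_eigen i_central A_division i_onto phi_h PE pf s.
  by exists d.
pose b (k : 'I_1 + 'I_#|gT|) := if k is inr m then phi y ^+ m else x.
have bcent k : b k * phi (gb 1%g y) = phi (gb 1%g y) * b k.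
  rewrite gb1; by case: k => [_|m] //=; rewrite -exprSr -exprS.
have /contrapT nfree : ~ ~ exists2 c : 'I_1 + 'I_#|gT| -> F,
    \sum_k i (c k) * b k = 0 & exists k, c k != 0.
  move=> nc; have bfree : lin_free i b.
    move=> c c0 k; apply/eqP/negPn/negP => ck; apply: nc.
    by exists c => //; exists k.
  have := free_eigen_mul i_central A_division y_inj PE (fun s => (uP s).2)
    (fun s => (uP s).1) bfree bcent.
  move/(card_lin_free (i := i) (fun c => erefl)).
  rewrite card_prod card_sum !card_ord add1n -dimA -mulnn leqNgt.
  by rewrite ltn_pmul2r ?ltnSn //; apply/card_gt0P; exists 1%g.
have [c c0 [k0 ck0]] := nfree.
move: c0; rewrite big_sumType /= big_ord1 /= => c0.
have cN : c (inl 0) != 0.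
  apply/eqP => cN; move: c0; rewrite cN scale0r mul0r add0r => /pow_free c0.
  by case: k0 ck0 => [m|m]; rewrite ?(ord1 m) ?cN ?c0 ?eqxx.
exists (\poly_(k < #|gT|)
  (if insub k is Some k' then - (c (inl 0))^-1 * c (inr k') else 0)).
rewrite (eval_sum (fun k => - (c (inl 0))^-1 * c (inr k))).
under eq_bigr do rewrite rmorphM -mulrA.
rewrite -big_distrr /=.
move/eqP: c0; rewrite addrC addr_eq0 => /eqP ->.
by rewrite mulrN -!scalerAl !mul1r scaleNr opprK scalerA mulVf // scale1r.
Qed.

End MaximalOrbit.

Section SeriesValuationFacts.
Variables (F : fieldType) (A : falgType F) (K : splittingFieldType F).
Variables (iota : 'AHom(K, A)) (u : skolem_noether iota).
Variables (G : ordAbGroupType) (eps : gal_hom G K).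
Variables (H : ordAbGroupType) (w : valuation A H).
Variable W : valuation (malcev_neumann u eps) (lex_group G H).
Hypothesis W_ge : forall f g b, infty_le (Some ((g, b) : lex_group G H)) (W f) <->
  (forall a, a < g -> series f a = 0) /\ infty_le (Some b) (w (series f g)).
Hypothesis W_lead : forall f m, lead f m ->
  W f = omap (fun b => (m, b) : lex_group G H) (w (series f m)).

Lemma series_val_ge0 f : infty_le (Some 0) (W f) <->
  (forall a, a < 0 -> series f a = 0) /\ infty_le (Some 0) (w (series f 0)).
Proof. exact: (W_ge f 0 0). Qed.

(** Residues for W only depend on the coefficients of degree 0. *)
Lemma series_val_pos f : pos_val (W f) <->
  (forall a, a < 0 -> series f a = 0) /\ pos_val (w (series f 0)).
Proof.
have lead0 : (forall a, a < 0 -> series f a = 0) -> series f 0 != 0 -> lead f 0.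
  move=> low f0; split=> // a fa; rewrite lexNgt; apply/negP => /low fa0.
  by rewrite fa0 eqxx in fa.
split=> [Wf|[low wf]].
  have Wf0 : infty_le (Some 0) (W f).
    move: Wf; rewrite /pos_val; case: (W f) => //= g.
    by rewrite -ltxNge => /ltW.
  have [low wf] := (series_val_ge0 f).1 Wf0; split=> //.
  apply/negP => wf0; have f0 : series f 0 != 0.
    by apply: contraTneq wf0 => ->; rewrite ((val_infty w 0).2 erefl).
  move: Wf; rewrite (W_lead (lead0 low f0)) /pos_val.
  case: (w _) wf wf0 => //= b b0 b0'; rewrite lexE /= eqxx ltxx /=.
  by rewrite b0'.
apply/negP => Wf0.
have f0 : f != 0 by apply: contraTneq Wf0 => ->; rewrite ((val_infty W 0).2 erefl).
have [m fm] := lead_exists f0.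
have m0 : 0 <= m.
  by rewrite lexNgt; apply/negP => /low fm0; move: fm.1; rewrite fm0 eqxx.
move: Wf0; rewrite (W_lead fm).
case E : (w (series f m)) => [b|]; last first.
  by move/(val_infty w): E => E; move: fm.1; rewrite E eqxx.
rewrite /infty_le /= lexE /= ltxNge m0 /= => /andP[/eqP m00 b0].
by move: wf; rewrite /pos_val -m00 E /= b0.
Qed.

End SeriesValuationFacts.

(** Extended to series, it gives the valuation by the least degree. *)
Lemma trivial_valuation (A : nzRingType) : division_ring A ->
  exists w : valuation A int, forall d, w d = if d == 0 then None else Some 0.
Proof.
move=> A_division; pose f (d : A) : option int := if d == 0 then None else Some 0.
have f1 d : f d = None <-> d = 0 by rewrite /f; case: eqP.
have f2 x y : infty_le (infty_min (f x) (f y)) (f (x + y)).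
  rewrite /f; have [->|x0] := eqVneq x 0.
    by rewrite add0r; case: (y == 0).
  have [->|y0] := eqVneq y 0; first by rewrite addr0 (negPf x0).
  by case: (x + y == 0).
have f3 x y : f (x * y) = infty_add (f x) (f y).
  rewrite /f; have [->|x0] := eqVneq x 0; first by rewrite mul0r eqxx.
  have [->|y0] := eqVneq y 0; first by rewrite mulr0 eqxx.
  have [z [zx _]] := A_division _ x0.
  case: eqP => [xy|_]; last by [].
  by move: y0; rewrite -[y]mul1r -zx -mulrA xy mulr0 eqxx.
by exists (Valuation f1 f2 f3).
Qed.

Section SeriesLink.
Variables (F : fieldType) (A : falgType F) (K : splittingFieldType F).
Variables (iota : 'AHom(K, A)) (u : skolem_noether iota).
Variables (G : ordAbGroupType) (eps : gal_hom G K).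
Hypothesis A_central : 'Z({:A})%VS = 1%VS.
Hypothesis K_galois : galois 1 {:K}.
Hypothesis eps_onto : forall s, exists g, eps g = s.

Local Notation D := (malcev_neumann u eps).

Variables (v : valuation F int) (H : ordAbGroupType) (w : valuation A H).
Hypothesis vw : extends (fun x : F => x%:A) v w.
Variable W : valuation D (lex_group G H).
Hypothesis W_ge : forall f g b, infty_le (Some ((g, b) : lex_group G H)) (W f) <->
  (forall a, a < g -> series f a = 0) /\ infty_le (Some b) (w (series f g)).
Hypothesis W_lead : forall f m, lead f m ->
  W f = omap (fun b => (m, b) : lex_group G H) (w (series f m)).
Variable kap : {rmorphism F -> D}.
Hypothesis kapE : forall c, series (kap c) = mono 0 c%:A.

Lemma kap_center c : ring_center (kap c).
Proof.
apply: central_series => a d; rewrite kapE /mono /GRing.comm.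
case: eqP => _; last by rewrite mul0r mulr0.
by rewrite -scalerAr -scalerAl mulr1 mul1r.
Qed.

Let kap_low c a : a < 0 -> series (kap c) a = 0.
Proof. by rewrite kapE /mono lt_neqAle => /andP[/negPf ->]. Qed.

Let kap0 c : series (kap c) 0 = c%:A.
Proof. by rewrite kapE /mono eqxx. Qed.

Lemma kap_ge0 c : infty_le (Some 0) (v c) -> infty_le (Some 0) (W (kap c)).
Proof.
move=> vc; apply/(series_val_ge0 W_ge); split; first exact: kap_low.
by rewrite kap0 (extends_ge0 vw).
Qed.

Lemma kap_pos c : pos_val (v c) -> pos_val (W (kap c)).
Proof.
move=> vc; apply/(series_val_pos W_ge W_lead); split; first exact: kap_low.
by rewrite kap0 (extends_pos vw).
Qed.

Lemma center_residue z : ring_center z -> infty_le (Some 0) (W z) ->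
  exists2 c, infty_le (Some 0) (v c) & pos_val (W (z - kap c)).
Proof.
move=> zc /(series_val_ge0 W_ge)[low wz].
have [c zE _] := series_center A_central K_galois eps_onto zc 0.
exists c; first by rewrite -(extends_ge0 vw) -zE.
apply/(series_val_pos W_ge W_lead); split=> [a a0|].
  by rewrite seriesD seriesN low // kap_low // subr0.
by rewrite seriesD seriesN zE kap0 subrr ((val_infty w 0).2 erefl).
Qed.

End SeriesLink.

Section MalcevNeumannNoncrossed.
Variables (p : nat) (F : fieldType) (A : falgType F).
Variables (K : splittingFieldType F) (iota : 'AHom(K, A)).
Variables (v1 v2 : valuation F int).
Hypothesis p_prime : prime p.
Hypothesis A_division : division_ring A.
Hypothesis A_central : 'Z({:A})%VS = 1%VS.
Hypothesis A_degree : \dim {:A} = ((p ^ 2) ^ 2)%N.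
Hypothesis K_galois : galois 1 {:K}.
Hypothesis K_degree : \dim {:K} = p.
Hypothesis v1_ramified : totally_ramified v1 K.
Hypothesis v1_char : p \notin [pchar (residue_field v1)].
Hypothesis v1_mu : ~ exists z : residue_field v1, (p ^ 2)%N.-primitive_root z.
Hypothesis v2_finite : exists s : seq (residue_field v2), [/\ Finite.axiom s,
  size s <> 0 %[mod p] & size s <> 1 %[mod p]].
Variables (H1 H2 : ordAbGroupType) (w1 : valuation A H1) (w2 : valuation A H2).
Hypothesis vw1 : extends (fun x : F => x%:A) v1 w1.
Hypothesis vw2 : extends (fun x : F => x%:A) v2 w2.

Variables (G : ordAbGroupType) (eps : gal_hom G K) (u : skolem_noether iota).
Hypothesis eps_onto : forall s, exists g, eps g = s.
Local Notation D := (malcev_neumann u eps).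

Variables (E : fieldType) (M : splittingFieldType E) (j : {rmorphism M -> D}).
Hypothesis galM : galois 1 {:M}.
Hypothesis jE : range (fun e : E => j e%:A) = ring_center (D := D).
Hypothesis selfc : [set c | forall x, c * j x = j x * c] `<=` range j.

Let Ddiv : division_ring D := @malcev_neumann_division _ _ _ _ u _ eps A_division.

Lemma malcev_card_gal : #|{: gal_of {:M}}| = (p ^ 2)%N.
Proof.
have [b [bfree bspan]] := gal_self_centralizing_basis galM Ddiv jE selfc.
have [B [Bfree Bspan]] :=
  malcev_neumann_basis (e := (j \o in_alg M : {rmorphism E -> D}))
    A_division A_central K_galois eps_onto jE.
have := card_free_le bfree Bspan (fun=> I).
have := card_free_le Bfree bspan (fun=> I).
rewrite !card_prod !card_ord.
rewrite (dim_cent_mul u A_division A_central K_galois) A_degree => le1 le2.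
have /eqP : (#|{: gal_of {:M}}| * #|{: gal_of {:M}}|)%N = ((p ^ 2) ^ 2)%N.
  by apply/eqP; rewrite eqn_leq le1 le2.
by rewrite mulnn eqn_exp2r // => /eqP.
Qed.

Lemma pF_neq0 : (p%:R : F) != 0.
Proof.
apply: contraNneq (v1_p_neq0 p_prime v1_char) => p0.
have : residue v1 p%:R = p%:R.
  elim: (p) => [|n IHn]; first by rewrite residue0.
  by rewrite !mulrS residueD ?rpred1 ?rpred_nat // residue1 IHn.
by rewrite p0 residue0 => <-.
Qed.

(** The valuation W0 by the least degree has as residue field of M a field N with
    an embedding phi in A by constant coefficients. The residue of the element y
    of [unramified_galois_cyclic] has p^2 conjugates in N, so phi maps the
    subfield that it generates onto one containing K by [commuting_in_span]. *)
Lemma malcev_no_galois_self_centralizing : False.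
Proof.
have card_gal := malcev_card_gal.
have [kap kapE] := const_morphism u eps.
have [W1 [W1_ge W1_lead]] := series_valuation u eps A_division w1.
have [W2 [W2_ge W2_lead]] := series_valuation u eps A_division w2.
have kapc := kap_center kapE.
have [ks [ks_enum q0 q1]] := v2_finite.
have [y [t [Wy ydist tgen]]] := unramified_galois_cyclic p_prime galM Ddiv jE card_gal kapc
  (kap_ge0 vw2 W2_ge kapE) (kap_pos vw2 W2_ge W2_lead kapE)
  (center_residue A_central K_galois eps_onto vw2 W2_ge W2_lead kapE) ks_enum q0 q1.
have ot : #[t]%g = (p ^ 2)%N.
  by rewrite -card_gal; apply: eq_card => s; rewrite tgen.
have [w0 w0E] := trivial_valuation A_division.
have [W0 [W0_ge W0_lead]] := series_valuation u eps A_division w0.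
pose wM := restrict W0 j.
have wM_gal (s : gal_of {:M}) x : wM (s x) = wM x by exact: (gal_val galM Ddiv jE).
have w0_ge0 d : infty_le (Some 0) (w0 d) by rewrite w0E; case: eqP.
have w0_pos d : pos_val (w0 d) = (d == 0) by rewrite w0E /pos_val; case: eqP.
have inO x : x \in valring wM <-> forall a, a < 0 -> series (j x) a = 0.
  rewrite in_valring; split=> [/(series_val_ge0 W0_ge)[]//|low].
  by apply/(series_val_ge0 W0_ge).
have [k [kE kalg]] := base_lift jE kapc.
have kO c : k c \in valring wM.
  apply/inO => a a0; rewrite kE kapE /mono.
  by move: a0; rewrite lt_neqAle => /andP[/negPf ->].
have [h hE] : exists h : {rmorphism F -> residue_field wM}, forall c, h c = residue wM (k c).
  have [||h hE] := @rmorphism_of F (residue_field wM) (fun c => residue wM (k c)).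
  - by move=> a b; rewrite rmorphB residueB.
  - by split=> [|a b]; rewrite ?rmorph1 ?residue1 // rmorphM residueM.
  by exists h.
(* residues for W0 are coefficients of degree 0 *)
have r0 x x' : x \in valring wM -> x' \in valring wM ->
    (residue wM x == residue wM x') = (series (j x) 0 == series (j x') 0).
  move=> xO xO'; rewrite -subr_eq0 -residueB // residue_eq0 ?rpredB //=.
  rewrite -[RHS]subr_eq0 -seriesN -seriesD -rmorphB -w0_pos.
  apply/idP/idP => [/(series_val_pos W0_ge W0_lead)[]//|pos].
  apply/(series_val_pos W0_ge W0_lead); split=> // a a0.
  by apply: (inO _).1 a a0; rewrite rpredB.
have [phi phiE] : exists phi : {rmorphism residue_field wM -> A},
    forall x, x \in valring wM -> phi (residue wM x) = series (j x) 0.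
  have /boolp.choice[l lP] : forall a : residue_field wM,
      exists x, x \in valring wM /\ residue wM x = a.
    by move=> a; have [x xO <-] := residue_surj a; exists x.
  have ls x : x \in valring wM -> series (j (l (residue wM x))) 0 = series (j x) 0.
    move=> xO; have [lO lE] := lP (residue wM x).
    by apply/eqP; rewrite -r0 // lE.
  have [||phi phiE] := @rmorphism_of (residue_field wM) A (fun a => series (j (l a)) 0).
  - move=> a b; have [aO aE] := lP a; have [bO bE] := lP b.
    rewrite -{1}aE -{1}bE -residueB // ls ?rpredB //.
    by rewrite rmorphB seriesD seriesN.
  - split=> [|a b].
      by rewrite -(residue1 wM) ls ?rpred1 // rmorph1 series1 /mono eqxx.
    have [aO aE] := lP a; have [bO bE] := lP b.
    rewrite -{1}aE -{1}bE -residueM // ls ?rpredM // rmorphM.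
    have [_] := seriesM_low ((inO _).1 aO) ((inO _).1 bO).
    by rewrite addr0.
  by exists phi => x xO; rewrite phiE ls.
have phi_h c : phi (h c) = c%:A by rewrite hE phiE // kE kapE /mono eqxx.
have h_lift a : exists2 e : E, e%:A \in valring wM & residue wM e%:A = h a.
  by have [e ke] := kalg a; exists e; rewrite -ke // hE.
have h_residue (e : E) : e%:A \in valring wM -> exists a, h a = residue wM e%:A.
  move=> eO; have zc : ring_center (j e%:A) by rewrite -jE; exists e.
  have [c zE _] := series_center A_central K_galois eps_onto zc 0.
  by exists c; apply/eqP; rewrite hE r0 // zE kE kapE /mono eqxx.
have card_neq0 : (#|{: gal_of {:M}}|%:R : F) != 0.
  by rewrite card_gal natrX expf_neq0 // pF_neq0.
have [gb [gbr gbM gb1 gbh]] := residue_action wM_gal h_lift.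
have gb_fixed c : (forall s, gb s c = c) -> exists a, h a = c.
  have [x xO <-] := residue_surj c => fx.
  apply: (residue_fixed galM wM_gal h_residue card_neq0 xO) => s.
  by rewrite -gbr.
have yO : y \in valring wM.
  by apply/inO => a a0; have [/(_ a a0)] := (series_val_ge0 W2_ge _).1 Wy.
have y_inj : injective (fun s => gb s (residue wM y)).
  move=> s s'; rewrite !gbr // => /eqP; rewrite r0 ?(gal_valring wM_gal) // => /eqP ss'.
  apply/eqP/negPn/negP => /ydist/negP; apply.
  apply/(series_val_pos W2_ge W2_lead); split.
    by apply/inO; rewrite rpredB ?(gal_valring wM_gal).
  by rewrite rmorphB seriesD seriesN ss' subrr ((val_infty w2 0).2 erefl).
have [x x0 wx] := ramified_element_K iota p_prime A_division A_central K_galois K_degree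
  v1_ramified vw1.
have iotax0 : iota x != 0 by rewrite fmorph_eq0.
have [||Q QE] := commuting_in_span A_division A_central gbM gb1 gbh gb_fixed phi_h
  y_inj (x := iota x).
- by rewrite card_gal A_degree.
- rewrite phiE // ; have := twisted_series (j y) 0 x.
  by rewrite eps0 gal_id.
(* an element of M with constant coefficient [iota x] *)
pose X := (map_poly k Q).[y].
have kyO c n : k c * y ^+ n \in valring wM by rewrite rpredM ?rpredX.
have XO : X \in valring wM.
  by rewrite /X horner_coef rpred_sum // => n _; rewrite coef_map; exact: kyO.
have rX : residue wM X = (map_poly h Q).[residue wM y].
  rewrite /X !horner_coef !size_map_poly residue_sum; last first.
    by move=> n; rewrite coef_map; exact: kyO.
  by apply: eq_bigr => n _; rewrite !coef_map /= residueM ?rpredX // residueX // hE.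
have X0E : series (j X) 0 = iota x by rewrite -phiE // rX.
have leadX : lead (j X) 0.
  split; first by rewrite X0E.
  move=> a fa; rewrite lexNgt; apply/negP => a0.
  by rewrite ((inO X).1 XO a a0) eqxx in fa.
have rX0 : residue wM X != 0.
  by apply: contra_neq iotax0 => rX0; rewrite -X0E -phiE // rX0 rmorph0.
have X0 : X != 0 by apply: contra_neq rX0 => ->; rewrite residue0.
have [P PE] := orbit_poly K_galois x.
have szP := orbit_poly_size K_galois PE.
have tpX : residue wM ((t ^+ p)%g X) = residue wM X.
  rewrite -gbr //; apply: (fixed_by_power gbM gb1 gbh p_prime ot (P := P)).
  - by rewrite -size_poly_eq0 szP.
  - by rewrite szP K_degree.
  - apply/eqP/(fmorph_inj phi); rewrite rmorph0.
    have := ahom_horner iota P x.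
    have /eqP -> := orbit_poly_root PE; rewrite rmorph0 => ->.
    rewrite horner_coef size_map_poly rmorph_sum; apply: eq_bigr => n _.
    by rewrite coef_map rmorphM rmorphXn /= phi_h phiE // X0E -scalerAl mul1r.
apply: (ramified_galois_root_of_unity p_prime galM Ddiv jE card_gal kapc
  (kap_ge0 vw1 W1_ge kapE) (kap_pos vw1 W1_ge W1_lead kapE)
  (center_residue A_central K_galois eps_onto vw1 W1_ge W1_lead kapE)
  (v1_p_neq0 p_prime v1_char) v1_mu tgen X0).
  move=> e; rewrite (W1_lead _ _ leadX) X0E.
  have [b wb] : exists b, w1 (iota x) = Some b.
    case E1 : (w1 _) => [b|]; first by exists b.
    by move/(val_infty w1): E1 => E1; rewrite E1 eqxx in iotax0.
  have [je0|je0] := eqVneq (j e%:A) 0.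
    by rewrite je0 ((val_infty W1 0).2 erefl) wb.
  have [m em] := lead_exists je0; rewrite (W1_lead _ _ em).
  have zc : ring_center (j e%:A) by rewrite -jE; exists e.
  have [c zE _] := series_center A_central K_galois eps_onto zc m.
  rewrite zE; have : w1 (iota c%:A) != w1 (iota x) by exact: wx.
  rewrite linearZ rmorph1 wb; apply: contraNN.
  by case: (w1 _) => //= b' /eqP[_ ->].
have wX : wM X = Some 0 by apply: val_eq0.
have tXO : (t ^+ p)%g X / X \in valring wM.
  by apply: (val_unit (gal_unit wM_gal _ X0)).1.
have : residue wM ((t ^+ p)%g X / X - 1) == 0.
  rewrite residueB ?rpred1 // residue1 residueM ?(gal_valring wM_gal) //; last first.
    by rewrite in_valring (valV wX) oppr0 /= lexx.
  by rewrite tpX residueV // divff // subrr.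
rewrite residue_eq0 ?rpredB ?rpred1 // => /(series_val_pos W0_ge W0_lead)[low].
rewrite w0_pos => /eqP z0.
by apply/(series_val_pos W1_ge W1_lead); rewrite z0 ((val_infty w1 0).2 erefl).
Qed.

End MalcevNeumannNoncrossed.

(** * Noncrossed products *)

Theorem theorem2p1 (p : nat) (F : fieldType) (A : falgType F)
    (K : splittingFieldType F) (iota : 'AHom(K, A)) (v1 v2 : valuation F int)
    (p_prime : prime p) (p_odd : odd p)
    (A_division : division_ring A) (A_central : 'Z({:A})%VS = 1%VS)
    (A_degree : \dim {:A} = ((p ^ 2) ^ 2)%N)
    (K_galois : galois 1 {:K}) (K_degree : \dim {:K} = p)
    (v1_discrete : discrete v1) (v2_discrete : discrete v2)
    (v1_extends : exists (G : ordAbGroupType) (w : valuation A G),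
      extends (fun x : F => x%:A) v1 w)
    (v2_extends : exists (G : ordAbGroupType) (w : valuation A G),
      extends (fun x : F => x%:A) v2 w)
    (v1_ramified : totally_ramified v1 K)
    (v1_char : p \notin [pchar (residue_field v1)])
    (v1_mu : ~ exists z : residue_field v1, (p ^ 2)%N.-primitive_root z)
    (v2_inertial : inertial v2 K)
    (v2_finite : exists s : seq (residue_field v2), [/\ Finite.axiom s,
      size s <> 0 %[mod p] & size s <> 1 %[mod p]]) :
  ~ (exists (M : splittingFieldType F) (j : 'AHom(M, A)),
       [/\ maximal_subfield (range j), range iota `<=` range j
         & galois 1 {:M}]) /\
  (forall (Gamma : ordAbGroupType) (eps : gal_hom Gamma K)
      (u : skolem_noether iota),
     range eps = [set s | s \in 'Gal({:K} / 1)%g] ->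
     noncrossed_product_division_algebra (malcev_neumann u eps)).
Proof.
have [G1 [w1 vw1]] := v1_extends; have [G2 [w2 vw2]] := v2_extends.
split.
  move=> [M [j [jmax Kj galM]]].
  apply: (no_galois_self_centralizing p_prime A_division A_central A_degree
    K_galois K_degree v1_ramified v1_char v1_mu v2_finite vw1 vw2 galM Kj).
  exact: (@maximal_subfield_centralizes _ _ j A_division jmax).
move=> Gamma eps u epsE.
have eps_onto s : exists g, eps g = s.
  have : [set s | s \in 'Gal({:K} / 1)%g] s by exact: mem_gal1.
  by rewrite -epsE => -[g _ <-]; exists g.
split.
- exact: malcev_neumann_division.
- exact: malcev_neumann_finite.
move=> [E [M [j [jE galM jmax]]]].
apply: (malcev_no_galois_self_centralizing p_prime A_division A_central A_degree
  K_galois K_degree v1_ramified v1_char v1_mu v2_finite vw1 vw2 eps_onto galM jE).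
exact: maximal_comm_subalg_centralizes.
Qed.
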